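(* In the linear model with measurement errors and the general subsampling scheme described in the context, suppose that: (A1) the matrix $\mathcal{H}_{W}=\frac{1}{n}\sum_{i=1}^{n}\mathbf{W}_{i}\mathbf{W}_{i}^{T}-\boldsymbol{\Sigma}_{uu}$ converges in probability to a positive definite matrix; (A2) $\frac{1}{n}\sum_{i=1}^{n}\|\mathbf{W}_{i}\|^{4}=O_{P}(1)$ and $\frac{1}{n}\sum_{i=1}^{n}(y_{i}-\mathbf{W}_{i}^{T}\hat{\boldsymbol{\beta}})^{4}=O_{P}(1)$; (A3) $\max_{i=1,\ldots,n}(n\pi_{i})^{-1}=O_{P}(1)$; (A4) there exists some $\delta>0$ such that $\frac{1}{n}\sum_{i=1}^{n}|y_{i}-\mathbf{W}_{i}^{T}\hat{\boldsymbol{\beta}}|^{2+\delta}\|\mathbf{W}_{i}\|^{2+\delta}=O_{P}(1)$. If $r=o(n)$, then as $r\to\infty$ and $n\to\infty$, $\tilde{\boldsymbol{\beta}}-\hat{\boldsymbol{\beta}}$ converges to a normal distribution in conditional probability given $\mathcal{F}_{n}$, that is, $$V^{-1/2}(\tilde{\boldsymbol{\beta}}-\hat{\boldsymbol{\beta}})\xrightarrow{d}N_{p}(\mathbf{0},I),$$ where $V=\mathcal{H}_{W}^{-1}V_{c}\mathcal{H}_{W}^{-1}$ and $$V_{c}=\frac{1}{rn^{2}}\sum_{i=1}^{n}\frac{(y_{i}-\mathbf{W}_{i}^{T}\hat{\boldsymbol{\beta}})^{2}\mathbf{W}_{i}\mathbf{W}_{i}^{T}}{\pi_{i}}-\fr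ac{1}{r}(\boldsymbol{\Sigma}_{uu}\hat{\boldsymbol{\beta}})(\boldsymbol{\Sigma}_{uu}\hat{\boldsymbol{\beta}})^{T}.$$
   Context: Model. For $i=1,\ldots,n$, $y_{i}=\mathbf{X}_{i}^{T}\boldsymbol{\beta}+\epsilon_{i}$ and $\mathbf{W}_{i}=\mathbf{X}_{i}+\mathbf{U}_{i}$, where $\mathbf{X}_{i}$ is a $p$-dimensional covariate vector, $y_i$ is the scalar response, $\boldsymbol{\beta}\in\mathbb{R}^{p}$ is unknown, $\epsilon_{i}$ is a random error with mean zero and variance $\sigma^{2}$, and $\mathbf{U}_{i}$ is a random measurement error vector with mean zero and known covariance matrix $\boldsymbol{\Sigma}_{uu}$, independent of $\epsilon_{i}$ and $\mathbf{X}_{i}$. Only $\mathbf{W}_i$ (not $\mathbf{X}_i$) is observed. The full data are $\mathcal{F}_{n}=\{(\mathbf{W}_{i},y_{i}):i=1,\ldots,n\}$. $\|\cdot\|$ is the Euclidean norm. Full-data estimator. $\hat{\boldsymbol{\beta}}=\arg\min_{\boldsymbol{\beta}}\ell(\boldsymbol{\beta})$ with $\ell(\boldsymbol{\beta})=\frac{1}{2n}\sum_{i=1}^{n}(y_{i}-\mathbf{W}_{i}^{T}\boldsymbol{\beta})^{2}-\frac12\boldsymbol{\beta}^{T}\boldsymbol{\Sigma}_{uu}\boldsymbol{\beta}$, i.e. $\hat{\boldsymbol{\beta}}=\big(\sum_{i=1}^{n}\mathbf{W}_{i}\mathbf{W}_{i}^{T}-n\boldsymbol{\Sigma}_{uu}\big)^{-1}\sum_{i=1}^{n}\mathbf{W}_{i}y_{i}$.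 General subsampling. Given subsampling probabilities $\pi_{1},\ldots,\pi_{n}$ with $\sum_{i=1}^{n}\pi_{i}=1$, a random subsample $\{(\mathbf{W}_{i}^{*},y_{i}^{*})\}_{i=1}^{r}$ of size $r$ is drawn from the full data with replacement according to $\{\pi_i\}$; $\pi_{i}^{*}$ denotes the subsampling probability of the $i$-th drawn data point. The subsample estimator is $\tilde{\boldsymbol{\beta}}=\arg\min_{\boldsymbol{\beta}}\ell^{*}(\boldsymbol{\beta})$, where $$\ell^{*}(\boldsymbol{\beta})=\frac{1}{2n}\sum_{i=1}^{r}\frac{1}{r\pi_{i}^{*}}(y_{i}^{*}-\mathbf{W}_{i}^{*T}\boldsymbol{\beta})^{2}-\frac12\boldsymbol{\beta}^{T}\boldsymbol{\Sigma}_{uu}\boldsymbol{\beta}.$$ Convention. Convergence to a normal distribution ''in conditional probability given $\mathcal{F}_n$'' means that the conditional distribution function given $\mathcal{F}_n$ converges in probability, at each point, to that of the limiting normal law. $N_p(\mathbf{0},I)$ is the $p$-dimensional standard normal distribution.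
   Formalization: The formal theorem additionally assumes that the smallest eigenvalue of rV_c is bounded away from zero in probability; without it V may vanish (σ=0, Σ_uu=0), or V may be positive definite while the standardized difference has no normal limit. *)

(* Defs.v *)
From HB Require Import structures.
From mathcomp Require Import all_boot all_order all_algebra.
From mathcomp Require Import all_classical all_reals all_analysis.
Set Implicit Arguments.
Unset Strict Implicit.
Unset Printing Implicit Defensive.
Import Order.TTheory GRing.Theory Num.Theory.
Import numFieldNormedType.Exports.
Local Open Scope classical_set_scope.
Local Open Scope ring_scope.

Section linear_algebra.
Context {R : realType} {p : nat}.
Implicit Types (u v x : 'cV[R]_p) (A S : 'M[R]_p).

Definition dot u v : R := (u^T *m v) 0 0.

Definition enorm u : R := Num.sqrt (\sum_a u a 0 ^+ 2).

Definition qform A u : R := (u^T *m A *m u) 0 0.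

Definition posdef A : Prop :=
  A^T = A /\ forall u, u != 0 -> 0 < qform A u.

(* For positive definite A this determines S uniquely. *)
Definition is_inv_sqrt A S : Prop := posdef S /\ S *m S = invmx A.

Definition is_argmin (l : 'cV[R]_p -> R) b : Prop := forall b', l b <= l b'.

(* Distribution function of N_p(0, I) at x: the coordinates are independent
   standard normal variables. *)
Definition std_normal_cdf x : R :=
  \prod_a fine (normal_prob (0 : R) (1 : R) `]-oo, x a 0]).

End linear_algebra.

Section probability.
Context d (T : measurableType d) (R : realType) (P : probability T R).

Definition measurable_mx m n (A : T -> 'M[R]_(m, n)) : Prop :=
  forall i j, measurable_fun [set: T] (fun w => A w i j).

Definition coords p (X : T -> 'cV[R]_p) : set (T -> R) :=
  [set f | exists a, f = fun w => X w a 0].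

Definition sigma_gen (Fs : set (T -> R)) : set (set T) :=
  <<s [set A | exists f B, [/\ Fs f, measurable B & A = f @^-1` B]] >>.

Definition independent (G1 G2 : set (set T)) : Prop :=
  forall A B, G1 A -> G2 B -> P (A `&` B) = (P A * P B)%E.

Definition measurable_wrt (G : set (set T)) (g : T -> R) : Prop :=
  forall B, measurable B -> G (g @^-1` B).

(* g is a version of the conditional probability P(E | G). *)
Definition is_cond_prob (G : set (set T)) (E : set T) (g : T -> R) : Prop :=
  [/\ measurable_wrt G g, P.-integrable [set: T] (EFin \o g) &
      forall A, G A -> (\int[P]_(w in A) (g w)%:E)%E = P (A `&` E)].

Definition cvg_in_prob (X : nat -> T -> R) (l : R) : Prop :=
  forall e : R, 0 < e -> P [set w | e < `|X n w - l|] @[n --> \oo] --> 0%E.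

(* X_n = O_P(1) *)
Definition bounded_in_prob (X : nat -> T -> \bar R) : Prop :=
  forall e : R, 0 < e -> exists M : R,
    \forall n \near \oo, (P [set w | M%:E < `|X n w|] <= e%:E)%E.

(* The smallest eigenvalue of the symmetric matrix A_n is bounded away from
   zero in probability. Applied to r Vc, the conditional covariance matrix of a
   single draw's contribution to the score: without it the standardization by
   V^{-1/2} need not have a normal limit, even if V is positive definite. *)
Definition nondegenerate_in_prob p (A : nat -> T -> 'M[R]_p) : Prop :=
  forall e : R, 0 < e -> exists2 c : R, 0 < c &
    \forall n \near \oo,
      (P [set w | ~ forall u, (c * enorm u ^+ 2 <= qform (A n w) u)%R] <= e%:E)%E.

End probability.

(* Data points are numbered from 0; a sample of size n uses the indices i < n
   of the sequences W, y (the values at one outcome). *)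
Section estimation.
Context {R : realType} {p : nat}.
Variables (Suu : 'M[R]_p) (W : nat -> 'cV[R]_p) (y : nat -> R).

Definition loss (n : nat) (b : 'cV[R]_p) : R :=
  (2 * n%:R)^-1 * \sum_(i < n) (y i - dot (W i) b) ^+ 2 - 2^-1 * qform Suu b.

(* J k is the index of the k-th drawn data point and pi i the subsampling
   probability of the data point i. *)
Definition subloss (n r : nat) (pi : nat -> R) (J : nat -> nat)
    (b : 'cV[R]_p) : R :=
  (2 * n%:R)^-1 * \sum_(k < r)
     (r%:R * pi (J k))^-1 * (y (J k) - dot (W (J k)) b) ^+ 2
  - 2^-1 * qform Suu b.

Definition HW (n : nat) : 'M[R]_p :=
  n%:R^-1 *: \sum_(i < n) W i *m (W i)^T - Suu.

Definition resid (bhat : 'cV[R]_p) (i : nat) : R := y i - dot (W i) bhat.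

Definition Vc (n r : nat) (pi : nat -> R) (bhat : 'cV[R]_p) : 'M[R]_p :=
  (r%:R * n%:R ^+ 2)^-1 *:
    \sum_(i < n) (resid bhat i ^+ 2 / pi i) *: (W i *m (W i)^T)
  - r%:R^-1 *: ((Suu *m bhat) *m (Suu *m bhat)^T).

Definition Vmx (n r : nat) (pi : nat -> R) (bhat : 'cV[R]_p) : 'M[R]_p :=
  invmx (HW n) *m Vc n r pi bhat *m invmx (HW n).

End estimation.

Section model.
Context d (T : measurableType d) (R : realType) (P : probability T R).
Context (p : nat).

Definition measurement_error_model (beta : 'cV[R]_p) (sigma : R)
    (Suu : 'M[R]_p) (X U : nat -> T -> 'cV[R]_p) (eps : nat -> T -> R)
    (W : nat -> T -> 'cV[R]_p) (y : nat -> T -> R) : Prop :=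
  forall i,
    [/\ measurable_mx (X i), measurable_mx (U i) &
        measurable_fun [set: T] (eps i)] /\
    [/\ forall w, y i w = dot (X i w) beta + eps i w &
        forall w, W i w = X i w + U i w] /\
    [/\ ('E_P[eps i] = 0)%E & ('V_P[eps i] = (sigma ^+ 2)%:E)%E] /\
    [/\ forall a, ('E_P[fun w => U i w a 0%R] = 0)%E &
        forall a b, covariance P (fun w => U i w a 0) (fun w => U i w b 0)
                    = (Suu a b)%:E] /\
    [/\ independent P (sigma_gen (coords (U i))) (sigma_gen [set eps i]) &
        independent P (sigma_gen (coords (U i))) (sigma_gen (coords (X i)))].

(* The sigma-algebra generated by the full data (W_i, y_i), i < n. *)
Definition data_sigma (W : nat -> T -> 'cV[R]_p) (y : nat -> T -> R)
    (n : nat) : set (set T) :=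
  sigma_gen (\bigcup_(i in [set i | (i < n)%N]) (coords (W i) `|` [set y i])).

(* Possibly data-dependent subsampling probabilities of n data points. *)
Definition sampling_probs (G : set (set T)) (n : nat) (pi : nat -> T -> R) :
    Prop :=
  [/\ forall i, (i < n)%N -> measurable_wrt G (pi i),
      forall i w, (i < n)%N -> 0 <= pi i w &
      forall w, \sum_(i < n) pi i w = 1].

(* Given G, the indices J 0, ..., J (r - 1) are drawn independently from
   {0, ..., n - 1} according to pi. *)
Definition drawn_with_replacement (G : set (set T)) (n r : nat)
    (pi : nat -> T -> R) (J : nat -> T -> nat) : Prop :=
  (forall k, (k < r)%N -> measurable_fun [set: T] (J k)) /\
  forall j : {ffun 'I_r -> 'I_n},
    is_cond_prob P G [set w | forall k : 'I_r, J k w = j k :> nat]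
      (fun w => \prod_(k < r) pi (j k) w).

(* bhat is a random vector that minimizes l_w at every outcome w where l_w has
   a minimizer; elsewhere its value is arbitrary. *)
Definition argmin_estimator (l : T -> 'cV[R]_p -> R) (bhat : T -> 'cV[R]_p) :
    Prop :=
  measurable_mx bhat /\
  forall w, (exists b, is_argmin (l w) b) -> is_argmin (l w) (bhat w).

End model.

(* Main.v *)
Require Import Defs.
From HB Require Import structures.
From mathcomp Require Import all_boot all_order all_algebra.
From mathcomp Require Import all_classical all_reals all_analysis.
From mathcomp Require Import measurable_realfun ring lra.
Import Order.TTheory GRing.Theory Num.Theory.
Import numFieldNormedType.Exports.
Local Open Scope classical_set_scope.
Local Open Scope ring_scope.

(** Given the data, the subsample is a sequence of [r] independent draws from a
    finite set, and everything about it is a finite sum. The normal equations of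
    the subsample and of the full data give
    [bt - bh = Hj^-1 *m Z], where [Hj] is the Hessian of the subsample and [Z] the
    mean over the draws of terms [xi] that have mean 0 ([xi_mean]) and covariance
    [r%:R *: Vc] ([xi_cov]). By Chebyshev's inequality [Hj] is close to the full
    Hessian [H] and [Z] is of order [r] to the power -1/2, so that [Hj] can be
    replaced by [H] ([linearization]). What remains is a sum of [r] independent
    terms with covariance matrix [r^-1] times the identity after multiplication
    by the inverse square root [S] of [V]. This sum is asymptotically normal by a
    Lindeberg argument.

    The law of the subsample depends on random data, so the central limit theorem
    is needed in a form that is uniform over data sets satisfying bounds with
    fixed constants ([uniform_clt]). The test functions are products over the
    coordinates of [gcdf ((c - x) / Num.sqrt t)], smoothings of the indicator of an
    orthant. They solve the heat equation, so adding one summand advances the time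
    [t] by [r^-1] up to an error of order [r^-2] plus the expectation of [kappa]
    ([heat_step], [lindeberg_step]). The total error tends to 0 by Lyapunov's
    condition ([kappa_stdz]), and the value at the end of the recursion is explicit.

    The assumptions say that, with a probability as close to 1 as desired, the
    data satisfy such bounds ([good], [good_event_compl]); the nondegeneracy of
    [r%:R *: Vc] enters by keeping [S] of order at most [Num.sqrt r%:R]
    ([good_S_le]). On this event the event [E] whose conditional probability is
    [F n] is sandwiched, up to the linearization error, between events that depend
    on the data and the drawn indices only, and the conditional law of the indices
    is the product of the sampling probabilities. This determines the conditional
    probability up to a small error, outside a null set ([cond_prob_lower],
    [cond_cdf_near]). The events must be measurable with respect to the data,
    whereas [bh] and [S] are only known as a minimizer and as a root. On the good
    event both are unique: the first is given by a formula, and the second depends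
    continuously on its square ([posdef_sqrt_stable], [measurable_root]). *)

(** * The standard normal distribution function *)

Section gaussian.
Context {R : realType}.
Implicit Types x d z : R.

Definition gpdf : R -> R := normal_pdf 0 1.
(** The factor of [std_normal_cdf] at one coordinate, to be treated as a smooth
    function of a real variable with bounded derivatives. *)
Definition gcdf x : R := fine (normal_prob (0 : R) (1 : R) `]-oo, x]).

Lemma gpdfE x : gpdf x = normal_peak 1 * expR (- (x ^+ 2 / 2)).
Proof.
rewrite /gpdf normal_pdfE ?oner_neq0// /normal_fun; congr (_ * expR _).
by rewrite subr0 expr1n mulNr -[1 *+ 2]/(2%:R).
Qed.

Lemma peak_le1 : normal_peak 1 <= 1 :> R.
Proof.
have := pi_ge2 R => pi2.
have pi1 : 1 <= pi *+ 2 :> R by rewrite -mulr_natr; lra.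
rewrite /normal_peak expr1n mul1r invf_le1 ?sqrtr_gt0; last exact: lt_le_trans pi1.
by rewrite -[X in X <= _]sqrtr1 ler_wsqrtr.
Qed.

Lemma gpdf_ge0 x : 0 <= gpdf x. Proof. exact: normal_pdf_ge0. Qed.

Lemma gpdf_le1 x : gpdf x <= 1.
Proof. by apply: le_trans peak_le1; apply: normal_pdf_ub; rewrite oner_neq0. Qed.

Lemma is_derive_gpdf x : is_derive x 1 gpdf (- x * gpdf x).
Proof.
rewrite (_ : gpdf = fun x => normal_peak 1 * expR (- (x ^+ 2 / 2))); last first.
  by apply/funext => ?; rewrite gpdfE.
apply: is_derive_eq; rewrite /GRing.scale/=.
by field.
Qed.

(** Fundamental theorem of calculus on a half-line, the density being
    continuous and integrable. *)
Lemma is_derive_gcdf x : is_derive x 1 gcdf (gpdf x).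
Proof.
have cphi : {for x, continuous gpdf}.
  by apply: continuous_normal_pdf; rewrite oner_neq0.
have xx1 : x < x + 1 by rewrite ltrDl.
have iphi : (@lebesgue_measure R).-integrable `]-oo, x + 1] (EFin \o gpdf).
  exact: (integrableS _ _ (@subsetT _ _) (@integrable_normal_pdf R 0 1)).
have [dF F'] := @continuous_FTC1 R gpdf -oo%O x (x + 1) xx1 iphi (ltNyr x) cphi.
by apply: DeriveDef; [exact: dF|rewrite -F' derive1E].
Qed.

(** From [expR u >= 1 + u] at [u = x ^+ 2 / 4], squared: the density is at
    most [(1 + x ^+ 2 / 4) ^- 2], which beats a cubic. *)
Lemma abs3_gpdf_le x : `|x| ^+ 3 * gpdf x <= 16.
Proof.
have e1 : (1 + x ^+ 2 / 4) ^+ 2 <= expR (x ^+ 2 / 2).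
  rewrite (_ : x ^+ 2 / 2 = x ^+ 2 / 4 + x ^+ 2 / 4); last by field.
  rewrite expRD -expr2 lerXn2r ?nnegrE ?expR_ge0 ?addr_ge0 ?divr_ge0 ?sqr_ge0//.
  exact: expR_ge1Dx.
rewrite gpdfE expRN.
set E := expR _ in e1 *; have E0 : 0 < E by exact: expR_gt0.
have k1 := peak_le1; have k0 : 0 <= normal_peak 1 :> R by exact: normal_peak_ge0.
apply: (@le_trans _ _ (`|x| ^+ 3 * E^-1)).
  by rewrite ler_wpM2l ?exprn_ge0// ler_piMl// invr_ge0 ltW.
rewrite ler_pdivrMr//; apply: (@le_trans _ _ (16 * (1 + x ^+ 2 / 4) ^+ 2)); last first.
  by rewrite ler_pM2l.
rewrite -[x ^+ 2]real_normK ?num_real//; have := normr_ge0 x; move: `|x| => t t0.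
rewrite exprS; have : 0 <= t ^+ 2 by rewrite sqr_ge0.
nra.
Qed.

Lemma abs_gpdf_le k x : (k <= 3)%N -> `|x| ^+ k * gpdf x <= 16.
Proof.
move=> k3; have [x1|x1] := leP `|x| 1.
  apply: (@le_trans _ _ (1 * 1)); last by rewrite mulr1 ler1n.
  by rewrite ler_pM ?exprn_ge0 ?gpdf_ge0 ?gpdf_le1// exprn_ile1.
apply: le_trans (abs3_gpdf_le x).
by rewrite ler_wpM2r ?gpdf_ge0// ler_weXn2l// ltW.
Qed.

Lemma gcdf_ge0 x : 0 <= gcdf x.
Proof. by rewrite fine_ge0. Qed.

Lemma gcdf_le1 x : gcdf x <= 1.
Proof.
rewrite -lee_fin fineK ?fin_num_measure//; exact: probability_le1.
Qed.

Lemma gcdf_homo : {homo gcdf : x y / x <= y}.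
Proof.
move=> x y xy; rewrite fine_le ?fin_num_measure//.
by rewrite le_measure ?inE//; exact: subitvPr.
Qed.

Let idR : measurableTypeR R -> R := idfun.

#[local] HB.instance Definition _ :=
  @isMeasurableFun.Build _ _ _ _ idR (@measurable_id _ _ setT).

(** Continuity of the measure along half-lines. *)
Lemma gcdf_tails (e : R) : 0 < e ->
  exists2 L, 0 < L & gcdf (- L) <= e /\ 1 - gcdf L <= e.
Proof.
move=> e0.
pose X : {RV (@normal_prob R 0 1) >-> R} := idR.
have cE x : cdf X x = (gcdf x)%:E.
  by rewrite /cdf /distribution /pushforward fineK// fin_num_measure.
have /fine_cvgP [_ h1] := cvg_cdfy1 X.
have /fine_cvgP [_ h0] := cvg_cdfNy0 X.
have /cvgr_dist_le/(_ _ e0) := h1; have /cvgr_dist_le/(_ _ e0) := h0.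
move=> [M0 [_ H0]] [M1 [_ H1]].
pose L := `|M0| + `|M1| + 1.
have L0 : 0 < L by rewrite ltr_wpDl ?addr_ge0.
exists L => //; split.
- have /H0 : - L < M0.
    rewrite /L; have := ler_norm (- M0); rewrite normrN.
    have := normr_ge0 M1; lra.
  rewrite (_ : (fine \o _) _ = gcdf (- L)); last by rewrite /comp cE.
  by rewrite sub0r normrN ger0_norm ?gcdf_ge0.
- have /H1 : M1 < L.
    rewrite /L; have := ler_norm M1; have := normr_ge0 M0; lra.
  rewrite (_ : (fine \o _) _ = gcdf L); last by rewrite /comp cE.
  by apply: le_trans; exact: ler_norm.
Qed.

(** The increment [d] may have either sign, so that no case distinction on it
    is left to the Taylor estimates below. *)
Lemma mean_value (f f1 : R -> R) x d : (forall x, is_derive x 1 f (f1 x)) ->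
  exists2 c, `|c| <= `|d| & f (x + d) - f x = f1 (x + c) * d.
Proof.
move=> df.
have cf a b : {within `[a, b], continuous f}.
  apply: continuous_subspaceT => u; apply: differentiable_continuous.
  by apply/derivable1_diffP; case: (df u).
have [d0|d0] := leP 0 d.
  have [c /itvP ci ->] := @MVT_segment R f f1 x (x + d) ltac:(lra)
    (fun u _ => df u) (cf _ _).
  have ci1 : x <= c by rewrite ci.
  have ci2 : c <= x + d by rewrite ci.
  exists (c - x); last by congr (f1 _ * _); ring.
  by rewrite !ger0_norm; lra.
have [c /itvP ci H] := @MVT_segment R f f1 (x + d) x ltac:(lra)
  (fun u _ => df u) (cf _ _).
have ci1 : x + d <= c by rewrite ci.
have ci2 : c <= x by rewrite ci.
exists (c - x).
  by rewrite (ltr0_norm d0) ler0_norm; lra.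
by rewrite -opprB H (_ : x + (c - x) = c); ring.
Qed.

(** The mean value theorem twice. The point [x + c] is kept, instead of a
    supremum, because the second derivative will be weighed against its
    argument. *)
Lemma taylor2 (f f1 f2 : R -> R) x d :
  (forall x, is_derive x 1 f (f1 x)) -> (forall x, is_derive x 1 f1 (f2 x)) ->
  exists2 c, `|c| <= `|d| & `|f (x + d) - f x - f1 x * d| <= `|f2 (x + c)| * d ^+ 2.
Proof.
move=> df df1.
pose g (t : R) := f t - f1 x * t.
have dg (t : R) : is_derive t 1 g (f1 t - f1 x).
  by apply: is_derive_eq; rewrite /GRing.scale/= mulr1.
have [c cd gE] := mean_value g _ x d dg.
have [b bc f1E] := mean_value f1 _ x c df1.
exists b; first exact: le_trans bc cd.
rewrite (_ : f (x + d) - f x - f1 x * d = g (x + d) - g x); last by rewrite /g; ring.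
rewrite gE f1E !normrM -mulrA ler_wpM2l//.
by rewrite -[d ^+ 2]real_normK ?num_real// expr2 ler_wpM2r.
Qed.

(** The mean value theorem three times, which costs a factor 6 against the
    usual remainder. *)
Lemma taylor3 (f f1 f2 f3 : R -> R) x d :
  (forall x, is_derive x 1 f (f1 x)) -> (forall x, is_derive x 1 f1 (f2 x)) ->
  (forall x, is_derive x 1 f2 (f3 x)) ->
  exists2 c, `|c| <= `|d| &
    `|f (x + d) - f x - f1 x * d - f2 x / 2 * d ^+ 2| <= `|f3 (x + c)| * `|d| ^+ 3.
Proof.
move=> df df1 df2.
pose g (t : R) := f t - f2 x / 2 * (t - x) ^+ 2.
have dg (t : R) : is_derive t 1 g (f1 t - f2 x * (t - x)).
  apply: is_derive_eq; rewrite /GRing.scale/=; lra.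
pose g1 (t : R) := f1 t - f2 x * (t - x).
have dg1 (t : R) : is_derive t 1 g1 (f2 t - f2 x).
  by apply: is_derive_eq; rewrite /GRing.scale/=; ring.
pose k (t : R) := g t - g1 x * t.
have dk (t : R) : is_derive t 1 k (g1 t - g1 x).
  by apply: is_derive_eq; rewrite /GRing.scale/= mulr1.
have [c cd kE] := mean_value k _ x d dk.
have [b bc g1E] := mean_value g1 _ x c dg1.
have [a ab f2E] := mean_value f2 _ x b df2.
exists a; first exact: le_trans ab (le_trans bc cd).
rewrite (_ : _ - _ - _ - _ = k (x + d) - k x); last by rewrite /k /g /g1; ring.
rewrite kE g1E f2E !normrM -!mulrA ler_wpM2l// !exprS expr0 mulr1.
by rewrite ler_pM ?mulr_ge0 ?ler_pM// (le_trans bc).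
Qed.

Lemma is_derive_gpdf1 x : is_derive x 1 (fun x => - x * gpdf x) ((x ^+ 2 - 1) * gpdf x).
Proof.
have := is_derive_gpdf x => h.
by apply: is_derive_eq; rewrite /GRing.scale/=; ring.
Qed.

Lemma gcdf_lip x y : `|gcdf x - gcdf y| <= `|x - y|.
Proof.
have [c _] := mean_value gcdf _ y (x - y) is_derive_gcdf.
rewrite (_ : y + (x - y) = x); last by ring.
move=> ->; rewrite normrM ler_piMl//.
by rewrite ger0_norm ?gpdf_ge0 ?gpdf_le1.
Qed.

(** The remainder is cubic for small [d] and quadratic for large [d]. With a
    cubic bound alone the summands of the central limit theorem would need a
    third moment, whereas [2 + delta] moments dominate this one. *)
Lemma gcdf_taylor x d :
  `|gcdf (x + d) - gcdf x - gpdf x * d + x * gpdf x / 2 * d ^+ 2|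
    <= 32 * (d ^+ 2 * Num.min 1 `|d|).
Proof.
have [d1|d1] := leP 1 `|d|.
  have [c _] := taylor2 gcdf _ _ x d is_derive_gcdf is_derive_gpdf.
  have hx u : `|u * gpdf u| <= 16.
    by rewrite normrM (ger0_norm (gpdf_ge0 u)) -[`|u|]expr1 abs_gpdf_le.
  rewrite mulNr normrN => h.
  apply: le_trans (ler_normD _ _) _.
  have d20 : 0 <= d ^+ 2 by rewrite sqr_ge0.
  have h2 : `|x * gpdf x / 2 * d ^+ 2| <= 8 * d ^+ 2.
    rewrite normrM [`|d ^+ 2|]ger0_norm// normrM normfV (ger0_norm (ler0n _ 2)).
    by rewrite ler_wpM2r//; have := hx x; lra.
  by have := hx (x + c); nra.
have [c _] := taylor3 gcdf _ _ _ x d is_derive_gcdf is_derive_gpdf is_derive_gpdf1.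
have := abs_gpdf_le 2 (x + c) isT; have := abs_gpdf_le 0 (x + c) isT.
rewrite expr0 mul1r real_normK ?num_real// => h0 h2.
rewrite (_ : _ - _ - _ - _ = gcdf (x + d) - gcdf x - gpdf x * d + x * gpdf x / 2 * d ^+ 2); last by ring.
move/le_trans; apply.
rewrite -[d ^+ 2]real_normK ?num_real// -exprSr ler_wpM2r ?exprn_ge0//.
rewrite ler_norml; have := gpdf_ge0 (x + c).
have := sqr_ge0 (x + c); set g := gpdf _ in h0 h2 *; set q := (x + c) ^+ 2 in h2 *.
by move=> q0 g0; apply/andP; split; nra.
Qed.

(** The heat equation for [gcdf (y / Num.sqrt t)] in integrated form: raising
    the variance [t] by the factor [1 + tau] has the effect, up to
    [tau ^+ 2], of half the second derivative in [y]. The bound is uniform in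
    [z] because [z ^+ 3 * gpdf z] is bounded. *)
Lemma gcdf_scale z tau : 0 <= tau <= 1 ->
  `|gcdf (z / Num.sqrt (1 + tau)) - gcdf z + tau / 2 * (z * gpdf z)|
    <= 80 * tau ^+ 2.
Proof.
move=> /andP[t0 t1].
set s := Num.sqrt _.
have ss : s ^+ 2 = 1 + tau by rewrite sqr_sqrtr// addr_ge0.
have s0 : 0 <= s by exact: sqrtr_ge0.
have s1 : 1 <= s by nra.
have s2 : s <= 2 by nra.
pose l := s^-1.
have ls : l * s = 1 by rewrite mulVf// gt_eqF//; lra.
have l0 : 0 < l by rewrite invr_gt0; lra.
have l1 : l <= 1 by rewrite invf_le1; lra.
have l2 : 1 / 2 <= l by rewrite mul1r lef_pV2 ?posrE; lra.
have lt : l ^+ 2 * (1 + tau) = 1 by rewrite -ss -exprMn ls expr1n.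
have d1 : 1 - l <= tau by nra.
have l22 : 1 - tau <= l ^+ 2 by nra.
(* The factor l = (1 + tau)^(-1/2) is 1 - tau / 2 to first order. *)
have dd : `|l - 1 + tau / 2| <= tau ^+ 2.
  have e : (l - 1 + tau / 2) * (l + 1) = l ^+ 2 - 1 + tau + tau / 2 * (l - 1) by field.
  have e2 : l ^+ 2 - 1 + tau = tau ^+ 2 * l ^+ 2.
    have : l ^+ 2 = 1 - tau * l ^+ 2 by lra.
    move=> h; rewrite {1}h [X in _ = _ * X]h; move: h => _; nra.
  rewrite ler_norml; apply/andP; split; nra.
have [c] := taylor2 gcdf _ _ z (z * (l - 1)) is_derive_gcdf is_derive_gpdf.
rewrite normrM => cz.
rewrite mulNr normrN.
rewrite (_ : z + z * (l - 1) = z * l); last by ring.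
rewrite -/l.
set G := gcdf (z * l) - gcdf z => h.
have zc : `|z| <= 2 * `|z + c|.
  have := ler_normB (z + c) c; rewrite addrK => h1.
  have : `|l - 1| <= 1 / 2 by rewrite ler0_norm; lra.
  have := normr_ge0 z; nra.
have h3 := abs_gpdf_le 3 (z + c) isT.
have h4 := abs_gpdf_le 1 z isT; rewrite expr1 in h4.
rewrite (_ : G + _ = (G - gpdf z * (z * (l - 1))) + (z * gpdf z) * (l - 1 + tau / 2)); last by ring.
apply: le_trans (ler_normD _ _) _.
have A : `|z * gpdf z * (l - 1 + tau / 2)| <= 16 * tau ^+ 2.
  by rewrite !normrM (ger0_norm (gpdf_ge0 _)) ler_pM// mulr_ge0 ?gpdf_ge0.
have B : `|(z + c) * gpdf (z + c)| * (z * (l - 1)) ^+ 2 <= 64 * tau ^+ 2.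
  have h5 : (l - 1) ^+ 2 <= tau ^+ 2 by nra.
  have h6 : `|z + c| * gpdf (z + c) * z ^+ 2 <= 64.
    have hz : z ^+ 2 <= 4 * `|z + c| ^+ 2.
      rewrite -[z ^+ 2]real_normK ?num_real//.
      by have := normr_ge0 z; nra.
    have g0 := gpdf_ge0 (z + c).
    have a0 : 0 <= `|z + c| * gpdf (z + c) by rewrite mulr_ge0.
    rewrite !exprS expr0 !mulr1 in h3 hz *.
    by nra.
  rewrite normrM (ger0_norm (gpdf_ge0 _)) exprMn mulrA.
  apply: ler_pM h6 h5; last exact: sqr_ge0.
  by rewrite mulr_ge0 ?sqr_ge0// mulr_ge0 ?gpdf_ge0.
apply: le_trans (lerD (le_trans h B) A) _.
by rewrite -mulrDl ler_wpM2r ?sqr_ge0//; lra.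
Qed.

End gaussian.

(** * Averages over independent draws from a finite set *)

Section draws.
Context {R : realType} {I : finType} {V : zmodType}.
Variables (pi : I -> R) (zeta : I -> V).

Definition draw_avg (f : V -> R) : V -> R := fun x => \sum_i pi i * f (x + zeta i).

(** The expectation of [f] over [r] independent draws from [I] according to
    [pi]: the conditional law of a subsample given the data is of this form. *)
Definition draws_avg r (f : {ffun 'I_r -> I} -> R) : R :=
  \sum_(j : {ffun 'I_r -> I}) (\prod_k pi (j k)) * f j.

(** A function of the sum of the draws can be averaged one draw at a time,
    by splitting off the first draw. *)
Lemma draws_avg_iter r (f : V -> R) x :
  draws_avg r (fun j => f (x + \sum_k zeta (j k))) = iter r draw_avg f x.
Proof.
rewrite /draws_avg; elim: r f x => [|r IH] f x.
  rewrite (big_pred1 [ffun k : 'I_0 => False_rect I (notF (ltn_ord k))]).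
    by rewrite !big_ord0 mul1r addr0.
  by move=> j; apply/esym/eqP/ffunP => -[].
rewrite iterSr -IH.
pose F (u : I * {ffun 'I_r -> I}) : {ffun 'I_r.+1 -> I} :=
  [ffun k => if unlift ord0 k is Some k' then u.2 k' else u.1].
pose G (j : {ffun 'I_r.+1 -> I}) := (j ord0, [ffun k => j (lift ord0 k)]).
have FK : cancel F G.
  move=> [i u]; rewrite /F /G ffunE unlift_none; congr (_, _).
  by apply/ffunP => k; rewrite !ffunE liftK.
have GK : cancel G F.
  move=> j; apply/ffunP => k; rewrite ffunE; case: unliftP => [k'|] -> //=.
  by rewrite ffunE.
rewrite (reindex F); last by exists G => ? _.
rewrite -(pair_big xpredT xpredT (fun i u => (\prod_k pi (F (i, u) k)) *
   f (x + \sum_k zeta (F (i, u) k))))/=.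
rewrite exchange_big/=; apply: eq_bigr => u _.
rewrite /draw_avg mulr_sumr; apply: eq_bigr => i _.
rewrite !big_ord_recl /F ffunE unlift_none/=.
rewrite (eq_bigr (fun k => pi (u k))); last by move=> k _; rewrite ffunE liftK.
rewrite [X in x + (_ + X)](eq_bigr (fun k => zeta (u k))); last first.
  by move=> k _; rewrite ffunE liftK.
by rewrite -mulrA mulrCA [zeta i + _]addrC addrA.
Qed.

Hypothesis pi0 : forall i, 0 <= pi i.
Hypothesis pi1 : \sum_i pi i = 1.

Lemma draws_avg_le r (f g : {ffun 'I_r -> I} -> R) :
  (forall j, f j <= g j) -> draws_avg r f <= draws_avg r g.
Proof.
by move=> fg; apply: ler_sum => j _; rewrite ler_wpM2l// prodr_ge0.
Qed.

Lemma draws_avgD r (f g : {ffun 'I_r -> I} -> R) :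
  draws_avg r (fun j => f j + g j) = draws_avg r f + draws_avg r g.
Proof. by rewrite -big_split; apply: eq_bigr => j _; rewrite mulrDr. Qed.

Lemma draws_avg_cst r (c : R) : draws_avg r (fun=> c) = c.
Proof.
rewrite /draws_avg -mulr_suml -(bigA_distr_bigA (fun _ i => pi i))/=.
by rewrite pi1 big1 ?mul1r.
Qed.

Lemma draws_avgZ r (c : R) (f : {ffun 'I_r -> I} -> R) :
  draws_avg r (fun j => c * f j) = c * draws_avg r f.
Proof. by rewrite mulr_sumr; apply: eq_bigr => j _; rewrite mulrCA. Qed.

End draws.

(** Cross terms vanish, one draw at a time: averaging [(x + g i) ^+ 2] adds
    the variance of [g] to [x ^+ 2], whatever [x] is. *)
Lemma draws_avg_sqr {R : realType} {I : finType} (pi g : I -> R) r :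
  \sum_i pi i = 1 -> \sum_i pi i * g i = 0 ->
  draws_avg pi r (fun j => (\sum_k g (j k)) ^+ 2) = r%:R * \sum_i pi i * g i ^+ 2.
Proof.
move=> pi1 g0.
have /= := draws_avg_iter pi g r (fun x => x ^+ 2) 0.
under eq_fun do rewrite add0r.
move=> ->.
suff H x : iter r (draw_avg pi g) (fun x => x ^+ 2) x =
    x ^+ 2 + r%:R * \sum_i pi i * g i ^+ 2 by rewrite H expr0n add0r.
elim: r x => [|r IH] x /=; first by rewrite mul0r addr0.
rewrite [LHS](eq_bigr (fun i => pi i * ((x + g i) ^+ 2 + r%:R * \sum_i pi i * g i ^+ 2))); last first.
  by move=> i _; rewrite -IH.
set S := \sum_i pi i * g i ^+ 2.
under eq_bigr => i _.
  rewrite (_ : pi i * _ = (x ^+ 2 + r%:R * S) * pi i + (2 * x) * (pi i * g i)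
    + pi i * g i ^+ 2); last by ring.
over.
rewrite !big_split/= -!mulr_sumr pi1 g0 -/S -natr1; ring.
Qed.

(** Replace the factors one at a time; the others are at most 1. *)
Lemma prod_diff {R : realType} {J : finType} (f g : J -> R) :
  (forall j, 0 <= f j <= 1) -> (forall j, 0 <= g j <= 1) ->
  `|\prod_j f j - \prod_j g j| <= \sum_j `|f j - g j|.
Proof.
move=> f01 g01.
suff [] : [/\ `|\prod_j f j - \prod_j g j| <= \sum_j `|f j - g j|,
  0 <= \prod_j f j <= 1 & 0 <= \prod_j g j <= 1] by [].
elim/big_ind3 : _ => [|sa b a sc d c [h1 /andP[a0 a1] /andP[b0 b1]]
    [h2 /andP[c0 c1] /andP[d0 d1]]|j _].
- by rewrite subrr normr0; split; rewrite ?ler01 ?lexx.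
- split; [|by apply/andP; split; [exact: mulr_ge0|exact: mulr_ile1] ..].
  rewrite (_ : _ - _ = (a - b) * c + b * (c - d)); last by ring.
  rewrite (le_trans (ler_normD _ _))// !normrM (ger0_norm b0) (ger0_norm c0).
  have := normr_ge0 (a - b); have := normr_ge0 (c - d).
  by move=> u0 v0; rewrite (le_trans _ (lerD h1 h2))// lerD// ?ler_piMr// ler_piMl.
- by split.
Qed.


(** * Second-order expansions of product functions *)

Section jets.
Context {R : realType} {p : nat}.
Implicit Types (z : 'cV[R]_p) (q : 'cV[R]_p -> R) (l : seq 'I_p).

(** The sum norm makes [lin_le] and [quad_le] hold without a factor [p]. *)
Definition norm1 z : R := \sum_a `|z a 0|.
(** The size of the remainder of a second-order expansion of a bounded smooth
    function. *)
Definition kappa z : R := norm1 z ^+ 2 * Num.min 1 (norm1 z).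

Lemma norm1_ge0 z : 0 <= norm1 z.
Proof. by apply: sumr_ge0. Qed.

Lemma le_norm1 z a : `|z a 0| <= norm1 z.
Proof. by rewrite /norm1 (bigD1 a)//= lerDl sumr_ge0. Qed.

Lemma kappa_ge0 z : 0 <= kappa z.
Proof. by rewrite mulr_ge0 ?sqr_ge0// le_min ler01 norm1_ge0. Qed.

Definition lin (b : 'I_p -> R) z := \sum_a b a * z a 0.
Definition quad (G : 'I_p -> 'I_p -> R) z :=
  \sum_a \sum_c G a c * (z a 0 * z c 0).

Lemma lin_le (b : 'I_p -> R) C z : (forall a, `|b a| <= C) -> `|lin b z| <= C * norm1 z.
Proof.
move=> bC; rewrite (le_trans (ler_norm_sum _ _ _))// mulr_sumr ler_sum// => a _.
by rewrite normrM ler_wpM2r.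
Qed.

Lemma quad_le (G : 'I_p -> 'I_p -> R) C z : (forall a c, `|G a c| <= C) ->
  `|quad G z| <= C * norm1 z ^+ 2.
Proof.
move=> GC; rewrite (le_trans (ler_norm_sum _ _ _))// expr2 mulr_suml mulr_sumr.
apply: ler_sum => a _; rewrite (le_trans (ler_norm_sum _ _ _))//.
rewrite mulr_sumr mulr_sumr; apply: ler_sum => c _.
by rewrite !normrM ler_wpM2r// mulr_ge0.
Qed.

(** [q] has a second-order expansion at 0 with coefficients and remainder
    bounded by [C], whose linear part involves only the coordinates in [l].
    The expectation of such an expansion at a centred random vector with
    covariance [h2] times the identity is [al + h2 * \sum_a G a a], and [v] is
    the value that this expectation should have up to [h2 ^+ 2]. *)
Definition jet l (h2 v C : R) q := exists al b G,
  [/\ [/\ `|al| <= C, forall a, `|b a| <= C & forall a c, `|G a c| <= C],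
      forall a, a \notin l -> b a = 0,
      `|al + h2 * \sum_a G a a - v| <= C * h2 ^+ 2 &
      forall z, `|q z - (al + lin b z + quad G z)| <= C * kappa z].

Lemma jet1 h2 : 0 <= h2 -> jet [::] h2 1 1 (fun=> 1).
Proof.
move=> h0; exists 1, (fun=> 0), (fun _ _ => 0).
split; [split|..] => //; rewrite ?normr1 ?normr0 ?lexx//.
- by rewrite big1// mulr0 addr0 subrr normr0 mulr_ge0 ?sqr_ge0.
- move=> z; rewrite /lin /quad !big1 ?addr0 ?subrr ?normr0 ?mul1r ?kappa_ge0//.
    by move=> a _; rewrite big1// => c _; rewrite mul0r.
  by move=> a _; rewrite mul0r.
Qed.

(** Multiplying by a function of a new coordinate [a] multiplies the expected
    values: the diagonal of the new quadratic part receives no contribution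
    from the two linear parts, because [b a = 0]. This is where the
    independence of the coordinates of the limit law comes from. *)
Lemma jet_mul l a h2 v C q C0 (A : R -> R) al0 be0 ga0 v0 :
  0 <= h2 <= 1 -> 1 <= C -> 1 <= C0 -> a \notin l ->
  `|v| <= 1 -> (forall z, `|q z| <= 1) -> (forall t, `|A t| <= 1) ->
  jet l h2 v C q ->
  `|al0| <= C0 -> `|be0| <= C0 -> `|ga0| <= C0 ->
  `|al0 + h2 * ga0 - v0| <= C0 * h2 ^+ 2 ->
  (forall t, `|A t - (al0 + be0 * t + ga0 * t ^+ 2)| <=
     C0 * (t ^+ 2 * Num.min 1 `|t|)) ->
  jet (a :: l) h2 (v0 * v) ((7 + p%:R) * (C * C0)) (fun z => A (z a 0) * q z).
Proof.
move=> /andP[h20 h21] C1 C01 al v1 q1 A1 [al' [b [G [[alC bC GC] bl vC qC]]]] al0C be0C ga0C v0C AC.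
have C0p : 0 < C by lra. have C00 : 0 < C0 by lra.
have CC1 : 1 <= C * C0 by nra.
have CC0 : 0 <= C * C0 by lra.
have p0 : 0 <= p%:R :> R by exact: ler0n.
pose b' c := al0 * b c + (c == a)%:R * (al' * be0).
pose G' c d := al0 * G c d + ((c == a) && (d == a))%:R * (al' * ga0)
               + (c == a)%:R * (be0 * b d).
have bnd (x y : R) : `|x| <= C -> `|y| <= C0 -> `|x * y| <= C * C0.
  by move=> xC yC; rewrite normrM ler_pM.
have bnd' (x y : R) : `|x| <= C0 -> `|y| <= C -> `|x * y| <= C * C0.
  by move=> xC yC; rewrite mulrC bnd.
have bb (bl' : bool) (x : R) : `|x| <= C * C0 -> `|bl'%:R * x| <= C * C0.
  by case: bl'; rewrite ?mul1r// mul0r normr0.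
have big1C : C * C0 + C * C0 + C * C0 <= (7 + p%:R) * (C * C0).
  have h : 0 <= p%:R * (C * C0) by rewrite mulr_ge0.
  by lra.
have linE z : lin b' z = al0 * lin b z + al' * be0 * z a 0.
  rewrite /lin mulr_sumr /b'.
  under eq_bigr do rewrite mulrDl.
  rewrite big_split/=; congr (_ + _); first by apply: eq_bigr => c _; rewrite mulrA.
  rewrite (bigD1 a)//= eqxx mul1r big1 ?addr0// => c /negPf ->.
  by rewrite !mul0r.
have quadE z : quad G' z = al0 * quad G z + al' * ga0 * z a 0 ^+ 2
    + be0 * z a 0 * lin b z.
  rewrite /quad /G' /lin.
  under eq_bigr => c _.
    under eq_bigr do rewrite !mulrDl.
    rewrite !big_split/=.
  over.
  rewrite !big_split/=; congr (_ + _ + _).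
  - rewrite mulr_sumr; apply: eq_bigr => c _; rewrite mulr_sumr.
    by apply: eq_bigr => d _; ring.
  - rewrite (bigD1 a)//= (bigD1 a)//= eqxx/= mul1r big1; last first.
      by move=> d /negPf ->; rewrite !mul0r.
    rewrite addr0 big1 ?addr0 ?expr2// => c /negPf ->.
    by rewrite big1// => d _; rewrite !mul0r.
  - rewrite (bigD1 a)//= eqxx mulr_sumr [X in _ + X]big1 ?addr0.
      by apply: eq_bigr => d _; rewrite mul1r; ring.
    by move=> c /negPf ->; rewrite big1// => d _; rewrite !mul0r.
exists (al0 * al'), b', G'; split; [split|..].
- have b1 := bnd' _ _ al0C alC; lra.
- move=> c; rewrite (le_trans (ler_normD _ _))//.
  have := bnd' _ _ al0C (bC c); have := bb (c == a) _ (bnd _ _ alC be0C); lra.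
- move=> c d.
  have k1 := bnd' _ _ al0C (GC c d).
  have k2 := bb ((c == a) && (d == a)) _ (bnd _ _ alC ga0C).
  have k3 := bb (c == a) _ (bnd' _ _ be0C (bC d)).
  apply: le_trans (ler_normD _ _) _; apply: le_trans (lerD (ler_normD _ _) k3) _.
  lra.
- move=> c; rewrite inE negb_or => /andP[/negPf ca cl].
  by rewrite /b' bl// ca mulr0 mul0r addr0.
- have -> : \sum_c G' c c = al0 * (\sum_c G c c) + al' * ga0.
    rewrite /G' !big_split/= -mulr_sumr -addrA; congr (_ + _).
    rewrite (bigD1 a)//= eqxx/= mul1r big1 ?addr0; last first.
      by move=> c /negPf ->; rewrite /= mul0r.
    rewrite big1 ?addr0// => c _; have [->|_] := eqVneq c a; last by rewrite mul0r.
    by rewrite bl// !mulr0.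
  set tr := \sum_c _ in vC *.
  have trC : `|tr| <= p%:R * C.
    rewrite (le_trans (ler_norm_sum _ _ _))//.
    apply: (@le_trans _ _ (\sum_(c < p) C)); first by apply: ler_sum => c _.
    by rewrite sumr_const card_ord mulr_natl.
  rewrite (_ : _ - _ = (al' + h2 * tr - v) * (al0 + h2 * ga0)
     + v * (al0 + h2 * ga0 - v0) - h2 ^+ 2 * (tr * ga0)); last by ring.
  have X0 : `|al0 + h2 * ga0| <= 2 * C0.
    rewrite (le_trans (ler_normD _ _))// normrM (ger0_norm h20).
    by have := normr_ge0 ga0; nra.
  have h22 : 0 <= h2 ^+ 2 by rewrite sqr_ge0.
  have t1 : `|(al' + h2 * tr - v) * (al0 + h2 * ga0)| <= (C * h2 ^+ 2) * (2 * C0).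
    by rewrite normrM ler_pM.
  have t2 : `|v * (al0 + h2 * ga0 - v0)| <= 1 * (C0 * h2 ^+ 2) by rewrite normrM ler_pM.
  have t3 : `|h2 ^+ 2 * (tr * ga0)| <= h2 ^+ 2 * (p%:R * C * C0).
    by rewrite normrM [`|h2 ^+ 2|]ger0_norm// ler_wpM2l// normrM ler_pM.
  have t4 : C0 * h2 ^+ 2 <= C * C0 * h2 ^+ 2 by rewrite ler_wpM2r//; nra.
  apply: le_trans (ler_normB _ _) _; apply: le_trans (lerD (ler_normD _ _) t3) _.
  have t5 : 0 <= C * C0 * h2 ^+ 2 by rewrite mulr_ge0.
  lra.
- move=> z; rewrite linE quadE.
  set t := z a 0; set N := norm1 z.
  have N0 : 0 <= N by exact: norm1_ge0.
  have tN : `|t| <= N by exact: le_norm1.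
  have LN := lin_le b C z bC; have QN := quad_le G C z GC.
  have qz := qC z; have Az := AC t.
  rewrite -/N in LN QN.
  have kE : kappa z = N ^+ 2 * Num.min 1 N by [].
  have t2E : `|t ^+ 2| <= N ^+ 2 by rewrite normrX lerXn2r ?nnegrE.
  set L := lin b z in LN qz *; set Q := quad G z in QN qz *.
  have K0 := kappa_ge0 z.
  have N20 : 0 <= N ^+ 2 by rewrite sqr_ge0.
  (* Far from 0 every term is bounded by the quadratic ones. *)
  have [N1|N1] := leP 1 N.
    rewrite kE min_l// mulr1.
    rewrite (le_trans (ler_normB _ _))//.
    have e1 : `|A t * q z| <= 1 by rewrite normrM mulr_ile1.
    have e2 : `|al0 * al' + (al0 * L + al' * be0 * t) +
       (al0 * Q + al' * ga0 * t ^+ 2 + be0 * t * L)| <=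
       C * C0 + (C * C0 * N + C * C0 * N) +
       (C * C0 * N ^+ 2 + C * C0 * N ^+ 2 + C * C0 * N ^+ 2).
      have u0 := bnd' _ _ al0C alC.
      have u1 : `|al0 * L| <= C0 * (C * N) by rewrite normrM ler_pM.
      have u2 : `|al' * be0 * t| <= C * C0 * N by rewrite normrM ler_pM// bnd.
      have u3 : `|al0 * Q| <= C0 * (C * N ^+ 2) by rewrite normrM ler_pM.
      have u4 : `|al' * ga0 * t ^+ 2| <= C * C0 * N ^+ 2.
        by rewrite normrM ler_pM// bnd.
      have u5 : `|be0 * t * L| <= (C0 * N) * (C * N).
        by rewrite normrM ler_pM// normrM ler_pM.
      apply: le_trans (ler_normD _ _) _.
      apply: le_trans (lerD (ler_normD _ _) (ler_normD _ _)) _.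
      apply: le_trans (lerD (lerD u0 (ler_normD _ _)) (lerD (ler_normD _ _) u5)) _.
      lra.
    apply: le_trans (lerD e1 e2) _.
    have : C * C0 * N <= C * C0 * N ^+ 2 by rewrite ler_wpM2l// expr2 ler_peMl.
    have N21 : 1 <= N ^+ 2 by rewrite exprn_ege1.
    have : C * C0 <= C * C0 * N ^+ 2 by rewrite ler_peMr.
    have : 1 <= C * C0 * N ^+ 2 by rewrite mulr_ege1.
    have : 0 <= p%:R * (C * C0 * N ^+ 2) by apply: mulr_ge0 => //; apply: mulr_ge0.
    lra.
  rewrite (_ : _ - _ = (q z - (al' + L + Q)) * A t
    + (al' + L + Q) * (A t - (al0 + be0 * t + ga0 * t ^+ 2))
    + (L * (ga0 * t ^+ 2) + (Q * (be0 * t) + Q * (ga0 * t ^+ 2)))); last by ring.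
  have kN : kappa z = N ^+ 3 by rewrite kE min_r ?ltW// -exprSr.
  have N3 : 0 <= N ^+ 3 by rewrite exprn_ge0.
  have P3 : `|al' + L + Q| <= 3 * C.
    rewrite (le_trans (ler_normD _ _))// (le_trans (lerD (ler_normD _ _) (lexx _)))//.
    have : C * N <= C by rewrite ler_piMr// ltW.
    have : C * N ^+ 2 <= C by rewrite ler_piMr ?ltW// exprn_ilt1.
    lra.
  have tk : C0 * (t ^+ 2 * Num.min 1 `|t|) <= C0 * N ^+ 3.
    have t1 : `|t| <= 1 by rewrite (le_trans tN)// ltW.
    have -> : t ^+ 2 * Num.min 1 `|t| = `|t| ^+ 3.
      by rewrite min_r// -[t ^+ 2]real_normK ?num_real// -exprSr.
    by rewrite ler_pM2l// lerXn2r ?nnegrE.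
  have N43 : N ^+ 4 <= N ^+ 3 by rewrite exprS ler_piMl// ltW.
  have e1 : `|(q z - (al' + L + Q)) * A t| <= C * N ^+ 3 * 1.
    by rewrite normrM -kN ler_pM.
  have e2 : `|(al' + L + Q) * (A t - (al0 + be0 * t + ga0 * t ^+ 2))| <=
      3 * C * (C0 * N ^+ 3).
    by rewrite normrM ler_pM// (le_trans Az tk).
  have e3 : `|L * (ga0 * t ^+ 2)| <= C * N * (C0 * N ^+ 2).
    by rewrite normrM ler_pM// normrM ler_pM.
  have e4 : `|Q * (be0 * t)| <= C * N ^+ 2 * (C0 * N).
    by rewrite normrM ler_pM// normrM ler_pM.
  have e5 : `|Q * (ga0 * t ^+ 2)| <= C * C0 * N ^+ 3.
    apply: (@le_trans _ _ (C * N ^+ 2 * (C0 * N ^+ 2))).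
      by rewrite normrM ler_pM// normrM ler_pM.
    rewrite (_ : _ * _ = C * C0 * N ^+ 4); last by ring.
    by rewrite ler_wpM2l.
  rewrite kN.
  have e6 : C * N ^+ 3 <= C * C0 * N ^+ 3 by rewrite ler_wpM2r//; nra.
  have e7 : C * N * (C0 * N ^+ 2) = C * C0 * N ^+ 3 by ring.
  have e8 : C * N ^+ 2 * (C0 * N) = C * C0 * N ^+ 3 by ring.
  have e9 : 0 <= p%:R * (C * C0 * N ^+ 3) by apply: mulr_ge0 => //; apply: mulr_ge0.
  apply: le_trans (ler_normD _ _) _.
  apply: le_trans (lerD (ler_normD _ _) (ler_normD _ _)) _.
  apply: le_trans (lerD (lerD e1 e2) (lerD e3 (ler_normD _ _))) _.
  lra.
Qed.

End jets.

(** * One step of the Lindeberg argument *)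

Section lindeberg.
Context {R : realType} {p : nat}.

Lemma jet_prod (C0 h2 : R) (A : 'I_p -> R -> R) (al be ga v : 'I_p -> R) :
  0 <= h2 <= 1 -> 1 <= C0 ->
  (forall a, `|v a| <= 1) -> (forall a t, `|A a t| <= 1) ->
  (forall a, [/\ `|al a| <= C0, `|be a| <= C0 & `|ga a| <= C0]) ->
  (forall a, `|al a + h2 * ga a - v a| <= C0 * h2 ^+ 2) ->
  (forall a t, `|A a t - (al a + be a * t + ga a * t ^+ 2)| <=
     C0 * (t ^+ 2 * Num.min 1 `|t|)) ->
  jet (index_enum 'I_p) h2 (\prod_a v a) (((7 + p%:R) * C0) ^+ p)
    (fun z => \prod_a A a (z a 0)).
Proof.
move=> h01 C01 v1 A1 coefC vC AC.
have [h0 _] := andP h01.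
have K1 : 1 <= (7 + p%:R) * C0.
  by rewrite mulr_ege1// -natrD ler1n.
have -> : (((7 + p%:R) * C0) ^+ p) = (((7 + p%:R) * C0) ^+ size (index_enum 'I_p)) :> R.
  by rewrite -sum1_size big_const_ord iter_addn_0 mul1n.
have : uniq (index_enum 'I_p) by exact: index_enum_uniq.
elim: (index_enum _) => [_|a l IH /= /andP[al' /IH{}IH]].
  rewrite big_nil expr0 (_ : (fun z : 'cV_p => _) = fun=> 1); first exact: jet1.
  by apply/funext => z; rewrite big_nil.
have prod1 (F : 'I_p -> R) : (forall a, `|F a| <= 1) -> `|\prod_(a <- l) F a| <= 1.
  move=> F1; elim: (l) => [|b m IHm]; first by rewrite big_nil normr1.
  by rewrite big_cons normrM mulr_ile1.
rewrite big_cons (_ : (fun z : 'cV_p => _) =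
  fun z => A a (z a 0) * \prod_(b <- l) A b (z b 0)); last first.
  by apply/funext => z; rewrite big_cons.
have [alC beC gaC] := coefC a.
rewrite exprS -mulrA [C0 * _]mulrC.
by apply: (jet_mul _ _ _ _ _ _ _ _ (al a) (be a) (ga a)) => //;
  rewrite ?exprn_ege1//; [exact: prod1|move=> z; exact: prod1].
Qed.

(** The linear and the off-diagonal quadratic terms of the expansion have
    expectation 0, so that only the remainder, bounded by [kappa], matters. *)
Lemma lindeberg_step (C0 h2 : R) (A : 'I_p -> R -> R) (al be ga v : 'I_p -> R)
    (I : finType) (pi : I -> R) (zeta : I -> 'cV[R]_p) :
  0 <= h2 <= 1 -> 1 <= C0 ->
  (forall a, `|v a| <= 1) -> (forall a t, `|A a t| <= 1) ->
  (forall a, [/\ `|al a| <= C0, `|be a| <= C0 & `|ga a| <= C0]) ->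
  (forall a, `|al a + h2 * ga a - v a| <= C0 * h2 ^+ 2) ->
  (forall a t, `|A a t - (al a + be a * t + ga a * t ^+ 2)| <=
     C0 * (t ^+ 2 * Num.min 1 `|t|)) ->
  (forall i, 0 <= pi i) -> \sum_i pi i = 1 ->
  (forall a, \sum_i pi i * zeta i a 0 = 0) ->
  (forall a b, \sum_i pi i * (zeta i a 0 * zeta i b 0) = (a == b)%:R * h2) ->
  `|\sum_i pi i * \prod_a A a (zeta i a 0) - \prod_a v a| <=
    ((7 + p%:R) * C0) ^+ p * (h2 ^+ 2 + \sum_i pi i * kappa (zeta i)).
Proof.
move=> h01 C01 v1 A1 coefC vC AC pi0 pi1 m1 m2.
have [al' [b [G [_ _ valC qC]]]] := jet_prod _ _ _ _ _ _ _ h01 C01 v1 A1 coefC vC AC.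
set K := _ ^+ p in valC qC *.
have linE : \sum_i pi i * lin b (zeta i) = 0.
  rewrite /lin; under eq_bigr do rewrite mulr_sumr.
  rewrite exchange_big big1//= => a _.
  by under eq_bigr do rewrite mulrCA; rewrite -mulr_sumr m1 mulr0.
have quadE : \sum_i pi i * quad G (zeta i) = h2 * \sum_a G a a.
  rewrite /quad; under eq_bigr do rewrite mulr_sumr.
  rewrite exchange_big mulr_sumr; apply: eq_bigr => a _/=.
  under eq_bigr do rewrite mulr_sumr.
  rewrite exchange_big/= (bigD1 a)//= [X in _ + X]big1 ?addr0.
    by under eq_bigr do rewrite mulrCA; rewrite -mulr_sumr m2 eqxx mul1r mulrC.
  move=> c /negPf ca; under eq_bigr do rewrite mulrCA.
  by rewrite -mulr_sumr m2 eq_sym ca mul0r mulr0.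
have -> : \sum_i pi i * \prod_a A a (zeta i a 0) - \prod_a v a =
  (al' + h2 * (\sum_a G a a) - \prod_a v a) +
  \sum_i pi i * (\prod_a A a (zeta i a 0) - (al' + lin b (zeta i) + quad G (zeta i))).
  under [X in _ = _ + X]eq_bigr do rewrite mulrBr !mulrDr.
  rewrite sumrB !big_split/= linE quadE -mulr_suml pi1; ring.
rewrite (le_trans (ler_normD _ _))// mulrDr lerD//.
rewrite (le_trans (ler_norm_sum _ _ _))// mulr_sumr ler_sum// => i _.
by rewrite normrM ger0_norm// mulrCA ler_wpM2l.
Qed.

(** As a function of [t] and [y], [gcdf (y / Num.sqrt t)] solves the heat
    equation with the indicator of a half-line as initial value. Hence one
    summand of variance [h2] moves its value at time [t] to its value at time
    [t + h2], up to [h2 ^+ 2]. At times [t >= eps ^+ 2] the derivatives, and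
    so all constants, are bounded in terms of [eps] only. *)
Lemma heat_step (eps t h2 y : R) : 0 < eps <= 1 -> eps ^+ 2 <= t ->
  0 <= h2 <= eps ^+ 2 -> let s := Num.sqrt t in
  exists al be ga, [/\
   [/\ `|al| <= 80 / eps ^+ 4, `|be| <= 80 / eps ^+ 4 & `|ga| <= 80 / eps ^+ 4],
   `|al + h2 * ga - gcdf (y / Num.sqrt (t + h2))| <= 80 / eps ^+ 4 * h2 ^+ 2 &
   forall u, `|gcdf ((y - u) / s) - (al + be * u + ga * u ^+ 2)| <=
     80 / eps ^+ 4 * (u ^+ 2 * Num.min 1 `|u|)].
Proof.
move=> /andP[e0 e1] et /andP[h0 he] s.
have t0 : 0 < t by rewrite (lt_le_trans _ et)// exprn_gt0.
have s0 : 0 < s by rewrite sqrtr_gt0.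
have ss : s ^+ 2 = t by rewrite sqr_sqrtr// ltW.
have es : eps <= s.
  by rewrite -(ler_pXn2r (ltn0Sn 1)) ?nnegrE ?(ltW e0) ?(ltW s0)// ss.
pose l := s^-1.
have l0 : 0 < l by rewrite invr_gt0.
pose k := eps^-1.
have k1 : 1 <= k by rewrite invf_ge1.
have lk : l <= k by rewrite lef_pV2 ?posrE.
have k0 : 0 < k by lra.
have -> : 80 / eps ^+ 4 = 80 * k ^+ 4 by rewrite exprVn.
have k12 : k <= k ^+ 2 by rewrite expr2 ler_peMr// ltW.
have k23 : k ^+ 2 <= k ^+ 3 by rewrite [k ^+ 3]exprSr ler_peMr// exprn_ge0// ltW.
have k34 : k ^+ 3 <= k ^+ 4 by rewrite [k ^+ 4]exprSr ler_peMr// exprn_ge0// ltW.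
have l2k : l ^+ 2 <= k ^+ 2 by rewrite lerXn2r ?nnegrE// ltW.
have l3k : l ^+ 3 <= k ^+ 3 by rewrite lerXn2r ?nnegrE// ltW.
have l4k : l ^+ 4 <= k ^+ 4 by rewrite lerXn2r ?nnegrE// ltW.
pose z := y * l.
have zg := abs_gpdf_le 1 z isT; rewrite expr1 in zg.
have zgE : `|z * gpdf z| <= 16 by rewrite normrM (ger0_norm (gpdf_ge0 z)).
have h00 : 0 <= h2 ^+ 2 by rewrite sqr_ge0.
exists (gcdf z), (- (gpdf z * l)), (- (z * gpdf z / 2 * l ^+ 2)); split; [split|..].
- by rewrite ger0_norm ?gcdf_ge0// (le_trans (gcdf_le1 _)); lra.
- rewrite normrN normrM (ger0_norm (gpdf_ge0 _)) (gtr0_norm l0).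
  have := gpdf_le1 z; have := gpdf_ge0 z; nra.
- have l20 : 0 <= l ^+ 2 by rewrite sqr_ge0.
  have : `|z * gpdf z / 2 * l ^+ 2| <= 8 * l ^+ 2.
    rewrite normrM [`|l ^+ 2|]ger0_norm// ler_wpM2r// normrM [`|2^-1|]ger0_norm//.
    by lra.
  by rewrite normrN; lra.
- pose tau := h2 * l ^+ 2.
  have l2t : l ^+ 2 * t = 1 by rewrite -ss -exprMn mulVf ?gt_eqF// expr1n.
  have tau0 : 0 <= tau by rewrite mulr_ge0// sqr_ge0.
  have tau1 : tau <= 1.
    by rewrite /tau -l2t mulrC ler_wpM2l ?sqr_ge0// (le_trans he).
  have := gcdf_scale z tau; rewrite tau0 tau1 => /(_ isT).
  have -> : z / Num.sqrt (1 + tau) = y / Num.sqrt (t + h2).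
    have -> : t + h2 = t * (1 + tau) by rewrite /tau mulrDr mulr1 mulrC -mulrA l2t mulr1.
    by rewrite sqrtrM ?ltW// -/s invfM mulrA.
  rewrite -normrN => H.
  rewrite (_ : _ - _ = - (gcdf (y / Num.sqrt (t + h2)) - gcdf z + tau / 2 * (z * gpdf z))); last first.
    by rewrite /tau; field.
  apply: le_trans H _; rewrite /tau exprMn -exprM.
  by rewrite [h2 ^+ 2 * _]mulrC mulrA ler_wpM2r// ler_pM2l.
- move=> u; have := gcdf_taylor z (- (u * l)).
  rewrite -mulNr -mulrDl -/l normrM normrN (gtr0_norm l0) => H.
  rewrite (_ : _ - _ = gcdf ((y - u) * l) - gcdf z - gpdf z * (- u * l) + z * gpdf z / 2 * (- u * l) ^+ 2); last first.
    by rewrite -/l; field.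
  apply: le_trans H _; rewrite exprMn sqrrN.
  have u20 : 0 <= u ^+ 2 by rewrite sqr_ge0.
  have m1 : Num.min 1 (`|u| * l) <= k * Num.min 1 `|u|.
    have [u1|u1] := leP 1 `|u|; first by rewrite mulr1 ge_min k1.
    by rewrite ge_min [X in _ || X](_ : _ = true) ?orbT// mulrC ler_wpM2r.
  have m0 : 0 <= Num.min 1 (`|u| * l) by rewrite le_min ler01 mulr_ge0// ltW.
  have m0' : 0 <= Num.min 1 `|u| by rewrite le_min ler01/=.
  have : u ^+ 2 * l ^+ 2 * Num.min 1 (`|u| * l) <= u ^+ 2 * k ^+ 2 * (k * Num.min 1 `|u|).
    by apply: ler_pM (ler_wpM2l u20 l2k) m1 => //; rewrite mulr_ge0// sqr_ge0.
  have : u ^+ 2 * k ^+ 2 * (k * Num.min 1 `|u|) <= k ^+ 4 * (u ^+ 2 * Num.min 1 `|u|).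
    rewrite (_ : _ * (k * _) = k ^+ 3 * (u ^+ 2 * Num.min 1 `|u|)); last by ring.
    by rewrite ler_wpM2r// mulr_ge0.
  have : 0 <= k ^+ 4 * (u ^+ 2 * Num.min 1 `|u|).
    by apply: mulr_ge0; [exact: exprn_ge0 (ltW k0)|exact: mulr_ge0].
  lra.
Qed.

End lindeberg.

(** * A uniform central limit theorem for draws from a finite set *)

Lemma inv_sqrt_bound {R : realType} (eps : R) : 0 < eps <= 1 ->
  let l := (Num.sqrt (eps ^+ 2 + 1))^-1 in [/\ 0 < l, l <= 1 & 1 - l <= eps].
Proof.
move=> /andP[e0 e1]; set s := Num.sqrt _.
have ss : s ^+ 2 = eps ^+ 2 + 1 by rewrite sqr_sqrtr// addr_ge0// sqr_ge0.
have s0 : 0 <= s by exact: sqrtr_ge0.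
have s1 : 1 <= s by nra.
have se : s <= 1 + eps by nra.
have ls : s^-1 * s = 1 by rewrite mulVf// gt_eqF//; lra.
have l0 : 0 < s^-1 by rewrite invr_gt0; lra.
by split => //; nra.
Qed.

Section clt.
Context {R : realType} {p : nat}.

Section lindeberg.
Context {I : finType}.
Variables (pi : I -> R) (zeta : I -> 'cV[R]_p) (r : nat).
Hypothesis r0 : (0 < r)%N.
Hypothesis pi0 : forall i, 0 <= pi i.
Hypothesis pi1 : \sum_i pi i = 1.
Hypothesis m1 : forall a, \sum_i pi i * zeta i a 0 = 0.
Hypothesis m2 : forall a b,
  \sum_i pi i * (zeta i a 0 * zeta i b 0) = (a == b)%:R * r%:R^-1.

(** Lindeberg's argument, with test functions that are Gaussian smoothings
    (at time [eps ^+ 2]) of the indicator of an orthant. Averaging over the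
    draws one by one follows the heat equation from time [eps ^+ 2] to
    [eps ^+ 2 + 1], so that no Gaussian integral ever appears. The constant
    depends only on [eps] and [p]. *)
Lemma lindeberg_smooth (eps : R) (c : 'cV[R]_p) : 0 < eps <= 1 ->
  r%:R^-1 <= eps ^+ 2 ->
  `|draws_avg pi r (fun j => \prod_a gcdf ((c a 0 - (\sum_k zeta (j k)) a 0) / eps))
    - \prod_a gcdf (c a 0 / Num.sqrt (eps ^+ 2 + 1))| <=
  ((7 + p%:R) * (80 / eps ^+ 4)) ^+ p *
    (r%:R^-1 + r%:R * \sum_i pi i * kappa (zeta i)).
Proof.
move=> eps01 re; have [e0 e1] := andP eps01.
set K := _ ^+ p.
have rp : 0 < r%:R :> R by rewrite ltr0n.
pose h2 : R := r%:R^-1.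
have h20 : 0 <= h2 by rewrite invr_ge0 ltW.
have e21 : eps ^+ 2 <= 1 by rewrite exprn_ile1// ltW.
pose u m (x : 'cV[R]_p) := \prod_a gcdf ((c a 0 - x a 0) / Num.sqrt (eps ^+ 2 + m%:R * h2)).
set S := \sum_i _.
have C01 : 1 <= 80 / eps ^+ 4 :> R.
  rewrite ler_pdivlMr ?exprn_gt0// mul1r (le_trans (exprn_ile1 _ (ltW e0) e1))//.
  by rewrite (ler_nat _ 1 80).
have g1 t : `|gcdf t : R| <= 1 by rewrite ger0_norm ?gcdf_ge0// gcdf_le1.
have step m x : `|draw_avg pi zeta (u m) x - u m.+1 x| <= K * (h2 ^+ 2 + S).
  have et : eps ^+ 2 <= eps ^+ 2 + m%:R * h2 by rewrite lerDl mulr_ge0.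
  have he : 0 <= h2 <= eps ^+ 2 by rewrite h20.
  have /= st a := heat_step eps _ h2 (c a 0 - x a 0) eps01 et he.
  have [al /choice [be /choice [ga jets]]] := choice st.
  rewrite /draw_avg /u.
  have -> : \sum_i pi i * \prod_a gcdf ((c a 0 - (x + zeta i) a 0) / Num.sqrt (eps ^+ 2 + m%:R * h2)) =
    \sum_i pi i * \prod_a (fun a t => gcdf ((c a 0 - x a 0 - t) / Num.sqrt (eps ^+ 2 + m%:R * h2))) a (zeta i a 0).
    by apply: eq_bigr => i _; congr (_ * _); apply: eq_bigr => a _; rewrite mxE opprD addrA.
  apply: (lindeberg_step (80 / eps ^+ 4) h2
    (fun a t => gcdf ((c a 0 - x a 0 - t) / Num.sqrt (eps ^+ 2 + m%:R * h2)))
    al be ga (fun a => gcdf ((c a 0 - x a 0) / Num.sqrt (eps ^+ 2 + m.+1%:R * h2)))) => //.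
  - by rewrite h20 (le_trans _ e21).
  - by move=> a; case: (jets a).
  - move=> a; case: (jets a) => _ + _.
    have -> : m.+1%:R * h2 = m%:R * h2 + h2 by rewrite -[m.+1%:R]natr1; ring.
    by rewrite addrA.
  - by move=> a; case: (jets a).
have pos m x : `|iter m (draw_avg pi zeta) (u 0%N) x - u m x| <= m%:R * (K * (h2 ^+ 2 + S)).
  elim: m x => [|m IH] x; first by rewrite subrr normr0 mul0r.
  have -> : m.+1%:R * (K * (h2 ^+ 2 + S)) = m%:R * (K * (h2 ^+ 2 + S)) + K * (h2 ^+ 2 + S).
    by rewrite -[m.+1%:R]natr1; ring.
  rewrite iterS.
  rewrite (_ : _ - _ = (draw_avg pi zeta (iter m (draw_avg pi zeta) (u 0%N)) x -
    draw_avg pi zeta (u m) x) + (draw_avg pi zeta (u m) x - u m.+1 x)); last by ring.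
  rewrite (le_trans (ler_normD _ _))// lerD// -sumrB.
  rewrite (le_trans (ler_norm_sum _ _ _))//.
  set D := m%:R * _ in IH *.
  have -> : D = \sum_i pi i * D by rewrite -mulr_suml pi1 mul1r.
  rewrite ler_sum// => i _.
  by rewrite -mulrBr normrM ger0_norm// ler_wpM2l.
have := pos r 0; rewrite -draws_avg_iter.
have -> : u r 0 = \prod_a gcdf (c a 0 / Num.sqrt (eps ^+ 2 + 1)).
  by apply: eq_bigr => a _; rewrite mxE subr0 mulfV ?gt_eqF.
have -> : draws_avg pi r (fun j => u 0%N (0 + \sum_k zeta (j k))) =
  draws_avg pi r (fun j => \prod_a gcdf ((c a 0 - (\sum_k zeta (j k)) a 0) / eps)).
  apply: eq_bigr => j _; congr (_ * _); apply: eq_bigr => a _.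
  by rewrite add0r mul0r addr0 sqrtr_sqr gtr0_norm.
move/le_trans; apply.
by rewrite mulrCA mulrDr expr2 mulrA mulfV ?gt_eqF// mul1r.
Qed.

End lindeberg.

(** The threshold [eta] depends neither on the set nor on the weights: this
    uniformity is what makes a statement about the conditional law given
    random data possible. The indicator of the orthant at [x] lies between
    smoothings of orthants at [x - L * eps] and [x + L * eps], up to the
    Gaussian tail beyond [L]. *)
Lemma uniform_clt (x : 'cV[R]_p) (e : R) : 0 < e -> exists2 eta : R, 0 < eta &
  forall (I : finType) (pi : I -> R) (zeta : I -> 'cV[R]_p) (r : nat),
    (0 < r)%N -> (forall i, 0 <= pi i) -> \sum_i pi i = 1 ->
    (forall a, \sum_i pi i * zeta i a 0 = 0) ->
    (forall a b, \sum_i pi i * (zeta i a 0 * zeta i b 0) = (a == b)%:R * r%:R^-1) ->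
    r%:R * (\sum_i pi i * kappa (zeta i)) <= eta -> r%:R^-1 <= eta ->
  `|draws_avg pi r (fun j => [forall a, (\sum_k zeta (j k)) a 0 <= x a 0]%:R)
    - std_normal_cdf x| <= e.
Proof.
move=> e0.
have lower (A B C : R) : - (e / 4) <= A - B -> - (e / 4) <= B - C ->
  C + - e <= A + - (e / 4) by lra.
have upper (A B C : R) : A - B <= e / 4 -> B - C <= e / 4 ->
  A + e / 4 <= C + e by lra.
pose e1 := e / (4 * (p%:R + 1)).
have p0 : 0 <= p%:R :> R by [].
have e10 : 0 < e1 by rewrite divr_gt0// mulr_gt0// ltr_wpDl.
have pe1 : (p%:R + 1) * e1 = e / 4 by rewrite /e1; field; rewrite gt_eqF// ltr_wpDl.
have [L L0 [Lm Lp]] := gcdf_tails e1 e10.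
pose B := p%:R * L + norm1 x.
have B0 : 0 <= B by rewrite addr_ge0 ?norm1_ge0// mulr_ge0// ltW.
pose eps := Num.min 1 (e / (4 * (B + 1))).
have eps0 : 0 < eps by rewrite lt_min ltr01 divr_gt0// mulr_gt0// ltr_wpDl.
have eps1 : eps <= 1 by rewrite ge_min lexx.
have Beps : B * eps <= e / 4.
  apply: (@le_trans _ _ ((B + 1) * (e / (4 * (B + 1))))).
    by apply: ler_pM => //; [exact: ltW|rewrite lerDl|rewrite ge_min lexx orbT].
  by rewrite le_eqVlt; apply/orP; left; apply/eqP; field; rewrite gt_eqF// ltr_wpDl.
pose K := ((7 + p%:R) * (80 / eps ^+ 4)) ^+ p.
have K0 : 0 < K.
  by rewrite exprn_gt0// mulr_gt0 ?ltr_wpDr// divr_gt0// exprn_gt0.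
exists (Num.min (eps ^+ 2) (e / (4 * (2 * K)))).
  by rewrite lt_min exprn_gt0//= divr_gt0// mulr_gt0// mulr_gt0.
move=> I pi zeta r r0 pi0 pi1 m1 m2; rewrite !le_min => /andP[_ k2] /andP[r1 r2].
have eps01 : 0 < eps <= 1 by rewrite eps0.
have lind c := lindeberg_smooth pi zeta r r0 pi0 pi1 m1 m2 eps c eps01 r1.
have {}lind (c : 'cV[R]_p) : `|draws_avg pi r (fun j => \prod_a gcdf ((c a 0 - (\sum_k zeta (j k)) a 0) / eps))
    - \prod_a gcdf (c a 0 / Num.sqrt (eps ^+ 2 + 1))| <= e / 4.
  apply: le_trans (lind c) _; rewrite -/K.
  apply: (@le_trans _ _ (K * (e / (4 * (2 * K)) + e / (4 * (2 * K))))).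
    by rewrite ler_pM2l// lerD.
  by rewrite le_eqVlt; apply/orP; left; apply/eqP; field; rewrite gt_eqF.
have g01 (t : R) : 0 <= gcdf t <= 1 by rewrite gcdf_ge0 gcdf_le1.
pose s := Num.sqrt (eps ^+ 2 + 1).
pose l := s^-1.
have [l0 l1 le] : [/\ 0 < l, l <= 1 & 1 - l <= eps] := inv_sqrt_bound eps eps01.
(* [gcdf] is 1-Lipschitz, and shifting the corner and rescaling by [s] move
   the coordinate a by at most (L + |x a|) * eps. *)
have shift (L' : R) : `|L'| = L -> `|\prod_a gcdf ((x + const_mx (L' * eps)) a 0 / s)
    - std_normal_cdf x| <= e / 4.
  move=> LL; apply: le_trans (prod_diff _ _ _ _) _; [by move=> a; exact: g01|by move=> a; exact: g01|].
  apply: le_trans Beps.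
  apply: (@le_trans _ _ (\sum_(a < p) (L * eps + `|x a 0| * eps))).
    apply: ler_sum => a _; apply: le_trans (gcdf_lip _ _) _.
    rewrite !mxE -/l (_ : _ - _ = L' * eps * l - x a 0 * (1 - l)); last by ring.
    rewrite (le_trans (ler_normB _ _))// lerD//.
      by rewrite !normrM LL (gtr0_norm eps0) (gtr0_norm l0) ler_piMr// mulr_ge0// ltW.
    by rewrite normrM ler_wpM2l// ger0_norm// subr_ge0.
  by rewrite big_split/= -!mulr_suml sumr_const card_ord -mulr_natl -mulrDl.
pose T (j : {ffun 'I_r -> I}) := \sum_k zeta (j k).
have up j : [forall a, T j a 0 <= x a 0]%:R <=
    \prod_a gcdf (((x + const_mx (L * eps)) a 0 - T j a 0) / eps) + e / 4.
  have P0 : 0 <= \prod_a gcdf (((x + const_mx (L * eps)) a 0 - T j a 0) / eps).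
    by apply: prodr_ge0 => a _; exact: gcdf_ge0.
  case: forallP => H; last by rewrite addr_ge0// divr_ge0// ltW.
  have := @prod_diff R 'I_p (fun=> 1) (fun a => gcdf (((x + const_mx (L * eps)) a 0 - T j a 0) / eps)) _ (fun=> g01 _).
  rewrite ler01 lexx => /(_ (fun=> isT)).
  rewrite [X in `|X - _|]big1// => H1.
  have {H1} := le_trans (ler_norm _) H1.
  have : \sum_(a < p) `|1 - gcdf (((x + const_mx (L * eps)) a 0 - T j a 0) / eps)| <= p%:R * e1.
    apply: (@le_trans _ _ (\sum_(a < p) e1)); last by rewrite sumr_const card_ord mulr_natl.
    apply: ler_sum => a _; rewrite ger0_norm ?subr_ge0 ?gcdf_le1//.
    apply: le_trans Lp; rewrite lerD2l lerN2; apply: gcdf_homo.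
    by rewrite !mxE ler_pdivlMr//; have := H a; lra.
  move=> h1 h2; rewrite -lerBlDl (le_trans h2)// (le_trans h1)//; lra.
have lo j : \prod_a gcdf (((x + const_mx (- L * eps)) a 0 - T j a 0) / eps) - e / 4 <=
    [forall a, T j a 0 <= x a 0]%:R.
  case: (boolP [forall a, _]) => [_|]; rewrite /=.
    have : \prod_a gcdf (((x + const_mx (- L * eps)) a 0 - T j a 0) / eps) <= 1.
      by apply: prodr_ile1 => a _; exact: g01.
    lra.
  rewrite negb_forall => /existsP[a]; rewrite -ltNge => xT.
  rewrite (bigD1 a)//= subr_le0.
  apply: (@le_trans _ _ (e1 * 1)).
    rewrite ler_pM ?gcdf_ge0//; first by apply: prodr_ge0 => b _; exact: gcdf_ge0.
      apply: le_trans Lm; apply: gcdf_homo.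
      by rewrite !mxE ler_pdivrMr//; lra.
    by apply: prodr_ile1 => b _; exact: g01.
  by rewrite mulr1 -pe1 mulrDl mul1r lerDr mulr_ge0// ltW.
have hu := draws_avg_le pi pi0 r _ _ up; have hl := draws_avg_le pi pi0 r _ _ lo.
rewrite draws_avgD draws_avg_cst// in hu; rewrite draws_avgD draws_avg_cst// in hl.
have := lind (x + const_mx (L * eps)); rewrite ler_norml => /andP[_ la].
have := lind (x + const_mx (- L * eps)); rewrite ler_norml => /andP[lb _].
have := shift L (gtr0_norm L0); rewrite ler_norml => /andP[_ sa].
have := shift (- L); rewrite normrN => /(_ (gtr0_norm L0)); rewrite ler_norml => /andP[sb _].
rewrite ler_norml; apply/andP; split.
  rewrite lerBrDl; apply: le_trans hl; rewrite /T; exact: lower lb sb.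
rewrite lerBlDl; apply: (le_trans hu); rewrite /T; exact: upper la sa.
Qed.

End clt.

(** * Positive definite matrices *)

Section linalg.
Context {R : realType} {p : nat}.
Implicit Types (u v x : 'cV[R]_p) (A B S : 'M[R]_p).

Lemma dotE u v : dot u v = \sum_a u a 0 * v a 0.
Proof. by rewrite /dot mxE; apply: eq_bigr => a _; rewrite mxE. Qed.

Lemma dotC u v : dot u v = dot v u.
Proof. by rewrite !dotE; apply: eq_bigr => a _; rewrite mulrC. Qed.

Lemma dotDr u v w : dot u (v + w) = dot u v + dot u w.
Proof. by rewrite /dot mulmxDr mxE. Qed.

Lemma dotBr u v w : dot u (v - w) = dot u v - dot u w.
Proof. by rewrite /dot mulmxBr !mxE. Qed.

Lemma dotZr (k : R) u v : dot u (k *: v) = k * dot u v.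
Proof. by rewrite /dot -scalemxAr mxE. Qed.

Lemma dotDl u v w : dot (v + w) u = dot v u + dot w u.
Proof. by rewrite ![dot _ u]dotC dotDr. Qed.

Lemma dotZl (k : R) u v : dot (k *: u) v = k * dot u v.
Proof. by rewrite ![dot _ v]dotC dotZr. Qed.

Lemma dot0r u : dot u 0 = 0.
Proof. by rewrite /dot mulmx0 mxE. Qed.

Lemma dot_sumr (I : finType) (F : I -> 'cV[R]_p) u :
  dot u (\sum_i F i) = \sum_i dot u (F i).
Proof. by rewrite /dot mulmx_sumr summxE. Qed.

Lemma dot_adj A u v : dot u (A *m v) = dot (A^T *m u) v.
Proof. by rewrite /dot trmx_mul trmxK mulmxA. Qed.

Lemma outerE u v a b : (u *m v^T) a b = u a 0 * v b 0.
Proof. by rewrite mxE big_ord1 mxE. Qed.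

Lemma dot_outer x u v : dot u (x *m x^T *m v) = dot u x * dot x v.
Proof.
have -> : dot u (x *m x^T *m v) = ((u^T *m x) *m (x^T *m v)) 0 0.
  by rewrite /dot !mulmxA.
by rewrite mxE big_ord1.
Qed.

Lemma dot_delta u a : dot u (delta_mx a 0) = u a 0.
Proof.
rewrite dotE (bigD1 a)//= mxE !eqxx mulr1 big1 ?addr0//.
by move=> d /negPf da; rewrite mxE da mulr0.
Qed.

Lemma qformE A u : qform A u = dot u (A *m u).
Proof. by rewrite /qform /dot mulmxA. Qed.

Lemma qform_sum A u : qform A u = \sum_a \sum_b A a b * (u a 0 * u b 0).
Proof.
rewrite qformE dotE; apply: eq_bigr => a _; rewrite mxE mulr_sumr.
by apply: eq_bigr => b _; rewrite mulrCA.
Qed.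

Lemma enorm2E u : enorm u ^+ 2 = \sum_a u a 0 ^+ 2.
Proof. by rewrite sqr_sqrtr// sumr_ge0// => a _; exact: sqr_ge0. Qed.

Lemma enorm2_gt0 u : u != 0 -> 0 < enorm u ^+ 2.
Proof.
move=> u0; rewrite lt0r enorm2E sumr_ge0 ?andbT; last by move=> a _; exact: sqr_ge0.
apply: contra u0 => /eqP/psumr_eq0P H; apply/eqP/matrixP => a b; rewrite ord1 mxE.
by apply/eqP; rewrite -sqrf_eq0 H// => c _; exact: sqr_ge0.
Qed.

Lemma le_enorm u a : `|u a 0| <= enorm u.
Proof.
rewrite -(ler_pXn2r (ltn0Sn 1)) ?nnegrE ?sqrtr_ge0// enorm2E real_normK ?num_real//.
by rewrite (bigD1 a)//= lerDl sumr_ge0// => b _; exact: sqr_ge0.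
Qed.

(** A quantitative form of positive definiteness: the smallest eigenvalue of a
    symmetric [A] is at least [c]. *)
Definition coercive (c : R) A := forall u, c * enorm u ^+ 2 <= qform A u.

Lemma coercive_qform_gt0 c A u : 0 < c -> coercive c A -> u != 0 -> 0 < qform A u.
Proof. by move=> c0 cA u0; apply: lt_le_trans (cA u); rewrite mulr_gt0 ?enorm2_gt0. Qed.

Lemma qform_gt0_unitmx A : (forall u, u != 0 -> 0 < qform A u) -> A \in unitmx.
Proof.
move=> A0; rewrite -row_free_unit -kermx_eq0; apply/negPn/negP => /rowV0Pn[v].
rewrite sub_kermx => /eqP vA v0.
have /A0 : v^T != 0 by rewrite trmx_eq0.
by rewrite /qform trmxK vA mul0mx mxE ltxx.
Qed.

(** For a column [v] of the inverse, [qform A v] is an entry of [v], so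
    coercivity bounds the square of [v] by the entry itself. *)
Lemma coercive_inv c A a b : 0 < c -> coercive c A -> `|invmx A a b| <= c^-1.
Proof.
move=> c0 cA.
have uA : A \in unitmx.
  by apply: qform_gt0_unitmx => u; exact: coercive_qform_gt0 cA.
pose v := col b (invmx A).
have Av : A *m v = delta_mx b 0 by rewrite /v colE mulmxA mulmxV// mul1mx.
have qv : qform A v = v b 0.
  by rewrite qformE Av dot_delta.
have := cA v; rewrite qv => h.
have h' d : c * v d 0 ^+ 2 <= v b 0.
  apply: le_trans h; rewrite ler_pM2l// -[_ ^+ 2]real_normK ?num_real//.
  by rewrite lerXn2r ?nnegrE ?sqrtr_ge0// le_enorm.
have vb : v b 0 <= c^-1.
  have := h' b; have [v0|v0] := leP (v b 0) 0; first by rewrite (le_trans v0)// invr_ge0 ltW.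
  by rewrite expr2 mulrA ger_pMl// mulrC => ?; rewrite -[leRHS]mul1r ler_pdivlMr.
have : `|v a 0| ^+ 2 <= c^-1 ^+ 2.
  rewrite real_normK ?num_real// expr2 ler_pdivlMl//.
  exact: le_trans (h' a) vb.
by rewrite ler_pXn2r ?nnegrE ?invr_ge0 ?(ltW c0)// mxE.
Qed.

Lemma posdef_unitmx A : posdef A -> A \in unitmx.
Proof. by case=> _; exact: qform_gt0_unitmx. Qed.

(** Cauchy-Schwarz for the inner product of [A]. *)
Lemma posdef_CS A x u : posdef A ->
  dot x (A *m u) ^+ 2 <= qform A x * qform A u.
Proof.
move=> [As A0].
have [->|x0] := eqVneq x 0.
  by rewrite qformE !dotE !big1 ?expr0n ?mul0r// => a _; rewrite mxE mul0r.
have qx := A0 _ x0.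
set B := dot x _; set q := qform A x in qx *.
have : 0 <= qform A (q *: u - B *: x).
  have [->|w0] := eqVneq (q *: u - B *: x) 0; last exact/ltW/A0.
  by rewrite qformE mulmx0 dot0r.
have -> : qform A (q *: u - B *: x) = q * (q * qform A u - B ^+ 2).
  have Bs : dot u (A *m x) = B by rewrite dot_adj As dotC.
  rewrite qformE -scaleNr mulmxDr -!scalemxAr !dotDl !dotDr !dotZl !dotZr Bs.
  rewrite -!qformE -/B -/q; ring.
by rewrite pmulr_rge0// subr_ge0.
Qed.

(** No compactness is involved: [u a 0] is the [A]-inner product of [u] with the
    column [a] of the inverse of [A], so Cauchy-Schwarz shows that the inverse
    of the trace of [invmx A] can serve as constant. *)
Lemma posdef_coercive A : posdef A -> exists2 c : R, 0 < c & coercive c A.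
Proof.
move=> pA; have uA := posdef_unitmx _ pA; have [As A0] := pA.
have key u a : u a 0 ^+ 2 <= invmx A a a * qform A u.
  pose x := col a (invmx A).
  have Ax : A *m x = delta_mx a 0 by rewrite /x colE mulmxA mulmxV// mul1mx.
  have := posdef_CS A x u pA; rewrite dot_adj As Ax [dot _ u]dotC dot_delta.
  by rewrite [qform A x]qformE Ax dot_delta mxE.
have inv0 a : 0 <= invmx A a a.
  have := key (delta_mx a 0) a; rewrite mxE !eqxx expr1n => h.
  have : 0 < qform A (delta_mx a 0).
    apply: A0; apply/eqP => /matrixP/(_ a 0); rewrite !mxE !eqxx => /eqP.
    by rewrite oner_eq0.
  by move=> q0; rewrite -(pmulr_lge0 _ q0) (le_trans _ h).
pose t := \sum_a invmx A a a + 1.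
have t0 : 0 < t by rewrite ltr_wpDl// sumr_ge0.
exists t^-1; first by rewrite invr_gt0.
move=> u; rewrite mulrC ler_pdivrMr// enorm2E mulrC.
have q0 : 0 <= qform A u.
  have [->|u0] := eqVneq u 0; last exact/ltW/A0.
  by rewrite qformE mulmx0 dot0r.
apply: (@le_trans _ _ (\sum_a invmx A a a * qform A u)); first exact: ler_sum.
by rewrite -mulr_suml ler_wpM2r// lerDl.
Qed.

Lemma coercive_perturb c e A B : coercive c A ->
  (forall a b, `|B a b - A a b| <= e) -> coercive (c - p%:R * e) B.
Proof.
move=> cA BA u; rewrite mulrBl.
have -> : qform B u = qform A u + \sum_a \sum_b (B a b - A a b) * (u a 0 * u b 0).
  rewrite !qform_sum -big_split; apply: eq_bigr => a _ /=.
  by rewrite -big_split; apply: eq_bigr => b _ /=; rewrite -mulrDl addrC subrK.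
rewrite lerD// lerNl.
apply: (@le_trans _ _ (\sum_a \sum_b e * ((u a 0 ^+ 2 + u b 0 ^+ 2) / 2))).
  rewrite -sumrN ler_sum// => a _; rewrite -sumrN ler_sum// => b _.
  rewrite -mulNr (le_trans (ler_norm _))// normrM normrN ler_pM//.
  rewrite normrM -[u a 0 ^+ 2]real_normK ?num_real// -[u b 0 ^+ 2]real_normK ?num_real//.
  by have := sqr_ge0 (`|u a 0| - `|u b 0|); nra.
under eq_bigr do rewrite -mulr_sumr -mulr_suml big_split/= sumr_const card_ord.
rewrite -mulr_sumr -mulr_suml big_split/= sumr_const card_ord -enorm2E.
rewrite sumrMnl -enorm2E -[enorm u ^+ 2 *+ p]mulr_natl le_eqVlt; apply/orP; left.
by apply/eqP; field.
Qed.

(** The positive square root depends continuously on its square, at any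
    coercive [S2]. With [D = S1 - S2], the difference [S1 *m D + D *m S2] of
    the squares has with [D] the trace product
    [\tr (D *m S1 *m D) + \tr (D *m S2 *m D)], which is at least [c] times
    the squared Frobenius norm of [D]. *)
Lemma posdef_sqrt_stable S1 S2 c q : posdef S1 -> S2^T = S2 -> 0 < c ->
  coercive c S2 -> (forall a b, `|(S1 *m S1) a b - (S2 *m S2) a b| <= q) ->
  forall a b, `|S1 a b - S2 a b| <= p%:R * q / c.
Proof.
move=> [S1s S10] S2s c0 cS2 Q.
pose D := S1 - S2; pose QQ := S1 *m S1 - S2 *m S2.
have Ds : D^T = D by rewrite /D linearB/= S1s S2s.
have QE : QQ = S1 *m D + D *m S2 by rewrite /QQ /D mulmxBr mulmxBl addrA subrK.
have trE M N : \tr (M^T *m (N *m M)) = \sum_a qform N (col a M).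
  rewrite mulmxA /mxtrace; apply: eq_bigr => a _; rewrite /qform tr_col !mxE.
  apply: eq_bigr => b _; rewrite !mxE; congr (_ * _).
  by apply: eq_bigr => d _; rewrite !mxE.
have q0 N : posdef N -> forall u, 0 <= qform N u.
  move=> [_ N0] u; have [->|u0] := eqVneq u 0; last exact/ltW/N0.
  by rewrite qformE mulmx0 dot0r.
have normD : \sum_a enorm (col a D) ^+ 2 = \sum_a \sum_b D b a ^+ 2.
  by apply: eq_bigr => a _; rewrite enorm2E; apply: eq_bigr => b _; rewrite mxE.
have key : c * \sum_a \sum_b D b a ^+ 2 <= \tr (D *m QQ).
  have e1 : \tr (D *m (S1 *m D)) = \sum_a qform S1 (col a D) by rewrite -trE Ds.
  have e2 : \tr (D *m (D *m S2)) = \sum_a qform S2 (col a D).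
    by rewrite -trE Ds mulmxA mxtrace_mulC [RHS]mxtrace_mulC mulmxA.
  rewrite QE mulmxDr linearD/= e1 e2.
  rewrite -normD mulr_sumr -[leLHS]add0r lerD//.
    by apply: sumr_ge0 => a _; exact: q0.
  by apply: ler_sum => a _; exact: cS2.
have QQq a b : `|QQ a b| <= q.
  by apply: le_trans (Q a b); rewrite /QQ mxE [X in _ + X]mxE.
(* q |d| <= c d^2 / 2 + q^2 / (2 c), so that half of the left side absorbs it. *)
have ub : \tr (D *m QQ) <= \sum_a \sum_b (c / 2 * D b a ^+ 2 + q ^+ 2 / (2 * c)).
  rewrite /mxtrace; apply: ler_sum => a _; rewrite mxE; apply: ler_sum => b _.
  have -> : D a b = D b a by rewrite -{1}Ds mxE.
  apply: le_trans (ler_norm _) _; rewrite normrM.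
  apply: (@le_trans _ _ (`|D b a| * q)); first by rewrite ler_wpM2l.
  rewrite -[D b a ^+ 2]real_normK ?num_real//; set d := `|D b a|.
  rewrite -subr_ge0 (_ : _ - _ = (c * d - q) ^+ 2 / (2 * c)).
    by rewrite divr_ge0 ?sqr_ge0// mulr_ge0// ltW.
  by field; rewrite gt_eqF.
have fin : \sum_a \sum_b D b a ^+ 2 <= p%:R ^+ 2 * (q ^+ 2 / c ^+ 2).
  have := le_trans key ub.
  under [X in _ <= X -> _]eq_bigr do rewrite big_split/= -mulr_sumr sumr_const card_ord.
  rewrite big_split/= -mulr_sumr sumr_const card_ord -[_ *+ p *+ p]mulr_natl -[_ *+ p]mulr_natl.
  set Z := \sum_a _ => h.
  have {}h : c / 2 * Z <= p%:R * (p%:R * (q ^+ 2 / (2 * c))) by lra.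
  have c2 : 0 < c / 2 by rewrite divr_gt0.
  rewrite -(ler_pM2l c2) (le_trans h)// le_eqVlt; apply/orP; left; apply/eqP.
  by field; rewrite gt_eqF.
move=> a b.
have q00 : 0 <= q by exact: le_trans (QQq a b).
have : `|D a b| ^+ 2 <= (p%:R * q / c) ^+ 2.
  rewrite real_normK ?num_real//.
  apply: (le_trans _ (le_trans fin _)); last by rewrite -exprVn -!exprMn mulrA.
  rewrite (bigD1 b)//= (bigD1 a)//= -addrA lerDl addr_ge0//.
    by apply: sumr_ge0 => ? _; exact: sqr_ge0.
  by apply: sumr_ge0 => ? _; apply: sumr_ge0 => ? _; exact: sqr_ge0.
by rewrite ler_pXn2r ?nnegrE ?divr_ge0 ?mulr_ge0 ?(ltW c0)// !mxE.
Qed.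

Lemma sym_entry_le S a b : S^T = S -> S a b ^+ 2 <= (S *m S) a a.
Proof.
move=> Ss; rewrite mxE.
rewrite (eq_bigr (fun d => S a d ^+ 2)); last first.
  by move=> d _; rewrite -[S d a]/(S d a) -{2}Ss mxE.
by rewrite (bigD1 b)//= lerDl sumr_ge0// => d _; exact: sqr_ge0.
Qed.

Definition entries_le {m n} (A : 'M[R]_(m, n)) (k : R) := forall a b, `|A a b| <= k.

Lemma entries_leM m n q (A : 'M[R]_(m, n)) (B : 'M[R]_(n, q)) (j k : R) :
  0 <= j -> entries_le A j -> entries_le B k -> entries_le (A *m B) (n%:R * (j * k)).
Proof.
move=> j0 Aj Bk a b; rewrite mxE (le_trans (ler_norm_sum _ _ _))//.
apply: (@le_trans _ _ (\sum_(d < n) (j * k))).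
  by apply: ler_sum => d _; rewrite normrM ler_pM.
by rewrite sumr_const card_ord mulr_natl.
Qed.

End linalg.

(** * Corrected least squares and the subsampled score *)

Section weighted_loss.
Context {R : realType} {p : nat} {I : finType}.
Variables (cn : R) (wt : I -> R) (W : I -> 'cV[R]_p) (y : I -> R) (Suu : 'M[R]_p).

(** Both the loss and the subsample loss are of this form. *)
Definition wloss (b : 'cV[R]_p) : R :=
  (2 * cn)^-1 * \sum_i wt i * (y i - dot (W i) b) ^+ 2 - 2^-1 * qform Suu b.
Definition whess : 'M[R]_p := cn^-1 *: \sum_i wt i *: (W i *m (W i)^T) - Suu.
Definition wscore : 'cV[R]_p := cn^-1 *: \sum_i (wt i * y i) *: W i.

Hypothesis Suus : Suu^T = Suu.

(** The loss is quadratic, with Hessian [whess] and gradient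
    [whess *m b - wscore]. *)
Lemma wloss_shift b v : wloss (b + v) =
  wloss b - dot v (wscore - whess *m b) + 2^-1 * qform whess v.
Proof.
have hess u w : dot u (whess *m w) =
    cn^-1 * (\sum_i wt i * (dot u (W i) * dot (W i) w)) - dot u (Suu *m w).
  rewrite /whess mulmxBl dotBr -scalemxAl dotZr mulmx_suml dot_sumr.
  congr (_ * _ - _); apply: eq_bigr => i _.
  by rewrite -scalemxAl dotZr dot_outer.
rewrite dotBr hess qformE hess /wscore dotZr dot_sumr /wloss.
have -> : qform Suu (b + v) = qform Suu b + 2 * dot v (Suu *m b) + dot v (Suu *m v).
  rewrite !qformE mulmxDr !dotDr !dotDl [dot b (Suu *m v)]dot_adj Suus.
  by rewrite [dot (Suu *m b) v]dotC; ring.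
have -> : \sum_i wt i * (y i - dot (W i) (b + v)) ^+ 2 =
  \sum_i wt i * (y i - dot (W i) b) ^+ 2 - 2 * (\sum_i dot v ((wt i * y i) *: W i))
  + 2 * (\sum_i wt i * (dot v (W i) * dot (W i) b))
  + \sum_i wt i * (dot v (W i) * dot (W i) v).
  rewrite !mulr_sumr -sumrN -!big_split; apply: eq_bigr => i _ /=.
  by rewrite dotDr dotZr [dot v (W i)]dotC; ring.
by rewrite invfM; move: cn^-1 => ci; field.
Qed.

Hypothesis hpos : forall u, u != 0 -> 0 < qform whess u.

(** Completing the square: with a positive definite Hessian the minimizers are
    the solutions of the normal equations. *)
Lemma wloss_argmin : is_argmin wloss (invmx whess *m wscore).
Proof.
move=> b; set b0 := _ *m _; rewrite -[b](subrK b0) addrC wloss_shift.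
rewrite /b0 mulKVmx ?qform_gt0_unitmx// -/b0 subrr dot0r subr0.
rewrite lerDl mulr_ge0//; have [->|] := eqVneq (b - b0) 0; last by move/hpos/ltW.
by rewrite qformE dotE big1// => a _; rewrite mxE mul0r.
Qed.

Lemma wloss_argmin_eq b : is_argmin wloss b -> whess *m b = wscore.
Proof.
move=> bmin; set b0 := invmx whess *m wscore.
have Hb0 : whess *m b0 = wscore by rewrite /b0 mulKVmx ?qform_gt0_unitmx.
have := bmin b0; rewrite -[in X in X <= _ -> _](subrK b0 b) addrC wloss_shift.
rewrite Hb0 subrr dot0r subr0.
rewrite gerDl => h; suff /eqP -> : b == b0 by [].
rewrite -subr_eq0; apply: contraTT h => /hpos h; rewrite -ltNge.
by rewrite mulr_gt0.
Qed.

End weighted_loss.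

Section sampling.
Context {R : realType} {p : nat}.
Variables (n r : nat) (Suu : 'M[R]_p) (W : nat -> 'cV[R]_p) (y pi : nat -> R).
Variable bh : 'cV[R]_p.

Local Notation e := (resid W y bh).
Local Notation H := (HW Suu W n).

Definition score : 'cV[R]_p := n%:R^-1 *: \sum_(i < n) y i *: W i.
Definition sub_hess (j : {ffun 'I_r -> 'I_n}) : 'M[R]_p :=
  whess n%:R (fun k : 'I_r => (r%:R * pi (j k))^-1) (fun k => W (j k)) Suu.
Definition sub_score (j : {ffun 'I_r -> 'I_n}) : 'cV[R]_p :=
  wscore n%:R (fun k : 'I_r => (r%:R * pi (j k))^-1) (fun k => W (j k)) (fun k => y (j k)).
(** The contribution of the data point [i], when drawn, to minus the gradient
    of the subsample loss at [bh]. The second term centres it (see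
    [xi_mean]). *)
Definition xi (i : nat) : 'cV[R]_p := (e i / (n%:R * pi i)) *: W i + Suu *m bh.
Definition mean_xi (j : {ffun 'I_r -> 'I_n}) : 'cV[R]_p :=
  r%:R^-1 *: \sum_k xi (j k).

Hypothesis Suus : Suu^T = Suu.

Lemma HW_whess : H = whess n%:R (fun=> 1) (fun i : 'I_n => W i) Suu.
Proof. by rewrite /HW /whess; under [in RHS]eq_bigr do rewrite scale1r. Qed.

Lemma score_wscore : score = wscore n%:R (fun=> 1) (fun i : 'I_n => W i) (fun i : 'I_n => y i).
Proof. by rewrite /score /wscore; under [in RHS]eq_bigr do rewrite mul1r. Qed.

Lemma loss_wloss : loss Suu W y n =
  wloss n%:R (fun=> 1) (fun i : 'I_n => W i) (fun i : 'I_n => y i) Suu.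
Proof.
by apply/funext => b; rewrite /loss /wloss; under [in RHS]eq_bigr do rewrite mul1r.
Qed.

Lemma subloss_wloss (J : nat -> nat) (j : {ffun 'I_r -> 'I_n}) :
  (forall k : 'I_r, J k = j k :> nat) -> subloss Suu W y n r pi J =
  wloss n%:R (fun k : 'I_r => (r%:R * pi (j k))^-1) (fun k => W (j k)) (fun k => y (j k)) Suu.
Proof.
move=> Jj; apply/funext => b; rewrite /subloss /wloss; congr (_ * _ - _).
by apply: eq_bigr => k _; rewrite Jj.
Qed.

Lemma HW_sym : H^T = H.
Proof.
rewrite /HW linearB linearZ/= Suus; congr (_ *: _ - _).
by rewrite linear_sum; apply: eq_bigr => i _/=; rewrite trmx_mul trmxK.
Qed.

Hypothesis r0 : (0 < r)%N.
Hypothesis n0 : (0 < n)%N.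
Hypothesis pi_gt0 : forall i, (i < n)%N -> 0 < pi i.
Hypothesis pi1 : \sum_(i < n) pi i = 1.
Hypothesis bhE : H *m bh = score.

Let rN0 : r%:R != 0 :> R. Proof. by rewrite pnatr_eq0 -lt0n. Qed.
Let nN0 : n%:R != 0 :> R. Proof. by rewrite pnatr_eq0 -lt0n. Qed.
Let piN0 (i : 'I_n) : pi i != 0. Proof. by rewrite gt_eqF// pi_gt0. Qed.

(** The subsample estimator solves [sub_hess j *m b = sub_score j], so
    [mean_xi j] is what drives its distance to [bh]. *)
Lemma sub_score_residual j : sub_score j - sub_hess j *m bh = mean_xi j.
Proof.
rewrite /sub_score /sub_hess /mean_xi /wscore /whess mulmxBl opprB addrC -addrA addrC.
rewrite /xi big_split/= sumr_const card_ord scalerDr.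
rewrite -[Suu *m bh *+ r]scaler_nat scalerA mulVf// scale1r; congr (_ + _).
rewrite addrC -scalemxAl -scalerBr.
rewrite mulmx_suml -sumrB !scaler_sumr; apply: eq_bigr => k _.
have -> : (r%:R * pi (j k))^-1 *: (W (j k) *m (W (j k))^T) *m bh =
    ((r%:R * pi (j k))^-1 * dot (W (j k)) bh) *: W (j k).
  rewrite -scalemxAl -mulmxA [(W (j k))^T *m bh]mx11_scalar mul_mx_scalar scalerA.
  by rewrite /dot.
rewrite -scalerBl !scalerA; congr (_ *: _); rewrite /resid; field.
by rewrite nN0 rN0 piN0.
Qed.

(** The normal equations in terms of the residuals; the measurement error
    correction keeps the right side from being 0. *)
Lemma mean_residual : n%:R^-1 *: \sum_(i < n) e i *: W i = - (Suu *m bh).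
Proof.
have : H *m bh + Suu *m bh = n%:R^-1 *: \sum_(i < n) dot (W i) bh *: W i.
  rewrite /HW mulmxBl subrK -scalemxAl mulmx_suml; congr (_ *: _).
  apply: eq_bigr => i _.
  by rewrite -mulmxA [(W i)^T *m bh]mx11_scalar mul_mx_scalar /dot.
rewrite bhE => h.
have -> : \sum_(i < n) e i *: W i = \sum_(i < n) y i *: W i - \sum_(i < n) dot (W i) bh *: W i.
  by rewrite -sumrB; apply: eq_bigr => i _; rewrite -scalerBl.
by rewrite scalerBr -h -/score opprD addNKr.
Qed.

Lemma xi_mean : \sum_(i < n) pi i *: xi i = 0.
Proof.
rewrite /xi; under eq_bigr do rewrite scalerDr scalerA.
rewrite big_split/= -scaler_suml pi1 scale1r.
rewrite (eq_bigr (fun i : 'I_n => n%:R^-1 *: (e i *: W i))); last first.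
  by move=> i _; rewrite scalerA; congr (_ *: _); field; rewrite nN0 piN0.
by rewrite -scaler_sumr mean_residual addNr.
Qed.

(** By [mean_residual] the cross terms combine with the square of the centring
    term, which explains the subtracted term of [Vc]. *)
Lemma xi_cov : \sum_(i < n) pi i *: (xi i *m (xi i)^T) = r%:R *: Vc Suu W y n r pi bh.
Proof.
set s := Suu *m bh.
have -> : r%:R *: Vc Suu W y n r pi bh =
    (n%:R ^+ 2)^-1 *: \sum_(i < n) (e i ^+ 2 / pi i) *: (W i *m (W i)^T) - s *m s^T.
  by rewrite /Vc scalerBr !scalerA invfM mulrA mulfV// mul1r scale1r.
have E (i : 'I_n) : pi i *: (xi i *m (xi i)^T) =
   (n%:R ^+ 2)^-1 *: ((e i ^+ 2 / pi i) *: (W i *m (W i)^T)) + (pi i *: xi i) *m s^T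
   + s *m (pi i *: xi i)^T - pi i *: (s *m s^T).
  have xiT : (xi i)^T = (e i / (n%:R * pi i)) *: (W i)^T + s^T.
    by rewrite /xi linearD linearZ.
  have pxiT : (pi i *: xi i)^T = (pi i * (e i / (n%:R * pi i))) *: (W i)^T + pi i *: s^T.
    by rewrite linearZ/= xiT scalerDr scalerA.
  rewrite pxiT xiT /xi -/s !mulmxDl !mulmxDr !scalerDr !mulmxDl.
  rewrite -!scalemxAl -!scalemxAr !scalerA.
  set A := W i *m _; set B := W i *m _; set C := s *m _; set D := s *m _.
  have -> : pi i * (e i / (n%:R * pi i)) * (e i / (n%:R * pi i)) = (n%:R ^+ 2)^-1 * (e i ^+ 2 / pi i).
    by field; rewrite nN0 piN0.
  have -> : pi i * (e i / (n%:R * pi i)) = e i / n%:R by field; rewrite nN0 piN0.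
  apply/matrixP => a b; rewrite !mxE; ring.
under eq_bigr do rewrite E.
rewrite sumrB !big_split/= -scaler_sumr -mulmx_suml -mulmx_sumr -scaler_suml.
by rewrite -linear_sum/= xi_mean pi1 scale1r mul0mx trmx0 mulmx0 !addr0.
Qed.

End sampling.

(** * Bounds at a good outcome *)

(** Chebyshev's inequality. *)
Lemma markov_sqr {R : realType} {I : finType} (pi : I -> R) r
    (f : {ffun 'I_r -> I} -> R) (t : R) : (forall i, 0 <= pi i) -> 0 < t ->
  draws_avg pi r (fun j => (t < `|f j|)%R%:R) <= draws_avg pi r (fun j => f j ^+ 2) / t ^+ 2.
Proof.
move=> pi0 t0; rewrite mulrC -draws_avgZ; apply: draws_avg_le => // j.
rewrite mulrC; case: ltP => tf /=; last by rewrite divr_ge0// sqr_ge0.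
rewrite ler_pdivlMr ?exprn_gt0// mul1r -[f j ^+ 2]real_normK ?num_real//.
by rewrite lerXn2r ?nnegrE// ltW.
Qed.

(** Lower powers are dominated by a higher one, so that the moment of order
    [2 + delta] controls all the moments needed. *)
Lemma powR_dom {R : realType} (t q : R) : 0 <= t -> 2 <= q ->
  [/\ t <= 1 + t `^ q, t ^+ 2 <= 1 + t `^ q &
      forall q', 0 <= q' <= q -> t `^ q' <= 1 + t `^ q].
Proof.
move=> t0 q2.
have H q' : 0 <= q' <= q -> t `^ q' <= 1 + t `^ q.
  move=> /andP[q'0 q'q]; have [t1|t1] := leP t 1.
    rewrite (@le_trans _ _ 1)// ?lerDl ?powR_ge0//.
    by have := @ge0_ler_powR R q' q'0 t 1; rewrite !nnegrE powR1; apply.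
  by rewrite (@le_trans _ _ (t `^ q))// ?lerDr// ler_powR// ltW.
split=> //.
  have := H 1; rewrite powRr1// => -> //; lra.
have := H 2%:R; rewrite powR_mulrn// => -> //; lra.
Qed.

Section good_outcome.
Context {R : realType} {p : nat}.
Variables (c M delta : R).
Variables (n r : nat) (Suu : 'M[R]_p) (W : nat -> 'cV[R]_p) (y pi : nat -> R).
Variable bh : 'cV[R]_p.

Local Notation e := (resid W y bh).
Local Notation H := (HW Suu W n).
Local Notation VC := (Vc Suu W y n r pi bh).
Local Notation V := (Vmx Suu W y n r pi bh).

(** The conditions on the data under which the conditional law of the subsample
    estimator is close to normal. The constants [c], [M] and [delta] are shared
    by all sample sizes; they come from the assumptions, outside an event of
    small probability. *)
Record good : Prop := Good {
  good_pi : forall i, (i < n)%N -> 0 < pi i /\ (n%:R * pi i)^-1 <= M;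
  good_bh : H *m bh = score n W y;
  good_H : coercive c H;
  good_HM : entries_le H M;
  good_V : coercive c (r%:R *: VC);
  good_W4 : n%:R^-1 * (\sum_(i < n) enorm (W i) ^+ 4) <= M;
  good_eW : n%:R^-1 * (\sum_(i < n) `|e i| `^ (2 + delta) * enorm (W i) `^ (2 + delta)) <= M
}.

Hypothesis c0 : 0 < c.
Hypothesis M1 : 1 <= M.
Hypothesis d0 : 0 < delta.
Hypothesis Suus : Suu^T = Suu.
Hypothesis r0 : (0 < r)%N.
Hypothesis n0 : (0 < n)%N.
Hypothesis pi1 : \sum_(i < n) pi i = 1.
Hypothesis G : good.

Let rp : 0 < r%:R :> R. Proof. by rewrite ltr0n. Qed.
Let np : 0 < n%:R :> R. Proof. by rewrite ltr0n. Qed.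
Let ni0 : 0 <= n%:R^-1 :> R. Proof. by rewrite invr_ge0. Qed.
Let piP (i : 'I_n) : 0 < pi i. Proof. by case: (good_pi G i (ltn_ord i)). Qed.
Let piM (i : 'I_n) : (n%:R * pi i)^-1 <= M. Proof. by case: (good_pi G i (ltn_ord i)). Qed.
Let pi_gt0 i : (i < n)%N -> 0 < pi i. Proof. by move=> /(good_pi G)[]. Qed.
Let pi0 (i : 'I_n) : 0 <= pi i. Proof. exact: ltW. Qed.

(* Draws are weighted by pi, and averages over the data by 1/n = pi i * m i. *)
Let m (i : nat) : R := (n%:R * pi i)^-1.
Let g (i : nat) : R := `|e i| * enorm (W i).
Let m0 (i : 'I_n) : 0 < m i. Proof. by rewrite invr_gt0 mulr_gt0. Qed.
Let g0 i : 0 <= g i. Proof. by rewrite mulr_ge0 ?sqrtr_ge0. Qed.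
Let pim (i : 'I_n) : pi i * m i = n%:R^-1.
Proof. by rewrite /m; field; rewrite !gt_eqF. Qed.

Let gq : n%:R^-1 * (\sum_(i < n) g i `^ (2 + delta)) <= M.
Proof.
by apply: le_trans (good_eW G); rewrite ler_wpM2l// ler_sum// => i _;
  rewrite powRM ?sqrtr_ge0.
Qed.

Let avg_dom (f : R -> R) :
  (forall t : R, 0 <= t -> f t <= 1 + t `^ (2 + delta)) ->
  n%:R^-1 * (\sum_(i < n) f (g i)) <= 1 + M.
Proof.
move=> fd.
apply: (@le_trans _ _ (n%:R^-1 * (\sum_(i < n) (1 + g i `^ (2 + delta))))).
  by rewrite ler_wpM2l// ler_sum// => i _; exact: fd.
rewrite big_split/= sumr_const card_ord mulrDr mulVf ?gt_eqF//.
by rewrite lerD2l.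
Qed.

Let avg_g1 : n%:R^-1 * (\sum_(i < n) g i) <= 1 + M.
Proof.
apply: (avg_dom id) => t t0.
by case: (powR_dom t (2 + delta) t0 _) => //; rewrite lerDl ltW.
Qed.

Let avg_g2 : n%:R^-1 * (\sum_(i < n) g i ^+ 2) <= 1 + M.
Proof.
apply: (avg_dom (fun t => t ^+ 2)) => t t0.
by case: (powR_dom t (2 + delta) t0 _) => //; rewrite lerDl ltW.
Qed.

(** By [mean_residual] the centring term is an average over the data. *)
Lemma good_bias a : `|(Suu *m bh) a 0| <= 1 + M.
Proof.
have -> : Suu *m bh = - (n%:R^-1 *: \sum_(i < n) e i *: W i).
  rewrite -[LHS]opprK; congr (- _); symmetry.
  exact: mean_residual (good_bh G).
rewrite mxE normrN mxE summxE normrM (ger0_norm ni0).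
apply: le_trans avg_g1; rewrite ler_wpM2l//.
rewrite (le_trans (ler_norm_sum _ _ _))// ler_sum// => i _.
by rewrite mxE normrM ler_wpM2l// le_enorm.
Qed.

Lemma xi_moment a b : \sum_(i < n) pi i * (xi n Suu W y pi bh i a 0 * xi n Suu W y pi bh i b 0)
  = (r%:R *: VC) a b.
Proof.
rewrite -(@xi_cov _ _ n r Suu W y pi bh r0 n0 pi_gt0 pi1 (good_bh G)) summxE.
by apply: eq_bigr => i _; rewrite [RHS]mxE outerE.
Qed.

Lemma xi_centred a : \sum_(i < n) pi i * xi n Suu W y pi bh i a 0 = 0.
Proof.
have /matrixP/(_ a 0) := @xi_mean _ _ n Suu W y pi bh n0 pi_gt0 pi1 (good_bh G).
by rewrite summxE mxE => h; rewrite -[RHS]h; apply: eq_bigr => i _; rewrite [RHS]mxE.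
Qed.

Lemma good_Vc_diag a : (r%:R *: VC) a a <= M * (1 + M).
Proof.
have -> : (r%:R *: VC) a a = n%:R^-1 * (\sum_(i < n) m i * (e i * W i a 0) ^+ 2)
    - (Suu *m bh) a 0 ^+ 2.
  rewrite /Vc scalerBr !scalerA invfM mulrA mulfV ?gt_eqF// mul1r scale1r.
  rewrite mxE [X in X + _]mxE [X in _ + X]mxE outerE summxE -expr2; congr (_ - _).
  rewrite !mulr_sumr; apply: eq_bigr => i _.
  by rewrite [X in _ * X]mxE outerE /m; field; rewrite !gt_eqF.
rewrite lerBlDr (@le_trans _ _ (M * (1 + M)))// ?lerDl ?sqr_ge0//.
apply: (@le_trans _ _ (M * (n%:R^-1 * (\sum_(i < n) g i ^+ 2)))); last first.
  by rewrite ler_wpM2l// (le_trans ler01).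
rewrite mulrCA ler_wpM2l// mulr_sumr ler_sum// => i _.
apply: ler_pM; [exact: ltW|exact: sqr_ge0|exact: piM|].
rewrite -[(e i * _) ^+ 2]real_normK ?num_real// lerXn2r ?nnegrE// normrM.
by rewrite ler_wpM2l// le_enorm.
Qed.

Let cVC : coercive (c / r%:R) VC.
Proof.
move=> u; rewrite mulrAC ler_pdivrMr// (le_trans (good_V G u))//.
by rewrite !qformE -scalemxAl dotZr mulrC.
Qed.

Let VCs : VC^T = VC.
Proof.
have outer_sym (u : 'cV[R]_p) : (u *m u^T)^T = u *m u^T by rewrite trmx_mul trmxK.
rewrite /Vc linearB !linearZ/= outer_sym scalerN; congr (_ *: _ - _).
by rewrite linear_sum; apply: eq_bigr => i _/=; rewrite linearZ/= outer_sym.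
Qed.

Let Hs : H^T = H. Proof. exact: HW_sym. Qed.
Let Hu : H \in unitmx.
Proof. by apply: qform_gt0_unitmx => u; exact: coercive_qform_gt0 (good_H G). Qed.
Let His : (invmx H)^T = invmx H. Proof. by rewrite trmx_inv Hs. Qed.

Let cr0 : 0 < c / r%:R. Proof. by rewrite divr_gt0. Qed.

Lemma good_V_posdef : posdef V.
Proof.
split; first by rewrite /Vmx !trmx_mul His VCs mulmxA.
move=> u u0; rewrite qformE /Vmx -!mulmxA dot_adj His -qformE.
apply: coercive_qform_gt0 cr0 cVC _.
by apply: contra u0 => /eqP h; rewrite -[u](mulKVmx Hu) h mulmx0.
Qed.

Variable S : 'M[R]_p.
Hypothesis SP : is_inv_sqrt V S.

Let Vu : V \in unitmx. Proof. exact: posdef_unitmx good_V_posdef. Qed.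

(** So [S] standardizes: [V] is the covariance matrix of the linearized
    estimator. *)
Lemma inv_sqrt_sandwich : S *m V *m S = 1%:M.
Proof. by apply: mulmx1C; rewrite mulmxA (proj2 SP) mulVmx. Qed.

Definition Sbound : R := p%:R ^+ 2 * M ^+ 2 / c + 1.

(** The square of [S] is the inverse of [V], of order [r], and the diagonal of
    the square bounds the squared entries of a symmetric matrix. *)
Lemma good_S_le : entries_le S (Num.sqrt r%:R * Sbound).
Proof.
have VCu : VC \in unitmx.
  by apply: qform_gt0_unitmx => u; exact: coercive_qform_gt0 cVC.
have VE : invmx V = H *m (invmx VC *m H).
  have h : V *m (H *m (invmx VC *m H)) = 1%:M.
    by rewrite /Vmx !mulmxA mulmxKV// mulmxK// mulVmx.
  by rewrite -[RHS](mulKmx Vu) h mulmx1.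
have Vi a b : `|(invmx V) a b| <= r%:R * (p%:R ^+ 2 * M ^+ 2 / c).
  have Vci : entries_le (invmx VC) (r%:R / c).
    by move=> a' b'; rewrite (le_trans (coercive_inv _ _ _ _ cr0 cVC))// invf_div.
  have rc0 : 0 <= r%:R / c by rewrite ltW// divr_gt0.
  have M0 : 0 <= M by rewrite (le_trans ler01).
  have h1 := entries_leM _ _ _ _ _ _ _ rc0 Vci (good_HM G).
  have h2 := entries_leM _ _ _ _ _ _ _ M0 (good_HM G) h1.
  rewrite VE (le_trans (h2 a b))// le_eqVlt; apply/orP; left; apply/eqP; ring.
move=> a b; have Ss : S^T = S by case: SP => -[].
have := sym_entry_le S a b Ss; rewrite (proj2 SP) => h.
have D0 : 0 <= p%:R ^+ 2 * M ^+ 2 / c by rewrite mulr_ge0 ?invr_ge0 ?(ltW c0)// mulr_ge0 ?sqr_ge0.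
have Sb1 : 1 <= Sbound by rewrite /Sbound lerDr.
have : `|S a b| ^+ 2 <= (Num.sqrt r%:R * Sbound) ^+ 2.
  rewrite real_normK ?num_real// (le_trans h)// (le_trans (ler_norm _))//.
  rewrite (le_trans (Vi _ _))// exprMn sqr_sqrtr ?ler_pM2l//.
  rewrite (@le_trans _ _ Sbound)// ?lerDl// expr2 ler_peMr// (le_trans ler01)//.
by rewrite ler_pXn2r ?nnegrE// mulr_ge0 ?sqrtr_ge0// (le_trans ler01).
Qed.

Let Sb_ge0 : 0 <= Sbound.
Proof.
by rewrite addr_ge0// mulr_ge0 ?invr_ge0 ?(ltW c0)// mulr_ge0 ?sqr_ge0.
Qed.

Let M_ge0 : 0 <= M. Proof. exact: le_trans M1. Qed.
Let M1_ge0 : 0 <= 1 + M. Proof. exact: addr_ge0. Qed.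

(** The contribution of one draw to the standardized estimation error, once the
    subsample Hessian is replaced by the full one. *)
Definition stdz (i : nat) : 'cV[R]_p :=
  r%:R^-1 *: (S *m invmx H *m xi n Suu W y pi bh i).

Lemma stdz_centred a : \sum_(i < n) pi i * stdz i a 0 = 0.
Proof.
have -> : \sum_(i < n) pi i * stdz i a 0 = (\sum_(i < n) pi i *: stdz i) a 0.
  by rewrite summxE; apply: eq_bigr => i _; rewrite [RHS]mxE.
rewrite /stdz; under eq_bigr do rewrite scalerA mulrC -scalerA scalemxAr.
rewrite -scaler_sumr -mulmx_sumr.
by rewrite (@xi_mean _ _ n Suu W y pi bh n0 pi_gt0 pi1 (good_bh G)) mulmx0 scaler0 mxE.
Qed.

Lemma stdz_cov a b : \sum_(i < n) pi i * (stdz i a 0 * stdz i b 0) = (a == b)%:R * r%:R^-1.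
Proof.
have Ss : S^T = S by case: SP => -[].
set B := S *m invmx H.
have BT : B^T = invmx H *m S by rewrite /B trmx_mul Ss His.
have -> : \sum_(i < n) pi i * (stdz i a 0 * stdz i b 0) =
  (\sum_(i < n) pi i *: (stdz i *m (stdz i)^T)) a b.
  by rewrite summxE; apply: eq_bigr => i _; rewrite [RHS]mxE outerE.
have -> : \sum_(i < n) pi i *: (stdz i *m (stdz i)^T) =
    r%:R^-1 ^+ 2 *: (B *m (r%:R *: VC) *m B^T).
  rewrite -(@xi_cov _ _ n r Suu W y pi bh r0 n0 pi_gt0 pi1 (good_bh G)).
  rewrite mulmx_sumr mulmx_suml scaler_sumr; apply: eq_bigr => i _.
  rewrite /stdz -/B linearZ/= trmx_mul -scalemxAl -!scalemxAr -scalemxAl !scalerA !mulmxA.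
  by congr (_ *: _); ring.
rewrite -scalemxAr -scalemxAl BT /B.
have -> : S *m invmx H *m VC *m (invmx H *m S) = 1%:M.
  by rewrite -[RHS]inv_sqrt_sandwich /Vmx !mulmxA.
rewrite scalerA mxE mxE mulrC; case: eqP => _; last by rewrite !mul0r.
by rewrite !mul1r expr2 -mulrA mulVf ?mulr1// gt_eqF.
Qed.


Definition kbound (dl : R) : R :=
  let C3 := p%:R ^+ 3 * (Sbound / c) in
  C3 ^+ 2 * C3 `^ dl * (2 `^ (2 + dl) *
     (M `^ (1 + dl) * (1 + M) + (1 + M) `^ (2 + dl))).

(** Of order [r] to the power -1/2: the growth of [S] takes back half of the
    factor [r^-1]. *)
Lemma norm1_stdz (i : 'I_n) :
  norm1 (stdz i) <= (Num.sqrt r%:R)^-1 * (p%:R ^+ 3 * (Sbound / c)) * (g i * m i + (1 + M)).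
Proof.
have Sb0 : 0 <= Num.sqrt r%:R * Sbound.
  by rewrite mulr_ge0 ?sqrtr_ge0.
have BB := entries_leM _ _ _ _ _ _ _ Sb0 good_S_le
  (fun a b => coercive_inv _ _ a b c0 (good_H G)).
set w := g i * m i + (1 + M).
have w0 : 0 <= w.
  by apply: addr_ge0 => //; apply: mulr_ge0 => //; exact: ltW.
have xw : entries_le (xi n Suu W y pi bh i) w.
  move=> a b; rewrite ord1 /xi mxE (le_trans (ler_normD _ _))// lerD ?good_bias//.
  rewrite mxE normrM normrM (gtr0_norm (m0 i)) mulrAC ler_wpM2r ?(ltW (m0 i))//.
  by rewrite ler_wpM2l// le_enorm.
have pB0 : 0 <= p%:R * (Num.sqrt r%:R * Sbound * c^-1).
  by apply: mulr_ge0 => //; apply: mulr_ge0 => //; rewrite invr_ge0 ltW.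
have Bx := entries_leM _ _ _ _ _ _ _ pB0 BB xw.
have sr0 : 0 < Num.sqrt r%:R :> R by rewrite sqrtr_gt0.
apply: (@le_trans _ _ (\sum_(a < p) (r%:R^-1 * (p%:R * (p%:R * (Num.sqrt r%:R * Sbound * c^-1) * w))))).
  apply: ler_sum => a _; rewrite /stdz mxE normrM gtr0_norm ?invr_gt0//.
  by rewrite ler_pM2l ?invr_gt0.
have -> : r%:R^-1 = (Num.sqrt r%:R ^+ 2)^-1 :> R by rewrite sqr_sqrtr.
rewrite sumr_const card_ord -mulr_natl le_eqVlt; apply/orP; left.
by apply/eqP; field; rewrite !mulr1 !gt_eqF.
Qed.

Let min1_powR (x dl : R) : 0 <= x -> 0 < dl <= 1 -> Num.min 1 x <= x `^ dl.
Proof.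
move=> x0 /andP[dl0 dl1]; have [x1|x1] := leP 1 x.
  have := @ge0_ler_powR R dl (ltW dl0) 1 x; rewrite !nnegrE powR1.
  by apply => //.
have [->|xN0] := eqVneq x 0; first exact: powR_ge0.
rewrite -[leLHS]powRr1//; apply: ger_powR => //.
by rewrite lt0r xN0 x0 ltW.
Qed.

(** Lyapunov's condition: [kappa z <= norm1 z `^ (2 + dl)], and the moment of
    that order of the contributions of the draws is bounded. The weights are
    harmless since [pi i * m i `^ (2 + dl)] is [n%:R^-1 * m i `^ (1 + dl)]. *)
Lemma kappa_stdz dl : 0 < dl <= 1 -> dl <= delta ->
  r%:R * (\sum_(i < n) pi i * kappa (stdz i)) <= kbound dl * (Num.sqrt r%:R)^-1 `^ dl.
Proof.
move=> dl01 dld; have [dl0 dl1] := andP dl01.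
set rho := (Num.sqrt r%:R)^-1; set C3 := p%:R ^+ 3 * (Sbound / c).
set s := 1 + M; pose q := 2 + dl.
have s0 : 0 <= s by exact: M1_ge0.
have q0 : 0 <= q by rewrite addr_ge0// ltW.
have rho0 : 0 <= rho by rewrite invr_ge0 sqrtr_ge0.
have rho2 : r%:R * rho ^+ 2 = 1 by rewrite exprVn sqr_sqrtr// mulfV// gt_eqF.
have C30 : 0 <= C3.
  by rewrite mulr_ge0 ?exprn_ge0// mulr_ge0 ?invr_ge0 ?(ltW c0).
have xq (t : R) : 0 <= t -> t ^+ 2 * t `^ dl = t `^ q.
  move=> t0; rewrite /q powRD; first by rewrite powR_mulrn.
  by rewrite gt_eqF// ltr_wpDl.
have K0 : 0 <= C3 ^+ 2 * C3 `^ dl * rho `^ dl.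
  apply: mulr_ge0 (powR_ge0 _ _); apply: mulr_ge0 (powR_ge0 _ _); exact: sqr_ge0.
have term (i : 'I_n) : r%:R * kappa (stdz i) <=
   C3 ^+ 2 * C3 `^ dl * rho `^ dl * (2 `^ q * ((g i * m i) `^ q + s `^ q)).
  set u := g i * m i.
  have u0 : 0 <= u by rewrite mulr_ge0// ltW.
  pose x := rho * C3 * (u + s).
  have us0 : 0 <= u + s by rewrite addr_ge0.
  have x0 : 0 <= x by apply: mulr_ge0 => //; apply: mulr_ge0.
  have Nx : norm1 (stdz i) <= x by exact: norm1_stdz.
  have N0 := norm1_ge0 (stdz i).
  apply: (@le_trans _ _ (r%:R * (x ^+ 2 * x `^ dl))).
    rewrite ler_pM2l// /kappa; apply: ler_pM; rewrite ?sqr_ge0 ?le_min ?ler01//.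
      by rewrite lerXn2r ?nnegrE.
    apply: le_trans (min1_powR _ _ N0 dl01) _.
    by apply: ge0_ler_powR; rewrite ?nnegrE// ltW.
  have -> : r%:R * (x ^+ 2 * x `^ dl) = C3 ^+ 2 * C3 `^ dl * rho `^ dl * (u + s) `^ q.
    have xdl : x `^ dl = rho `^ dl * C3 `^ dl * (u + s) `^ dl.
      have h := mulr_ge0 rho0 C30.
      by rewrite /x powRM// powRM.
    rewrite xdl -(xq _ us0) /x.
    apply: (@etrans _ _ ((r%:R * rho ^+ 2) * (C3 ^+ 2 * C3 `^ dl * rho `^ dl *
      ((u + s) ^+ 2 * (u + s) `^ dl)))); first by ring.
    by rewrite rho2 mul1r.
  apply: (ler_wpM2l K0).
  have [us|su] := leP u s.
    apply: (@le_trans _ _ ((2 * s) `^ q)).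
      apply: ge0_ler_powR; rewrite ?nnegrE//; first exact: mulr_ge0.
      by rewrite [2 * s]mulrDl mul1r lerD2r.
    by rewrite powRM// ler_wpM2l ?powR_ge0// lerDr powR_ge0.
  apply: (@le_trans _ _ ((2 * u) `^ q)).
    apply: ge0_ler_powR; rewrite ?nnegrE//; first exact: mulr_ge0.
    by rewrite [2 * u]mulrDl mul1r lerD2l ltW.
  by rewrite powRM// ler_wpM2l ?powR_ge0// lerDl powR_ge0.
rewrite mulr_sumr.
set K := C3 ^+ 2 * C3 `^ dl * rho `^ dl in term K0.
apply: (@le_trans _ _ (\sum_(i < n) K * (2 `^ q * (pi i * (g i * m i) `^ q + pi i * s `^ q)))).
  apply: ler_sum => i _; rewrite mulrCA -mulrDr [2 `^ q * _]mulrCA [leRHS]mulrCA.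
  by rewrite ler_wpM2l.
rewrite -!mulr_sumr big_split/= -mulr_suml pi1 mul1r.
have -> : kbound dl * rho `^ dl = K * (2 `^ q * (M `^ (1 + dl) * (1 + M) + s `^ q)).
  by rewrite /kbound -/C3 -/s -/q /K; ring.
apply: ler_wpM2l => //; apply: ler_wpM2l; first exact: powR_ge0.
rewrite lerD2r.
apply: (@le_trans _ _ (M `^ (1 + dl) * (n%:R^-1 * (\sum_(i < n) g i `^ q)))).
  rewrite mulrCA mulr_sumr mulr_sumr; apply: ler_sum => i _.
  rewrite powRM ?(ltW (m0 i))//.
  have -> : m i `^ q = m i * m i `^ (1 + dl).
    have -> : q = 1 + (1 + dl) by rewrite /q; ring.
    rewrite powRD ?powRr1 ?(ltW (m0 i))//.
    by rewrite (gt_eqF (m0 i)) implybT.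
  rewrite (_ : _ * (_ * _) = (pi i * m i) * (m i `^ (1 + dl) * g i `^ q)); last by ring.
  rewrite pim; apply: ler_wpM2l => //; apply: ler_wpM2r; first exact: powR_ge0.
  apply: ge0_ler_powR; rewrite ?nnegrE ?(ltW (m0 i))//; last exact: piM.
  by rewrite addr_ge0// ltW.
apply: ler_wpM2l; first exact: powR_ge0.
apply: (avg_dom (fun t => t `^ q)) => t t0.
case: (powR_dom t (2 + delta) t0); first by rewrite lerDl ltW.
by move=> _ _; apply; rewrite q0 /q lerD2l.
Qed.

Local Notation draws := (draws_avg (fun i : 'I_n => pi i) r).

(** Chebyshev's inequality: the entries of the subsample Hessian are unbiased,
    with a variance controlled by the fourth moments of the covariates. *)
Lemma sub_hess_deviation a b (rho : R) : 0 < rho ->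
  draws (fun j => (rho < `|sub_hess n r Suu W pi j a b - H a b|)%R%:R) <=
  M ^+ 2 / (r%:R * rho ^+ 2).
Proof.
move=> rho0.
pose mab := n%:R^-1 * \sum_(i < n) W i a 0 * W i b 0.
pose f (i : 'I_n) := r%:R^-1 * (m i * (W i a 0 * W i b 0) - mab).
have fE (j : {ffun 'I_r -> 'I_n}) : sub_hess n r Suu W pi j a b - H a b = \sum_k f (j k).
  have -> : H a b = mab - Suu a b.
    rewrite /HW !mxE summxE /mab; congr (_ * _ - _).
    by apply: eq_bigr => i _; rewrite outerE.
  have -> : sub_hess n r Suu W pi j a b =
      \sum_k r%:R^-1 * (m (j k) * (W (j k) a 0 * W (j k) b 0)) - Suu a b.
    rewrite /sub_hess /whess !mxE summxE mulr_sumr; congr (_ - _).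
    apply: eq_bigr => k _; rewrite mxE outerE /m; field.
    by rewrite !gt_eqF.
  rewrite /f; under [RHS]eq_bigr do rewrite mulrBr.
  rewrite sumrB sumr_const card_ord -[(_ * mab) *+ r]mulr_natl mulrA mulfV ?gt_eqF//.
  by rewrite mul1r; ring.
rewrite [X in draws X](_ : _ = fun j : {ffun 'I_r -> 'I_n} => (rho < `|\sum_k f (j k)|)%R%:R); last first.
  by apply/funext => j; rewrite fE.
apply: le_trans (markov_sqr _ _ _ _ pi0 rho0) _.
have fm : \sum_(i < n) pi i * (m i * (W i a 0 * W i b 0)) = mab.
  by rewrite /mab mulr_sumr; apply: eq_bigr => i _; rewrite mulrA pim.
have f0 : \sum_(i < n) pi i * f i = 0.
  rewrite /f; under eq_bigr do rewrite mulrCA mulrBr.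
  by rewrite -mulr_sumr sumrB fm -mulr_suml pi1 mul1r subrr mulr0.
rewrite (draws_avg_sqr _ f r pi1 f0).
have f2 : \sum_(i < n) pi i * f i ^+ 2 <= r%:R^-1 ^+ 2 * M ^+ 2.
  have -> : \sum_(i < n) pi i * f i ^+ 2 = r%:R^-1 ^+ 2 *
      (n%:R^-1 * \sum_(i < n) m i * (W i a 0 * W i b 0) ^+ 2 - mab ^+ 2).
    rewrite (eq_bigr (fun i : 'I_n => r%:R^-1 ^+ 2 * (n%:R^-1 * (m i * (W i a 0 * W i b 0) ^+ 2)
       - 2 * mab * (pi i * (m i * (W i a 0 * W i b 0))) + mab ^+ 2 * pi i))); last first.
      by move=> i _; rewrite /f -(pim i); ring.
    rewrite -mulr_sumr big_split/= sumrB -!mulr_sumr fm pi1; ring.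
  rewrite ler_wpM2l ?sqr_ge0// lerBlDr.
  apply: (@le_trans _ _ (M ^+ 2)); last by rewrite lerDl sqr_ge0.
  apply: (@le_trans _ _ (M * (n%:R^-1 * \sum_(i < n) enorm (W i) ^+ 4))); last first.
    by rewrite expr2 ler_wpM2l ?(le_trans ler01)//; exact: good_W4 G.
  rewrite mulrCA ler_wpM2l// mulr_sumr; apply: ler_sum => i _.
  apply: ler_pM; [exact: ltW|exact: sqr_ge0|exact: piM|].
  rewrite -[(_ * _) ^+ 2]real_normK ?num_real// (_ : enorm (W i) ^+ 4 = (enorm (W i) * enorm (W i)) ^+ 2); last by ring.
  rewrite lerXn2r ?nnegrE ?mulr_ge0 ?sqrtr_ge0// normrM.
  by apply: ler_pM => //; exact: le_enorm.
have r2 : 0 < rho ^+ 2 by rewrite exprn_gt0.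
apply: (@le_trans _ _ (r%:R * (r%:R^-1 ^+ 2 * M ^+ 2) / rho ^+ 2)).
  by rewrite ler_wpM2r ?invr_ge0 ?(ltW r2)// ler_wpM2l// ltW.
by rewrite le_eqVlt; apply/orP; left; apply/eqP; field; rewrite !gt_eqF.
Qed.

Lemma mean_xi_deviation a (K : R) : 0 < K ->
  draws (fun j => (K / Num.sqrt r%:R < `|mean_xi n r Suu W y pi bh j a 0|)%R%:R) <=
  M * (1 + M) / K ^+ 2.
Proof.
move=> K0.
have sr0 : 0 < Num.sqrt r%:R :> R by rewrite sqrtr_gt0.
pose f (i : 'I_n) := r%:R^-1 * xi n Suu W y pi bh i a 0.
have fE (j : {ffun 'I_r -> 'I_n}) : mean_xi n r Suu W y pi bh j a 0 = \sum_k f (j k).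
  by rewrite /mean_xi mxE summxE mulr_sumr.
rewrite [X in draws X](_ : _ = fun j : {ffun 'I_r -> 'I_n} => (K / Num.sqrt r%:R < `|\sum_k f (j k)|)%R%:R); last first.
  by apply/funext => j; rewrite fE.
apply: le_trans (markov_sqr _ _ _ _ pi0 (divr_gt0 K0 sr0)) _.
have f0 : \sum_(i < n) pi i * f i = 0.
  by rewrite /f; under eq_bigr do rewrite mulrCA; rewrite -mulr_sumr xi_centred mulr0.
rewrite (draws_avg_sqr _ f r pi1 f0).
have -> : \sum_(i < n) pi i * f i ^+ 2 = r%:R^-1 ^+ 2 * (r%:R *: VC) a a.
  rewrite -xi_moment mulr_sumr; apply: eq_bigr => i _; rewrite /f; ring.
rewrite expr_div_n sqr_sqrtr ?(ltW rp)//.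
rewrite (_ : _ / _ = (r%:R *: VC) a a / K ^+ 2); last by field; rewrite !gt_eqF.
by rewrite ler_wpM2r ?invr_ge0 ?sqr_ge0//; exact: good_Vc_diag.
Qed.

(** The subsamples for which the linearization of the estimator is accurate. *)
Definition sample_close (rho t : R) (j : {ffun 'I_r -> 'I_n}) : bool :=
  [forall a, forall b, `|sub_hess n r Suu W pi j a b - H a b| <= rho] &&
  [forall a, `|mean_xi n r Suu W y pi bh j a 0| <= t].

Lemma sum_stdz (j : {ffun 'I_r -> 'I_n}) :
  \sum_k stdz (j k) = S *m invmx H *m mean_xi n r Suu W y pi bh j.
Proof.
rewrite /mean_xi -scalemxAr mulmx_sumr scaler_sumr.
by apply: eq_bigr => k _.
Qed.

Lemma not_close_le (rho K : R) : 0 < rho -> 0 < K ->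
  draws (fun j => (~~ sample_close rho (K / Num.sqrt r%:R) j)%:R) <=
  p%:R ^+ 2 * (M ^+ 2 / (r%:R * rho ^+ 2)) + p%:R * (M * (1 + M) / K ^+ 2).
Proof.
move=> rho0 K0; set t := K / _.
pose A a b (j : {ffun 'I_r -> 'I_n}) : R := (rho < `|sub_hess n r Suu W pi j a b - H a b|)%R%:R.
pose B a (j : {ffun 'I_r -> 'I_n}) : R := (t < `|mean_xi n r Suu W y pi bh j a 0|)%R%:R.
have draws_sum (I : finType) (F : I -> {ffun 'I_r -> 'I_n} -> R) :
    draws (fun j => \sum_i F i j) = \sum_i draws (F i).
  by rewrite /draws_avg exchange_big; apply: eq_bigr => j _; rewrite mulr_sumr.
apply: (@le_trans _ _ (draws (fun j => \sum_a \sum_b A a b j + \sum_a B a j))).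
  apply: draws_avg_le => // j; rewrite /sample_close negb_and.
  have A0 : 0 <= \sum_a \sum_b A a b j by do 2!apply: sumr_ge0 => ? _; exact: ler0n.
  have B0 : 0 <= \sum_a B a j by apply: sumr_ge0 => ? _; exact: ler0n.
  case: (boolP (~~ [forall a, _])) => /= [|_].
    rewrite negb_forall => /existsP[a]; rewrite negb_forall => /existsP[b].
    rewrite -ltNge => h; rewrite -[leLHS]addr0 lerD//.
    rewrite (bigD1 a)//= (bigD1 b)//= /A h -addrA lerDl addr_ge0//.
      by apply: sumr_ge0 => ? _; exact: ler0n.
    by apply: sumr_ge0 => ? _; apply: sumr_ge0 => ? _; exact: ler0n.
  case: (boolP (~~ _)) => /= [|_]; last by rewrite addr_ge0.
  rewrite negb_forall => /existsP[a]; rewrite -ltNge => h.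
  rewrite -[leLHS]add0r lerD// (bigD1 a)//= /B h lerDl.
  by apply: sumr_ge0 => ? _; exact: ler0n.
rewrite draws_avgD !draws_sum lerD//.
  apply: (@le_trans _ _ (\sum_(a < p) \sum_(b < p) M ^+ 2 / (r%:R * rho ^+ 2))).
    apply: ler_sum => a _; rewrite draws_sum; apply: ler_sum => b _.
    exact: sub_hess_deviation.
  by rewrite !sumr_const card_ord -mulrnA -[X in X <= _]mulr_natl natrM.
apply: (@le_trans _ _ (\sum_(a < p) M * (1 + M) / K ^+ 2)).
  by apply: ler_sum => a _; exact: mean_xi_deviation.
by rewrite sumr_const card_ord -[X in X <= _]mulr_natl.
Qed.

(** The error made by putting the full Hessian in place of that of the
    subsample is [S *m Hj^-1 *m (H - Hj) *m H^-1 *m Z]. Here [S] is of order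
    [Num.sqrt r%:R] and [Z] of the inverse order, so that the closeness of the
    two Hessians remains as a factor. *)
Lemma linearization (rho K : R) (j : {ffun 'I_r -> 'I_n}) (J : nat -> nat) bt :
  0 < rho -> 0 < K -> p%:R * rho <= c / 2 ->
  sample_close rho (K / Num.sqrt r%:R) j ->
  (forall k : 'I_r, J k = j k :> nat) ->
  ((exists b, is_argmin (subloss Suu W y n r pi J) b) ->
     is_argmin (subloss Suu W y n r pi J) bt) ->
  forall a, `|(S *m (bt - bh)) a 0 - (\sum_k stdz (j k)) a 0| <=
    p%:R ^+ 4 * Sbound * (2 / c) * c^-1 * K * rho.
Proof.
move=> rho0 K0 prho /andP[/forallP cl1 /forallP cl2] Jj btP a.
set t := K / _ in cl2.
have sr0 : 0 < Num.sqrt r%:R :> R by rewrite sqrtr_gt0.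
have t0 : 0 < t by rewrite divr_gt0.
set Hj := sub_hess n r Suu W pi j.
have HjH : entries_le (H - Hj) rho.
  move=> a' b; have /forallP/(_ b) := cl1 a'.
  by rewrite -normrN opprB /Hj !mxE.
have c20 : 0 < c / 2 by rewrite divr_gt0.
have Hjc : coercive (c / 2) Hj.
  have h := coercive_perturb c rho H Hj (good_H G) _.
  move=> u; apply: le_trans (h _ u); last by move=> a' b; have /forallP/(_ b) := cl1 a'.
  rewrite ler_wpM2r ?sqr_ge0//; move: prho; lra.
have Hjpos u : u != 0 -> 0 < qform Hj u by exact: coercive_qform_gt0 Hjc.
rewrite (subloss_wloss n r Suu W y pi J j Jj) in btP.
have bt1 : Hj *m bt = sub_score n r W y pi j.
  apply: wloss_argmin_eq => //; apply: btP.
  by exists (invmx Hj *m sub_score n r W y pi j); exact: wloss_argmin.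
have Hju : Hj \in unitmx by exact: qform_gt0_unitmx.
set Z := mean_xi n r Suu W y pi bh j.
have btE : bt - bh = invmx Hj *m Z.
  rewrite /Z -(sub_score_residual n r Suu W y pi bh r0 n0 pi_gt0) -/Hj -bt1 -mulmxBr.
  by rewrite mulKmx.
have -> : (S *m (bt - bh)) a 0 - (\sum_k stdz (j k)) a 0 =
    (S *m (invmx Hj *m ((H - Hj) *m (invmx H *m Z)))) a 0.
  have subE (u v : 'cV[R]_p) : u a 0 - v a 0 = (u - v) a 0 by rewrite !mxE.
  rewrite subE sum_stdz -/Z btE; congr (fun_of_matrix _ a 0).
  by rewrite mulmxBl mulmxBr mulKVmx// mulKmx// mulmxBr !mulmxA.
have Zt : entries_le Z t by move=> a' b; rewrite ord1.
have Sb0 : 0 <= Num.sqrt r%:R * Sbound.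
  by rewrite mulr_ge0 ?sqrtr_ge0.
have ci0 : 0 <= c^-1 by rewrite invr_ge0 ltW.
have ci20 : 0 <= (c / 2)^-1 by rewrite invr_ge0 ltW.
have h1 := entries_leM _ _ _ _ _ _ _ ci0 (fun a b => coercive_inv _ _ a b c0 (good_H G)) Zt.
have h2 := entries_leM _ _ _ _ _ _ _ (ltW rho0) HjH h1.
have h3 := entries_leM _ _ _ _ _ _ _ ci20 (fun a b => coercive_inv _ _ a b c20 Hjc) h2.
have h4 := entries_leM _ _ _ _ _ _ _ Sb0 good_S_le h3.
apply: le_trans (h4 a 0) _; rewrite /t le_eqVlt; apply/orP; left; apply/eqP.
by field; rewrite !gt_eqF.
Qed.

End good_outcome.

Lemma cdf_shift {R : realType} {p : nat} (x : 'cV[R]_p) (eta : R) :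
  `|std_normal_cdf (x + const_mx eta) - std_normal_cdf x| <= p%:R * `|eta|.
Proof.
have g01 (t : R) : 0 <= gcdf t <= 1 by rewrite gcdf_ge0 gcdf_le1.
apply: le_trans (prod_diff _ _ _ _) _ => [a|a|]; [exact: g01|exact: g01|].
apply: (@le_trans _ _ (\sum_(a < p) `|eta|)); last by rewrite sumr_const card_ord mulr_natl.
apply: ler_sum => a _; apply: le_trans (gcdf_lip _ _) _.
by rewrite !mxE addrAC subrr add0r.
Qed.

Lemma powR_small {R : realType} (C dl eta : R) : 0 <= C -> 0 < dl -> 0 < eta ->
  exists2 t, 0 < t & forall s, 0 <= s <= t -> C * s `^ dl <= eta.
Proof.
move=> C0 dl0 eta0; pose t := (eta / (C + 1)) `^ dl^-1.
have C10 : 0 < C + 1 by rewrite ltr_wpDl.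
have q0 : 0 < eta / (C + 1) by rewrite divr_gt0.
exists t; first by rewrite powR_gt0.
move=> s /andP[s0 st].
have : s `^ dl <= eta / (C + 1).
  have := @ge0_ler_powR R dl (ltW dl0) s t; rewrite !nnegrE powR_ge0 => /(_ s0 isT st).
  by rewrite /t -powRrM mulVf ?gt_eqF// powRr1 ?(ltW q0).
move=> h; apply: (@le_trans _ _ (C * (eta / (C + 1)))); first by rewrite ler_wpM2l.
by rewrite mulrCA ler_piMr ?(ltW eta0)// ler_pdivrMr// mul1r lerDl.
Qed.

(** All that the measure-theoretic part needs about a good outcome, uniformly
    over these outcomes once [r] is large. Up to [e], the lower orthant at [x]
    has at least its Gaussian probability for subsamples whose standardized
    linearized error [T] is below [x] with a margin [eta], and so has its
    complement. The margin exceeds the linearization error, hence the event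
    about the estimator itself is decided on both families. *)
Lemma draws_of_good {R : realType} {p : nat} (c M delta : R) (x : 'cV[R]_p) (e : R) :
  0 < c -> 1 <= M -> 0 < delta -> 0 < e ->
  exists eta rho K R0 : R, [/\ 0 < eta, 0 < rho, 0 < K &
  forall n r Suu (W : nat -> 'cV[R]_p) (y pi : nat -> R) bh S, Suu^T = Suu ->
    (0 < r)%N -> (0 < n)%N -> (forall i, (i < n)%N -> 0 <= pi i) ->
    \sum_(i < n) pi i = 1 -> good c M delta n r Suu W y pi bh ->
    is_inv_sqrt (Vmx Suu W y n r pi bh) S -> R0 <= r%:R ->
    let near := sample_close n r Suu W y pi bh rho (K / Num.sqrt r%:R) in
    let T (j : {ffun 'I_r -> 'I_n}) : 'cV[R]_p :=
      \sum_k stdz n r Suu W y pi bh S (j k) in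
    [/\ forall j (J : nat -> nat) bt, near j -> (forall k : 'I_r, J k = j k :> nat) ->
         ((exists b, is_argmin (subloss Suu W y n r pi J) b) ->
           is_argmin (subloss Suu W y n r pi J) bt) ->
         forall a, `|(S *m (bt - bh)) a 0 - T j a 0| <= eta,
       std_normal_cdf x - e <= draws_avg (fun i : 'I_n => pi i) r
         (fun j => (near j && [forall a, T j a 0 <= x a 0 - eta])%:R) &
       1 - std_normal_cdf x - e <= draws_avg (fun i : 'I_n => pi i) r
         (fun j => (near j && [exists a, x a 0 + eta < T j a 0])%:R)]].
Proof.
move=> c0 M1 d0 e0.
have p0 : 0 <= p%:R :> R by [].
have M0 : 0 <= M by rewrite (le_trans ler01).
have p10 : 0 < p%:R + 1 :> R by rewrite ltr_wpDl.
have chain (A B C D Q : R) : `|B - C| <= e / 4 -> `|A - B| <= e / 4 -> Q <= e / 2 ->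
    A - Q <= D -> C - e <= D.
  by rewrite !ler_norml => /andP[? ?] /andP[? ?] ? ?; lra.
have chain' (A B C D Q : R) : `|B - C| <= e / 4 -> `|A - B| <= e / 4 -> Q <= e / 2 ->
    1 - A - Q <= D -> 1 - C - e <= D.
  by rewrite !ler_norml => /andP[? ?] /andP[? ?] ? ?; lra.
pose eta := e / (4 * (p%:R + 1)).
have eta0 : 0 < eta by rewrite divr_gt0// mulr_gt0.
have peta : p%:R * eta <= e / 4.
  have <- : (p%:R + 1) * eta = e / 4 by rewrite /eta; field; rewrite gt_eqF.
  by rewrite ler_pM2r// lerDl.
pose K := 4 * (p%:R * (M * (1 + M))) / e + 1.
have B0 : 0 <= p%:R * (M * (1 + M)) by rewrite !mulr_ge0// addr_ge0.
have K1 : 1 <= K by rewrite lerDr divr_ge0 ?(ltW e0)// mulr_ge0.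
have K0 : 0 < K by rewrite (lt_le_trans ltr01).
have KB : p%:R * (M * (1 + M) / K ^+ 2) <= e / 4.
  rewrite mulrA ler_pdivrMr ?exprn_gt0//.
  apply: (@le_trans _ _ (e / 4 * K)); last first.
    by rewrite ler_pM2l ?divr_gt0// expr2 ler_peMr// ltW.
  have -> : e / 4 * K = p%:R * (M * (1 + M)) + e / 4 by rewrite /K; field; rewrite gt_eqF.
  by rewrite lerDl divr_ge0// ltW.
have Sb0 : 0 <= @Sbound R p c M.
  by rewrite addr_ge0// mulr_ge0 ?invr_ge0 ?(ltW c0)// mulr_ge0 ?sqr_ge0.
pose Q := p%:R ^+ 4 * @Sbound R p c M * (2 / c) * c^-1 * K.
have Q0 : 0 <= Q.
  have ci : 0 < c^-1 by rewrite invr_gt0.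
  rewrite mulr_ge0 ?(ltW K0)// mulr_ge0 ?(ltW ci)// mulr_ge0 ?divr_ge0 ?(ltW c0)//.
  by rewrite mulr_ge0// exprn_ge0.
pose rho := Num.min (c / (2 * (p%:R + 1))) (eta / (Q + 1)).
have rho0 : 0 < rho.
  by rewrite lt_min !divr_gt0 ?mulr_gt0 ?ltr_wpDl.
have prho : p%:R * rho <= c / 2.
  apply: (@le_trans _ _ ((p%:R + 1) * (c / (2 * (p%:R + 1))))).
    by apply: ler_pM; rewrite ?(ltW rho0)// ?lerDl// ge_min lexx.
  by rewrite le_eqVlt; apply/orP; left; apply/eqP; field; rewrite gt_eqF.
have Qrho : Q * rho <= eta.
  apply: (@le_trans _ _ (Q * (eta / (Q + 1)))).
    by rewrite ler_wpM2l// ge_min lexx orbT.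
  by rewrite mulrCA ler_piMr ?(ltW eta0)// ler_pdivrMr ?ltr_wpDl// mul1r lerDl.
pose xm : 'cV[R]_p := x + const_mx (- eta); pose xp : 'cV[R]_p := x + const_mx eta.
have e40 : 0 < e / 4 by rewrite divr_gt0.
have [k1 k10 clt1] := uniform_clt xm (e / 4) e40.
have [k2 k20 clt2] := uniform_clt xp (e / 4) e40.
pose k := Num.min k1 k2.
have k0 : 0 < k by rewrite lt_min k10.
pose dl := Num.min 1 delta.
have dl0 : 0 < dl by rewrite lt_min ltr01.
have dl01 : 0 < dl <= 1 by rewrite dl0 ge_min lexx.
have dld : dl <= delta by rewrite ge_min lexx orbT.
have kb0 : 0 <= @kbound R p c M dl.
  have C30 : 0 <= p%:R ^+ 3 * (@Sbound R p c M / c).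
    by rewrite mulr_ge0 ?exprn_ge0// divr_ge0// ltW.
  rewrite /kbound; apply: mulr_ge0.
    by apply: mulr_ge0 (powR_ge0 _ _); exact: sqr_ge0.
  apply: mulr_ge0; first exact: powR_ge0.
  apply: addr_ge0; last exact: powR_ge0.
  by apply: mulr_ge0; [exact: powR_ge0|exact: addr_ge0].
have [t t0 tP] := powR_small _ _ _ kb0 dl0 k0.
pose R0 := t^-1 ^+ 2 + k^-1 + 4 * (p%:R ^+ 2 * (M ^+ 2 / rho ^+ 2)) / e + 1.
exists eta, rho, K, R0; split=> //.
move=> n r Suu W y pi bh S Suus r0 n0 pi0 pi1 G SP rR near T.
have rp : 0 < r%:R :> R by rewrite ltr0n.
have sr0 : 0 < Num.sqrt r%:R :> R by rewrite sqrtr_gt0.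
have ti0 : 0 <= t^-1 ^+ 2 by rewrite sqr_ge0.
have ki0 : 0 <= k^-1 by rewrite invr_ge0 ltW.
have D0 : 0 <= 4 * (p%:R ^+ 2 * (M ^+ 2 / rho ^+ 2)) / e.
  rewrite divr_ge0 ?(ltW e0)// mulr_ge0// mulr_ge0 ?sqr_ge0//.
  by rewrite divr_ge0 ?sqr_ge0.
have [r1 r2 r3] : [/\ t^-1 ^+ 2 <= r%:R, k^-1 <= r%:R &
    4 * (p%:R ^+ 2 * (M ^+ 2 / rho ^+ 2)) / e <= r%:R].
  by split; apply: le_trans rR; rewrite /R0 -?addrA ?lerDl ?addr_ge0//;
    [rewrite addrCA lerDl|rewrite addrA addrCA lerDl]; rewrite ?addr_ge0// addr_ge0.
have piI (i : 'I_n) : 0 <= pi i by exact: pi0.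
have rk : r%:R^-1 <= k by rewrite -[k]invrK lef_pV2 ?posrE ?invr_gt0.
have st : (Num.sqrt r%:R)^-1 <= t.
  rewrite -[t]invrK lef_pV2 ?posrE ?invr_gt0//.
  rewrite -(@ler_pXn2r _ 2)// ?nnegrE ?invr_ge0 ?(ltW t0) ?(ltW sr0)//.
  by rewrite sqr_sqrtr// ltW.
have kap : r%:R * (\sum_(i < n) pi i * kappa (stdz n r Suu W y pi bh S i)) <= k.
  apply: (@le_trans _ _ (kbound c M dl * (Num.sqrt r%:R)^-1 `^ dl)).
    exact: (kappa_stdz c M delta).
  by apply: tP; rewrite invr_ge0 (ltW sr0).
have zm := stdz_centred c M delta n r Suu W y pi bh n0 pi1 G S.
have zc := stdz_cov c M delta n r Suu W y pi bh c0 Suus r0 n0 pi1 G S SP.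
have kk1 : k <= k1 by rewrite ge_min lexx.
have kk2 : k <= k2 by rewrite ge_min lexx orbT.
have C1 := clt1 _ _ _ r r0 piI pi1 zm zc (le_trans kap kk1) (le_trans rk kk1).
have C2 := clt2 _ _ _ r r0 piI pi1 zm zc (le_trans kap kk2) (le_trans rk kk2).
have bad : draws_avg (fun i : 'I_n => pi i) r (fun j => (~~ near j)%:R) <= e / 2.
  apply: le_trans (not_close_le c M delta n r Suu W y pi bh M1 d0 r0 n0 pi1 G rho K rho0 K0) _.
  have : p%:R ^+ 2 * (M ^+ 2 / (r%:R * rho ^+ 2)) <= e / 4.
    rewrite invfM (_ : _ * (_ * _) = p%:R ^+ 2 * (M ^+ 2 / rho ^+ 2) / r%:R); last by ring.
    rewrite ler_pdivrMr//; move: r3; rewrite ler_pdivrMr//.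
    by move: (p%:R ^+ 2 * _) => B; lra.
  by move: KB; lra.
split.
- move=> j J bt nj Jj btP a.
  apply: le_trans Qrho; rewrite /Q.
  exact: (linearization c M delta n r Suu W y pi bh c0 M1 Suus r0 n0 G S SP).
- have s1 : `|std_normal_cdf xm - std_normal_cdf x| <= e / 4.
    by apply: le_trans (cdf_shift _ _) _; rewrite normrN gtr0_norm.
  apply: chain s1 C1 bad _.
  rewrite lerBlDr -draws_avgD; apply: draws_avg_le => // j.
  have -> : [forall a, (\sum_k stdz n r Suu W y pi bh S (j k)) a 0 <= xm a 0] =
      [forall a, T j a 0 <= x a 0 - eta].
    by apply: eq_forallb => a; rewrite !mxE.
  by case: (near j); case: [forall a, _]; rewrite /= ?addr0 ?add0r.
- have s2 : `|std_normal_cdf xp - std_normal_cdf x| <= e / 4.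
    by apply: le_trans (cdf_shift _ _) _; rewrite gtr0_norm.
  apply: chain' s2 C2 bad _.
  rewrite -[X in X - _ - _](draws_avg_cst (fun i : 'I_n => pi i) pi1 r 1).
  rewrite -addrA -opprD lerBlDr -!draws_avgD; apply: draws_avg_le => // j.
  have -> : [exists a, x a 0 + eta < T j a 0] =
     ~~ [forall a, (\sum_k stdz n r Suu W y pi bh S (j k)) a 0 <= xp a 0].
    rewrite negb_forall; apply: eq_existsb => a.
    by rewrite -ltNge !mxE.
  by case: (near j); case: [forall a, _]; rewrite /= ?addr0 ?add0r ?lerDl ?lerDr.
Qed.

(** * Conditional probabilities given the data *)

Section conditional_probability.
Context d (T : measurableType d) (R : realType) (P : probability T R).
Variable C : set (set T).
Hypothesis Cm : C `<=` measurable.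
Local Notation G := (<<s C >>).

Lemma gen_measurable A : G A -> measurable A.
Proof. by apply: smallest_sub => //; exact: sigma_algebra_measurable. Qed.

Lemma measurable_wrtP (g : T -> R) :
  measurable_wrt G g <-> measurable_fun [set: g_sigma_algebraType C] g.
Proof.
split=> [mg _ B mB|mg B mB]; first by rewrite setTI; exact: mg.
by have := mg measurableT B mB; rewrite setTI.
Qed.

Lemma measurable_wrt_fun (g : T -> R) : measurable_wrt G g -> measurable_fun [set: T] g.
Proof. by move=> mg _ B mB; rewrite setTI; apply: gen_measurable; exact: mg. Qed.

Lemma cond_prob_compl (E : set T) (F : T -> R) : measurable E ->
  is_cond_prob P G E F -> is_cond_prob P G (~` E) (fun w => 1 - F w).
Proof.
move=> mE [mF iF PF]; split.
- apply/measurable_wrtP; apply: measurable_funB; first exact: measurable_cst.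
  exact/measurable_wrtP.
- rewrite (_ : EFin \o _ = (fun w => 1%:E - (F w)%:E)%E)//.
  apply: integrableB => //; exact: finite_measure_integrable_cst.
- move=> A GA; have mA := gen_measurable _ GA.
  under eq_integral do rewrite EFinB.
  rewrite integralB//; last 2 first.
  + exact: finite_measure_integrable_cst.
  + exact: integrableS iF.
  rewrite integral_cst// mul1e PF// -setDE measureD//.
  by rewrite (le_lt_trans (probability_le1 P mA))// ltry.
Qed.

(** When the draw is [j], i.e. on [Ej j], and the data lie in [A0] and [L j],
    the event [E] occurs. Hence the conditional probability of [E] is at least
    the sum of the conditional probabilities of the draws [j] with data in
    [L j]. The event [E] itself may depend on more than the data and the draw:
    only sufficient conditions for it are used. Integrating [F] over the part
    of [A0] where the bound fails shows that this part is negligible. *)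
Lemma cond_prob_lower (I : finType) (E : set T) (F : T -> R) (Ej : I -> set T)
    (q : I -> T -> R) (L : I -> set T) (A0 : set T) (v e : R) :
  measurable E -> is_cond_prob P G E F ->
  (forall j, measurable (Ej j)) -> (forall j, is_cond_prob P G (Ej j) (q j)) ->
  (forall i j w, Ej i w -> Ej j w -> i = j) ->
  G A0 -> (forall j, G (L j)) ->
  (forall j, A0 `&` L j `&` Ej j `<=` E) ->
  (forall w, A0 w -> v <= \sum_j q j w * \1_(L j) w) -> 0 < e ->
  P (A0 `&` [set w | F w < v - e]) = 0%E.
Proof.
move=> mE [mF iF PF] mEj qP Ej_inj GA0 GL LE vq e0.
set A := A0 `&` _.
have GA : G A.
  have -> : A = A0 `&` F @^-1` `]-oo, v - e[.
    by congr (_ `&` _); apply/seteqP; split=> w; rewrite /= in_itv.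
  apply: (@measurableI _ (g_sigma_algebraType C) _ _ GA0); exact: mF.
have mA := gen_measurable _ GA.
have GAL j : G (A `&` L j).
  exact: (@measurableI _ (g_sigma_algebraType C) _ _ GA (GL j)).
have mAL j := gen_measurable _ (GAL j).
have mL j := gen_measurable _ (GL j).
have iq j : P.-integrable A (fun w => (q j w * \1_(L j) w)%:E).
  have [_ iqj _] := qP j.
  rewrite (_ : (fun w => _) = ((EFin \o q j) \_ (L j))); last first.
    apply/funext => w; rewrite patchE indicE; case: ifPn => wL.
      by rewrite mulr1.
    by rewrite mulr0.
  apply: (@integrableS _ _ _ _ setT) => //.
  by apply/(integrable_mkcond _ _).1 => //; apply: integrableS iqj.
have up : (\int[P]_(w in A) (F w)%:E <= (v - e)%:E * P A)%E.
  rewrite -integral_cst//; apply: le_integral => //.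
  - exact: integrableS iF.
  - exact: finite_measure_integrable_cst.
  - by move=> w; rewrite inE => -[_ /= h]; rewrite lee_fin; exact: ltW.
have lo : (v%:E * P A <= \int[P]_(w in A) (F w)%:E)%E.
  rewrite PF//.
  apply: (@le_trans _ _ (\sum_j P (A `&` L j `&` Ej j))%E).
    apply: (@le_trans _ _ (\int[P]_(w in A) (\sum_j (q j w * \1_(L j) w)%:E))%E).
      rewrite -integral_cst//; apply: le_integral => //.
      - exact: finite_measure_integrable_cst.
      - exact: integrable_sum.
      - by move=> w; rewrite inE => -[A0w _]; rewrite sumEFin lee_fin; exact: vq.
    rewrite integral_sum//; apply: lee_sum => j _.
    have [_ _ Pq] := qP j.
    rewrite -Pq// le_eqVlt; apply/orP; left; apply/eqP.
    rewrite [RHS]integral_mkcondr; apply: eq_integral => w _.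
    by rewrite patchE indicE; case: ifPn; rewrite ?mulr1 ?mulr0.
  have mALE j : measurable (A `&` L j `&` Ej j) by exact: measurableI.
  rewrite fsbig_seq ?index_enum_uniq// -measure_fin_bigcup//; last first.
    by move=> i j _ _ [w [[_ Ei] [_ Ej']]]; exact: Ej_inj Ei Ej'.
  apply: le_measure; rewrite ?inE.
  - exact: fin_bigcup_measurable.
  - exact: measurableI.
  - move=> w [j _ [[Aw Lw] Ew]]; split=> //.
    by apply: (LE j); split=> //; split=> //; case: Aw.
have PA : P A \is a fin_num by rewrite fin_num_measure.
have := le_trans lo up; rewrite -(fineK PA) -!EFinM lee_fin => h.
have : 0 <= fine (P A) by rewrite fine_ge0.
move=> h0; congr (_%:E); apply/eqP; rewrite eq_le h0 andbT; nra.
Qed.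

End conditional_probability.

(** * Measurability of matrix statistics *)

Section measurable_matrices.
Context d (T : measurableType d) (R : realType).

(** [x^-1] is [x] times a power of [x ^+ 2], also at 0. *)
Lemma measurable_fun_inv (f : T -> R) :
  measurable_fun [set: T] f -> measurable_fun [set: T] (fun w => (f w)^-1).
Proof.
move=> mf; rewrite (_ : (fun w => _) = (fun w => f w * (f w ^+ 2) `^ (-1))); last first.
  apply/funext => w; rewrite powR_inv1 ?sqr_ge0// expr2 invfM mulrA.
  have [->|fw0] := eqVneq (f w) 0; first by rewrite mul0r invr0 mulr0.
  by rewrite mulfV// mul1r.
apply: measurable_funM => //.
by apply: (measurableT_comp (measurable_powR (-1))); exact: measurable_funX.
Qed.

Lemma measurable_fun_powR (f : T -> R) q :
  measurable_fun [set: T] f -> measurable_fun [set: T] (fun w => f w `^ q).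
Proof. by move=> mf; exact: (measurableT_comp (measurable_powR q)). Qed.

Lemma measurable_fun_norm (f : T -> R) :
  measurable_fun [set: T] f -> measurable_fun [set: T] (fun w => `|f w|).
Proof. by move=> mf; exact: measurableT_comp. Qed.

Lemma measurable_fun_ord_sum n (h : 'I_n -> T -> R) :
  (forall i, measurable_fun [set: T] (h i)) ->
  measurable_fun [set: T] (fun w => \sum_i h i w).
Proof. by move=> mh; exact: measurable_sum. Qed.

Section ops.
Variables (m n q : nat).
Implicit Types (A B : T -> 'M[R]_(m, n)).

Lemma measurable_mx_cst (A : 'M[R]_(m, n)) : measurable_mx (fun _ : T => A).
Proof. by move=> i j; exact: measurable_cst. Qed.

Lemma measurable_mxD A B : measurable_mx A -> measurable_mx B ->
  measurable_mx (fun w => A w + B w).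
Proof.
by move=> mA mB i j; under eq_fun do rewrite mxE; exact: measurable_funD.
Qed.

Lemma measurable_mxB A B : measurable_mx A -> measurable_mx B ->
  measurable_mx (fun w => A w - B w).
Proof.
by move=> mA mB i j; under eq_fun do rewrite !mxE; exact: measurable_funB.
Qed.

Lemma measurable_mxZ (f : T -> R) A : measurable_fun [set: T] f -> measurable_mx A ->
  measurable_mx (fun w => f w *: A w).
Proof.
by move=> mf mA i j; under eq_fun do rewrite mxE; exact: measurable_funM.
Qed.

Lemma measurable_mx_tr A : measurable_mx A -> measurable_mx (fun w => (A w)^T).
Proof. by move=> mA i j; under eq_fun do rewrite mxE; exact: mA. Qed.

Lemma measurable_mx_sum (I : finType) (F : I -> T -> 'M[R]_(m, n)) :
  (forall i, measurable_mx (F i)) -> measurable_mx (fun w => \sum_i F i w).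
Proof.
move=> mF i j; under eq_fun do rewrite summxE.
by apply: measurable_sum => k; exact: mF.
Qed.

Lemma measurable_mxM A (B : T -> 'M[R]_(n, q)) : measurable_mx A -> measurable_mx B ->
  measurable_mx (fun w => A w *m B w).
Proof.
move=> mA mB i j; under eq_fun do rewrite mxE.
by apply: measurable_fun_ord_sum => k; exact: measurable_funM.
Qed.

End ops.

Lemma measurable_det n (A : T -> 'M[R]_n) : measurable_mx A ->
  measurable_fun [set: T] (fun w => \det (A w)).
Proof.
move=> mA; rewrite /determinant; apply: measurable_sum => s.
apply: measurable_funM; first exact: measurable_cst.
by apply: measurable_prod => i _; exact: mA.
Qed.

Lemma measurable_invmx n (A : T -> 'M[R]_n) : measurable_mx A ->
  measurable_mx (fun w => invmx (A w)).
Proof.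
move=> mA i j.
have mdet := measurable_det n A mA.
have madj : measurable_fun [set: T] (fun w => (\adj (A w)) i j).
  under eq_fun do rewrite mxE /cofactor.
  apply: measurable_funM; first exact: measurable_cst.
  apply: measurable_det => k l; under eq_fun do rewrite !mxE; exact: mA.
rewrite (_ : (fun w => _) = (fun w => if \det (A w) != 0 then (\det (A w))^-1 * (\adj (A w)) i j else A w i j)); last first.
  apply/funext => w; rewrite /invmx unitmxE unitfE; case: ifP => // _.
  by rewrite mxE.
apply: measurable_fun_ifT.
- rewrite (_ : (fun w => _) = negb \o (fun w => \det (A w) == 0))//.
  apply: (measurableT_comp (f := negb)) => //.
  apply: measurable_fun_eqr => //; exact: measurable_cst.
- by apply: measurable_funM => //; exact: measurable_fun_inv.
- exact: mA.
Qed.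

Lemma measurable_dot p (u v : T -> 'cV[R]_p) : measurable_mx u -> measurable_mx v ->
  measurable_fun [set: T] (fun w => dot (u w) (v w)).
Proof. by move=> mu mv; apply: (measurable_mxM _ _ _ _ _ (measurable_mx_tr _ _ _ mu) mv). Qed.

Lemma measurable_enorm p (u : T -> 'cV[R]_p) : measurable_mx u ->
  measurable_fun [set: T] (fun w => enorm (u w)).
Proof.
move=> mu; rewrite (_ : (fun w => _) = (fun w => (\sum_a u w a 0 ^+ 2) `^ 2^-1)).
  apply: measurable_fun_powR; apply: measurable_fun_ord_sum => a.
  by apply: measurable_funX; exact: mu.
by apply/funext => w; rewrite powR12_sqrt// sumr_ge0// => a _; exact: sqr_ge0.
Qed.

(** An event that is decided, near each of its outcomes, by the value of a
    random matrix is a countable union of events that constrain the matrix to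
    a box with rational centre. It serves for sets that are given by
    uncountably many conditions, and for functions of a matrix that are only
    known to be continuous. *)
Lemma measurable_open_preimage m n (B : T -> 'M[R]_(m, n)) (A0 Q : set T) :
  measurable A0 -> measurable_mx B ->
  (forall w0, A0 w0 -> Q w0 -> exists2 rho : R, 0 < rho & forall w, A0 w ->
     (forall a b, `|B w a b - B w0 a b| < rho) -> Q w) ->
  measurable (A0 `&` Q).
Proof.
move=> mA0 mB loc.
pose box (u : 'M[rat]_(m, n) * nat) : set T :=
  [set w | forall a b, `|B w a b - ratr (u.1 a b)| < u.2.+1%:R^-1].
pose sel u : set T := if `[< A0 `&` box u `<=` Q >] then A0 `&` box u else set0.
have mbox u : measurable (box u).
  rewrite (_ : box u = \bigcap_(a in [set: 'I_m]) \bigcap_(b in [set: 'I_n])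
     [set w | `|B w a b - ratr (u.1 a b)| < u.2.+1%:R^-1]); last first.
    by apply/seteqP; split=> [w h a _ b _|w h a b]; [exact: h|exact: h].
  apply: fin_bigcap_measurable => // a _; apply: fin_bigcap_measurable => // b _.
  rewrite -[X in measurable X]setTI; apply: (measurable_fun_ltr _ _ measurableT (Y := [set true])) => //.
  apply: measurable_fun_norm; apply: measurable_funB => //; exact: mB.
rewrite (_ : A0 `&` Q = \bigcup_u sel u).
  apply: countable_bigcupT_measurable; first exact: countableP.
  by move=> u; rewrite /sel; case: asboolP => _ //; exact: measurableI.
apply/seteqP; split=> [w0 [Aw0 Qw0]|w [u _]]; last first.
  by rewrite /sel; case: asboolP => // h wu; split; [case: wu|exact: h].
have [rho rho0 locw] := loc w0 Aw0 Qw0.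
have [k kr] : exists k : nat, k.+1%:R^-1 < rho / 2.
  have r20 : 0 < rho / 2 by rewrite divr_gt0.
  have [N _ HN] := near_infty_natSinv_lt (PosNum r20).
  by exists N; exact: (HN N (leqnn N)).
have k0 : 0 < k.+1%:R^-1 :> R by rewrite invr_gt0.
have rats a b : exists s : rat, `|B w0 a b - ratr s| < k.+1%:R^-1.
  move: k0; move: k.+1%:R^-1 => t t0.
  have lt_t : B w0 a b - t < B w0 a b + t by lra.
  have [s] := rat_in_itvoo lt_t.
  rewrite in_itv /= => /andP[s1 s2]; exists s.
  by rewrite ltr_norml; apply/andP; split; lra.
have [s sP] := choice (fun ab : 'I_m * 'I_n => rats ab.1 ab.2).
pose u : 'M[rat]_(m, n) * nat := (\matrix_(a, b) s (a, b), k).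
have bw0 : box u w0 by move=> a b; rewrite /u/= mxE; exact: (sP (a, b)).
exists u => //; rewrite /sel; case: asboolP => // -[] w [Aw bw].
apply: locw => // a b.
have := bw a b; have := bw0 a b; rewrite /u/= => h1 h2.
rewrite (_ : _ - _ = (B w a b - ratr ((\matrix_(a, b) s (a, b)) a b)) -
  (B w0 a b - ratr ((\matrix_(a, b) s (a, b)) a b))); last by ring.
apply: le_lt_trans (ler_normB _ _) _; rewrite (splitr rho).
by apply: ltrD; [exact: lt_trans h2 kr|exact: lt_trans h1 kr].
Qed.

End measurable_matrices.

Section measurable_statistics.
Context d (T : measurableType d) (R : realType) (p n : nat).
Variables (Suu : 'M[R]_p) (W : nat -> T -> 'cV[R]_p) (y pi : nat -> T -> R).
Variable bh : T -> 'cV[R]_p.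
Hypothesis mW : forall i, (i < n)%N -> measurable_mx (W i).
Hypothesis my : forall i, (i < n)%N -> measurable_fun [set: T] (y i).
Hypothesis mpi : forall i, (i < n)%N -> measurable_fun [set: T] (pi i).

Local Notation Ww w := (W ^~ w).
Local Notation yw w := (y ^~ w).
Local Notation pw w := (pi ^~ w).

Let mWo (i : 'I_n) : measurable_mx (W i). Proof. exact: mW. Qed.
Let myo (i : 'I_n) : measurable_fun [set: T] (y i). Proof. exact: my. Qed.
Let mpio (i : 'I_n) : measurable_fun [set: T] (pi i). Proof. exact: mpi. Qed.
Let mouter (i : 'I_n) : measurable_mx (fun w => W i w *m (W i w)^T).
Proof. by apply: measurable_mxM => //; exact: measurable_mx_tr. Qed.

Lemma measurable_HW : measurable_mx (fun w => HW Suu (Ww w) n).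
Proof.
apply: measurable_mxB; last exact: measurable_mx_cst.
apply: measurable_mxZ; first exact: measurable_cst.
exact: measurable_mx_sum.
Qed.

Lemma measurable_score : measurable_mx (fun w => score n (Ww w) (yw w)).
Proof.
apply: measurable_mxZ; first exact: measurable_cst.
by apply: measurable_mx_sum => i; exact: measurable_mxZ.
Qed.

Lemma measurable_sub_hess r (j : {ffun 'I_r -> 'I_n}) :
  measurable_mx (fun w => sub_hess n r Suu (Ww w) (pw w) j).
Proof.
apply: measurable_mxB; last exact: measurable_mx_cst.
apply: measurable_mxZ; first exact: measurable_cst.
apply: measurable_mx_sum => k; apply: measurable_mxZ => //.
apply: measurable_fun_inv; apply: measurable_funM => //; exact: measurable_cst.
Qed.

Lemma measurable_W4 :
  measurable_fun [set: T] (fun w => n%:R^-1 * \sum_(i < n) enorm (W i w) ^+ 4).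
Proof.
apply: measurable_funM; first exact: measurable_cst.
apply: measurable_fun_ord_sum => i; apply: measurable_funX.
exact: measurable_enorm.
Qed.

Hypothesis mbh : measurable_mx bh.

Let mresid (i : 'I_n) : measurable_fun [set: T] (fun w => resid (Ww w) (yw w) (bh w) i).
Proof. by apply: measurable_funB => //; exact: measurable_dot. Qed.

Lemma measurable_eW q :
  measurable_fun [set: T] (fun w => n%:R^-1 * \sum_(i < n)
    `|resid (Ww w) (yw w) (bh w) i| `^ q * enorm (W i w) `^ q).
Proof.
apply: measurable_funM; first exact: measurable_cst.
apply: measurable_fun_ord_sum => i; apply: measurable_funM.
  by apply: measurable_fun_powR; exact: measurable_fun_norm.
by apply: measurable_fun_powR; exact: measurable_enorm.
Qed.

Let mSb : measurable_mx (fun w => Suu *m bh w).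
Proof. by apply: measurable_mxM => //; exact: measurable_mx_cst. Qed.

Lemma measurable_Vc r : measurable_mx (fun w => Vc Suu (Ww w) (yw w) n r (pw w) (bh w)).
Proof.
apply: measurable_mxB.
  apply: measurable_mxZ; first exact: measurable_cst.
  apply: measurable_mx_sum => i; apply: measurable_mxZ => //.
  by apply: measurable_funM; [exact: measurable_funX|exact: measurable_fun_inv].
apply: measurable_mxZ; first exact: measurable_cst.
by apply: measurable_mxM => //; exact: measurable_mx_tr.
Qed.

Lemma measurable_Vmx r : measurable_mx (fun w => Vmx Suu (Ww w) (yw w) n r (pw w) (bh w)).
Proof.
have mHi := measurable_invmx _ _ _ _ _ measurable_HW.
by apply: measurable_mxM => //; apply: measurable_mxM => //; exact: measurable_Vc.
Qed.

Let mxi (i : 'I_n) : measurable_mx (fun w => xi n Suu (Ww w) (yw w) (pw w) (bh w) i).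
Proof.
apply: measurable_mxD => //; apply: measurable_mxZ => //; apply: measurable_funM => //.
by apply: measurable_fun_inv; apply: measurable_funM => //; exact: measurable_cst.
Qed.

Lemma measurable_mean_xi r (j : {ffun 'I_r -> 'I_n}) :
  measurable_mx (fun w => mean_xi n r Suu (Ww w) (yw w) (pw w) (bh w) j).
Proof.
apply: measurable_mxZ; first exact: measurable_cst.
exact: measurable_mx_sum.
Qed.

Lemma measurable_sum_stdz r (j : {ffun 'I_r -> 'I_n}) (S : T -> 'M[R]_p) :
  measurable_mx S -> measurable_mx (fun w =>
    \sum_k stdz n r Suu (Ww w) (yw w) (pw w) (bh w) (S w) (j k)).
Proof.
move=> mS; apply: measurable_mx_sum => k; apply: measurable_mxZ.
  exact: measurable_cst.
apply: measurable_mxM => //; apply: measurable_mxM => //.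
exact/measurable_invmx/measurable_HW.
Qed.

End measurable_statistics.

(** * The good event and the conditional distribution function *)

Section measurable_events.
Context d (T : measurableType d) (R : realType).

Lemma measurable_forallb (I : finType) (Q : I -> T -> bool) :
  (forall i, measurable [set w | Q i w]) -> measurable [set w | [forall i, Q i w]].
Proof.
move=> mQ; rewrite (_ : mkset _ = \bigcap_(i in [set: I]) [set w | Q i w]).
  by apply: fin_bigcap_measurable.
apply/seteqP; split=> [w /forallP h i _|w h]; first exact: h.
by apply/forallP => i; exact: h.
Qed.

Lemma measurable_existsb (I : finType) (Q : I -> T -> bool) :
  (forall i, measurable [set w | Q i w]) -> measurable [set w | [exists i, Q i w]].
Proof.
move=> mQ; rewrite (_ : mkset _ = \bigcup_(i in [set: I]) [set w | Q i w]).
  by apply: fin_bigcup_measurable.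
apply/seteqP; split=> [w /existsP[i h]|w [i _ h]]; first by exists i.
by apply/existsP; exists i.
Qed.

Lemma measurable_le_set (f g : T -> R) : measurable_fun [set: T] f ->
  measurable_fun [set: T] g -> measurable [set w | f w <= g w].
Proof.
move=> mf mg; rewrite -[X in measurable X]setTI.
exact: (measurable_fun_ler mf mg measurableT (Y := [set true])).
Qed.

Lemma measurable_lt_set (f g : T -> R) : measurable_fun [set: T] f ->
  measurable_fun [set: T] g -> measurable [set w | f w < g w].
Proof.
move=> mf mg; rewrite -[X in measurable X]setTI.
exact: (measurable_fun_ltr mf mg measurableT (Y := [set true])).
Qed.

(** The complement is open: a strict violation at one [u] persists nearby. *)
Lemma measurable_coercive p (c : R) (A : T -> 'M[R]_p) : measurable_mx A ->
  measurable [set w | coercive c (A w)].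
Proof.
move=> mA; rewrite -[X in measurable X]setCK; apply: measurableC.
rewrite -[X in measurable X]setTI; apply: (measurable_open_preimage _ _ _ _ _ A) => // w0 _.
move=> /existsNP[u /negP]; rewrite -ltNge => h.
pose g := c * enorm u ^+ 2 - qform (A w0) u.
have g0 : 0 < g by rewrite subr_gt0.
have N0 : 0 < norm1 u ^+ 2 + 1 by rewrite ltr_wpDl// sqr_ge0.
exists (g / (norm1 u ^+ 2 + 1)); first by rewrite divr_gt0.
move=> w _ Aw /(_ u); apply/negP; rewrite -ltNge.
have : qform (A w) u - qform (A w0) u <= g / (norm1 u ^+ 2 + 1) * norm1 u ^+ 2.
  apply: le_trans (ler_norm _) _; rewrite !qform_sum -sumrB.
  rewrite (eq_bigr (fun a => \sum_b (A w a b - A w0 a b) * (u a 0 * u b 0))); last first.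
    by move=> a _; rewrite -sumrB; apply: eq_bigr => b _; rewrite mulrBl.
  by apply: (quad_le (fun a b => A w a b - A w0 a b)) => a b; apply/ltW/Aw.
have : g / (norm1 u ^+ 2 + 1) * norm1 u ^+ 2 < g.
  by rewrite mulrAC ltr_pdivrMr// ltr_pM2l// ltrDl.
by rewrite {2}/g; lra.
Qed.

End measurable_events.

Lemma probability_bigcup_le d (T : measurableType d) (R : realType)
    (P : probability T R) (I : finType) (A : I -> set T) :
  (forall i, measurable (A i)) -> (P (\bigcup_i A i) <= \sum_i P (A i))%E.
Proof.
move=> mA.
have -> : \bigcup_i A i = \big[setU/set0]_i A i.
  rewrite -bigcup_seq; apply/seteqP; split=> w [i _ Aw]; exists i => //=.
  by rewrite mem_index_enum.
elim: (index_enum I) => [|i l IH]; first by rewrite !big_nil measure0.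
rewrite !big_cons; apply: le_trans (measureU2 _ _ _) _ => //.
  by apply: bigsetU_measurable.
exact: leeD.
Qed.

Section one_sample.
Context d (T : measurableType d) (R : realType) (P : probability T R) (p : nat).
Variables (n r : nat) (Suu : 'M[R]_p) (W : nat -> T -> 'cV[R]_p) (y : nat -> T -> R).
Variables (pi : nat -> T -> R) (J : nat -> T -> nat).
Variables (bh bt : T -> 'cV[R]_p) (S : T -> 'M[R]_p).

Local Notation G := (data_sigma W y n).
Local Notation Ww w := (W ^~ w).
Local Notation yw w := (y ^~ w).
Local Notation pw w := (pi ^~ w).
Local Notation Hn w := (HW Suu (Ww w) n).

Hypothesis n0 : (0 < n)%N.
Hypothesis r0 : (0 < r)%N.
Hypothesis Suus : Suu^T = Suu.
Hypothesis mW : forall i, measurable_mx (W i).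
Hypothesis my : forall i, measurable_fun [set: T] (y i).
Hypothesis bhP : argmin_estimator (fun w => loss Suu (Ww w) (yw w) n) bh.
Hypothesis piP : sampling_probs G n pi.
Hypothesis JP : drawn_with_replacement P G n r pi J.
Hypothesis btP :
  argmin_estimator (fun w => subloss Suu (Ww w) (yw w) n r (pw w) (J ^~ w)) bt.
Hypothesis mS : measurable_mx S.
Hypothesis SP : forall w, let V := Vmx Suu (Ww w) (yw w) n r (pw w) (bh w) in
  posdef V -> is_inv_sqrt V (S w).

Variables (c M delta e0 : R) (H : 'M[R]_p).
Hypothesis c0 : 0 < c.
Hypothesis M1 : 1 <= M.
Hypothesis d0 : 0 < delta.
Hypothesis Hclose : forall A : 'M[R]_p, (forall a b, `|A a b - H a b| <= e0) ->
  coercive c A /\ entries_le A M.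

Let gens : set (set T) := [set A | exists f B,
  [/\ (\bigcup_(i in [set i | (i < n)%N]) (coords (W i) `|` [set y i])) f,
      measurable B & A = f @^-1` B]].
Local Notation TG := (g_sigma_algebraType gens).

Let gens_m : gens `<=` measurable.
Proof.
move=> _ [f [B [[i _ Ff] mB ->]]]; rewrite -[X in measurable X]setTI.
by case: Ff => [[a ->]|->]; [exact: mW|exact: my].
Qed.

Let GW i : (i < n)%N -> @measurable_mx _ TG R _ _ (W i).
Proof.
move=> ni a b; rewrite ord1; apply/measurable_wrtP => B mB.
apply: sub_sigma_algebra; exists (fun w => W i w a 0), B; split=> //.
by exists i => //; left; exists a.
Qed.

Let Gy i : (i < n)%N -> @measurable_fun _ _ TG R [set: TG] (y i).
Proof.
move=> ni; apply/measurable_wrtP => B mB.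
by apply: sub_sigma_algebra; exists (y i), B; split=> //; exists i => //; right.
Qed.

Let Gpi i : (i < n)%N -> @measurable_fun _ _ TG R [set: TG] (pi i).
Proof. by case: piP => h _ _ ni; apply/measurable_wrtP; exact: h. Qed.

Let mpi i : (i < n)%N -> measurable_fun [set: T] (pi i).
Proof. by case: piP => h _ _ ni; apply: (measurable_wrt_fun _ _ _ _ gens_m); exact: h. Qed.

Let mbh : measurable_mx bh. Proof. by case: bhP. Qed.
Let mbt : measurable_mx bt. Proof. by case: btP. Qed.

(** The estimator [bh] is only determined, as a function of the data, where
    the Hessian is positive definite. This function of the data agrees with it
    there, and is measurable for the data everywhere. *)
Definition normal_sol w : 'cV[R]_p := invmx (Hn w) *m score n (Ww w) (yw w).

Let Gns : @measurable_mx _ TG R _ _ normal_sol.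
Proof.
apply: measurable_mxM; last exact: measurable_score.
exact/measurable_invmx/measurable_HW.
Qed.

Definition hess_close : set T :=
  [set w | [forall a, forall b, `|Hn w a b - H a b| <= e0]].
Definition moment_le : set T :=
  [set w | n%:R^-1 * (\sum_(i < n) enorm (W i w) ^+ 4) <= M].
Definition weights_ge (m : R) : set T :=
  [set w | [forall i : 'I_n, 0 < pi i w] && [forall i : 'I_n, (n%:R * pi i w)^-1 <= m]].
Definition cross_le (b : T -> 'cV[R]_p) : set T :=
  [set w | n%:R^-1 * (\sum_(i < n) `|resid (Ww w) (yw w) (b w) i| `^ (2 + delta)
            * enorm (W i w) `^ (2 + delta)) <= M].
Definition Vc_coercive (b : T -> 'cV[R]_p) : set T :=
  [set w | coercive c (r%:R *: Vc Suu (Ww w) (yw w) n r (pw w) (b w))].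
(** The residuals are those of [normal_sol], so that the event is determined by
    the data; on it [bh] is [normal_sol], by [hess_close]. *)
Definition good_event : set T :=
  hess_close `&` (moment_le `&` (weights_ge M `&`
    (cross_le normal_sol `&` Vc_coercive normal_sol))).

Lemma good_event_G : G good_event.
Proof.
have h1 : @measurable _ TG hess_close.
  apply: measurable_forallb => a; apply: measurable_forallb => b.
  apply: measurable_le_set; last exact: measurable_cst.
  apply: measurable_fun_norm; apply: measurable_funB; last exact: measurable_cst.
  exact: measurable_HW.
have h2 : @measurable _ TG moment_le.
  by apply: measurable_le_set; [exact: measurable_W4|exact: measurable_cst].
have h3 : @measurable _ TG (weights_ge M).
  rewrite (_ : weights_ge M = [set w | [forall i : 'I_n, 0 < pi i w]] `&`
    [set w | [forall i : 'I_n, (n%:R * pi i w)^-1 <= M]]); last first.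
    by apply/seteqP; split=> [w /andP[]|w [h1' h2']]//; apply/andP.
  apply: measurableI; apply: measurable_forallb => i.
    by apply: measurable_lt_set; [exact: measurable_cst|exact: Gpi].
  apply: measurable_le_set; last exact: measurable_cst.
  apply: measurable_fun_inv; apply: measurable_funM; first exact: measurable_cst.
  exact: Gpi.
have h4 : @measurable _ TG (cross_le normal_sol).
  by apply: measurable_le_set; [exact: measurable_eW|exact: measurable_cst].
have h5 : @measurable _ TG (Vc_coercive normal_sol).
  apply: measurable_coercive; apply: measurable_mxZ; first exact: measurable_cst.
  exact: measurable_Vc.
have : @measurable _ TG good_event by do 4!apply: measurableI => //.
by [].
Qed.

Let mA0 : measurable good_event. Proof. exact: (gen_measurable _ _ _ gens_m _ good_event_G). Qed.

Lemma hess_closeP w : hess_close w ->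
  [/\ coercive c (Hn w), entries_le (Hn w) M, Hn w *m bh w = score n (Ww w) (yw w) &
      bh w = normal_sol w].
Proof.
move=> /forallP h.
have [cH HM] := Hclose _ (fun a b => forallP (h a) b).
have Hpos u : u != 0 -> 0 < qform (Hn w) u by exact: coercive_qform_gt0 cH.
have bE : Hn w *m bh w = score n (Ww w) (yw w).
  have [_ bmin] := bhP; have := bmin w.
  rewrite loss_wloss score_wscore HW_whess in Hpos * => bmin'.
  by apply: wloss_argmin_eq => //; apply: bmin'; exists (invmx (whess n%:R (fun=> 1) (fun i : 'I_n => W i w) Suu) *m
    wscore n%:R (fun=> 1) (fun i : 'I_n => W i w) (fun i : 'I_n => y i w)); exact: wloss_argmin.
split=> //; rewrite /normal_sol -bE mulKmx//.
exact: qform_gt0_unitmx.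
Qed.

Lemma good_eventP w : good_event w ->
  good c M delta n r Suu (Ww w) (yw w) (pw w) (bh w).
Proof.
move=> [/hess_closeP[cH HM bE bns] [W4 [/andP[/forallP pi0 /forallP piM] [eW cV]]]].
split=> //.
- by move=> i ni; have := pi0 (Ordinal ni); have := piM (Ordinal ni).
- by rewrite bns.
- by rewrite bns.
Qed.

Lemma good_event_V w : good_event w ->
  is_inv_sqrt (Vmx Suu (Ww w) (yw w) n r (pw w) (bh w)) (S w).
Proof. by move=> /good_eventP gw; apply: SP; exact: (good_V_posdef c M delta). Qed.

Let GV : @measurable_mx _ TG R _ _ (fun w =>
  invmx (Vmx Suu (Ww w) (yw w) n r (pw w) (normal_sol w))).
Proof. by apply: measurable_invmx; exact: measurable_Vmx. Qed.

Lemma good_event_ns w : good_event w -> bh w = normal_sol w.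
Proof. by case=> /hess_closeP[]. Qed.

(** The inverse square root at good outcomes. Nothing but its uniqueness ties
    it to the data; [measurable_root] derives measurability from its continuity,
    as a function of the inverse of [Vmx]. *)
Definition root w : 'M[R]_p := if w \in good_event then S w else 0.

Lemma measurable_root : @measurable_mx _ TG R _ _ root.
Proof.
move=> a b; rewrite (_ : (fun w => _) = (fun w => S w a b) \_ good_event); last first.
  by apply/funext => w; rewrite patchE /root; case: ifP => _ //; rewrite mxE.
have GA0 : @measurable _ TG good_event := good_event_G.
apply/(measurable_restrictT _ _).1 => //.
move=> _; apply: (measurability _ (RGenOInfty.measurableE R)) => //.
move=> /= _ [_ [t ->] <-]; rewrite preimage_itvoy.
apply: (measurable_open_preimage _ _ _ _ _ _ _ _ GA0 GV) => w0 Aw0 tw0.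
have [pS SS] := good_event_V _ Aw0.
have [cS cS0 coS] := posdef_coercive _ pS.
pose eps := S w0 a b - t.
have eps0 : 0 < eps by rewrite subr_gt0.
have p10 : 0 < p%:R + 1 :> R by rewrite ltr_wpDl.
pose rho := cS * eps / (p%:R + 1).
have rho0 : 0 < rho by rewrite divr_gt0// mulr_gt0.
exists rho => // w Aw close.
have [pS' SS'] := good_event_V _ Aw.
have : `|S w a b - S w0 a b| <= p%:R * rho / cS.
  apply: (posdef_sqrt_stable _ _ _ _ pS' pS.1 cS0 coS) => a' b'.
  rewrite SS SS' (good_event_ns _ Aw) (good_event_ns _ Aw0).
  exact/ltW/close.
have : p%:R * rho / cS < eps.
  rewrite /rho (_ : _ / cS = eps * (p%:R / (p%:R + 1))); last by field; rewrite !gt_eqF.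
  by rewrite gtr_pMr// ltr_pdivrMr// mul1r ltrDl.
rewrite ler_norml /eps /= => h1 /andP[h2 _]; lra.
Qed.

Section conclusion.
Variables (x : 'cV[R]_p) (e eta rho K : R).
Hypothesis e_gt0 : 0 < e.

Let near w := sample_close n r Suu (Ww w) (yw w) (pw w) (bh w) rho (K / Num.sqrt r%:R).
Let T_ w (j : {ffun 'I_r -> 'I_n}) : 'cV[R]_p :=
  \sum_k stdz n r Suu (Ww w) (yw w) (pw w) (bh w) (S w) (j k).

Hypothesis lin : forall w, good_event w -> forall j (I : nat -> nat) b, near w j ->
  (forall k : 'I_r, I k = j k :> nat) ->
  ((exists b', is_argmin (subloss Suu (Ww w) (yw w) n r (pw w) I) b') ->
     is_argmin (subloss Suu (Ww w) (yw w) n r (pw w) I) b) ->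
  forall a, `|(S w *m (b - bh w)) a 0 - T_ w j a 0| <= eta.
Hypothesis lower : forall w, good_event w -> std_normal_cdf x - e <=
  draws_avg (fun i : 'I_n => pi i w) r
    (fun j => (near w j && [forall a, T_ w j a 0 <= x a 0 - eta])%:R).
Hypothesis upper : forall w, good_event w -> 1 - std_normal_cdf x - e <=
  draws_avg (fun i : 'I_n => pi i w) r
    (fun j => (near w j && [exists a, x a 0 + eta < T_ w j a 0])%:R).

(* The same quantities in terms of functions of the data alone. *)
Let near' w := sample_close n r Suu (Ww w) (yw w) (pw w) (normal_sol w) rho (K / Num.sqrt r%:R).
Let T' w (j : {ffun 'I_r -> 'I_n}) : 'cV[R]_p :=
  \sum_k stdz n r Suu (Ww w) (yw w) (pw w) (normal_sol w) (root w) (j k).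

Let near'E w j : good_event w -> near' w j = near w j.
Proof. by move=> gw; rewrite /near' /near (good_event_ns _ gw). Qed.

Let T'E w j : good_event w -> T' w j = T_ w j.
Proof. by move=> gw; rewrite /T' /T_ (good_event_ns _ gw) /root mem_set. Qed.

Let Gnear j : @measurable _ TG [set w | near' w j].
Proof.
rewrite (_ : mkset _ =
  [set w | [forall a, forall b, `|sub_hess n r Suu (Ww w) (pw w) j a b - Hn w a b| <= rho]] `&`
  [set w | [forall a, `|mean_xi n r Suu (Ww w) (yw w) (pw w) (normal_sol w) j a 0| <= K / Num.sqrt r%:R]]); last first.
  by apply/seteqP; split=> [w /andP[]|w [h1 h2]]//; apply/andP.
apply: measurableI.
  apply: measurable_forallb => a; apply: measurable_forallb => b.
  apply: measurable_le_set; last exact: measurable_cst.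
  apply: measurable_fun_norm; apply: measurable_funB; last exact: measurable_HW.
  exact: measurable_sub_hess.
apply: measurable_forallb => a; apply: measurable_le_set; last exact: measurable_cst.
apply: measurable_fun_norm; exact: measurable_mean_xi.
Qed.

Let GT j a : @measurable_fun _ _ TG R [set: TG] (fun w => T' w j a 0).
Proof. exact: (measurable_sum_stdz _ _ _ _ _ _ _ _ _ _ _ _ _ Gns _ _ _ measurable_root). Qed.

Let drawn (j : {ffun 'I_r -> 'I_n}) : set T := [set w | forall k : 'I_r, J k w = j k :> nat].

Let mdrawn j : measurable (drawn j).
Proof.
have [mJ _] := JP.
rewrite (_ : drawn j = \bigcap_(k in [set: 'I_r]) (J k @^-1` [set (j k : nat)])).
  apply: fin_bigcap_measurable => // k _; rewrite -[X in measurable X]setTI.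
  exact: mJ.
by apply/seteqP; split=> [w h k _|w h k]; [exact: h|exact: h].
Qed.

Let drawn_inj i j w : drawn i w -> drawn j w -> i = j.
Proof.
by move=> hi hj; apply/ffunP => k; apply/val_inj; rewrite /= -(hi k) -(hj k).
Qed.

Let E : set T := [set w | forall a, (S w *m (bt w - bh w)) a 0 <= x a 0].

Let mE : measurable E.
Proof.
rewrite (_ : E = [set w | [forall a, (S w *m (bt w - bh w)) a 0 <= x a 0]]).
  apply: measurable_forallb => a; apply: measurable_le_set; last exact: measurable_cst.
  by apply: measurable_mxM => //; exact: measurable_mxB.
by apply/seteqP; split=> w h; [apply/forallP|apply/forallP].
Qed.

Let btw w (j : {ffun 'I_r -> 'I_n}) : good_event w -> near w j -> drawn j w ->
  forall a, `|(S w *m (bt w - bh w)) a 0 - T_ w j a 0| <= eta.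
Proof. by move=> gw nj dj; apply: (lin _ gw j (J ^~ w)) => //; case: btP => _; exact. Qed.

(** [cond_prob_lower] bounds the conditional probability of the event from
    below, and, applied to the complement, from above. *)
Lemma cond_cdf_near (F : T -> R) : is_cond_prob P G E F ->
  P (good_event `&` [set w | e + e < `|F w - std_normal_cdf x|]) = 0%E.
Proof.
move=> FP.
have [_ JP2] := JP.
have lo : P (good_event `&` [set w | F w < (std_normal_cdf x - e) - e]) = 0%E.
  pose L j := [set w | near' w j] `&` [set w | [forall a, T' w j a 0 <= x a 0 - eta]].
  apply: (@cond_prob_lower _ _ _ P gens gens_m _ E F drawn
    (fun j w => \prod_(k < r) pi (j k) w) L) => //.
  - exact: good_event_G.
  - move=> j; have : @measurable _ TG (L j); last by [].
    apply: measurableI => //; apply: measurable_forallb => a.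
    by apply: measurable_le_set => //; exact: measurable_cst.
  - move=> j w [[gw [nj /forallP Tj]] dj] a.
    have nj' : near w j by rewrite -near'E.
    have := btw _ _ gw nj' dj a; have := Tj a; rewrite T'E// ler_norml => h /andP[_ h2].
    lra.
  - move=> w gw; apply: le_trans (lower _ gw) _.
    rewrite /draws_avg le_eqVlt; apply/orP; left; apply/eqP; apply: eq_bigr => j _.
    congr (_ * _); rewrite indicE /L in_setI; congr (nat_of_bool _)%:R.
    by rewrite -near'E// -T'E// !mem_setE.
have up : P (good_event `&` [set w | 1 - F w < (1 - std_normal_cdf x - e) - e]) = 0%E.
  pose L j := [set w | near' w j] `&` [set w | [exists a, x a 0 + eta < T' w j a 0]].
  apply: (@cond_prob_lower _ _ _ P gens gens_m _ (~` E) (fun w => 1 - F w) drawn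
    (fun j w => \prod_(k < r) pi (j k) w) L) => //.
  - exact: measurableC.
  - exact: (@cond_prob_compl _ _ _ P gens gens_m).
  - exact: good_event_G.
  - move=> j; have : @measurable _ TG (L j); last by [].
    apply: measurableI => //; apply: measurable_existsb => a.
    by apply: measurable_lt_set => //; exact: measurable_cst.
  - move=> j w [[gw [nj /existsP[a Tj]]] dj] /(_ a) Ea.
    have nj' : near w j by rewrite -near'E.
    move: (btw _ _ gw nj' dj a) Tj; rewrite T'E// ler_norml => /andP[h2 _].
    lra.
  - move=> w gw; apply: le_trans (upper _ gw) _.
    rewrite /draws_avg le_eqVlt; apply/orP; left; apply/eqP; apply: eq_bigr => j _.
    congr (_ * _); rewrite indicE /L in_setI; congr (nat_of_bool _)%:R.
    by rewrite -near'E// -T'E// !mem_setE.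
have mF : measurable_fun [set: T] F.
  by case: FP => mF _ _; exact: (measurable_wrt_fun _ _ _ _ gens_m).
have m1 : measurable (good_event `&` [set w | F w < (std_normal_cdf x - e) - e]).
  by apply: measurableI => //; apply: measurable_lt_set => //; exact: measurable_cst.
have m2 : measurable (good_event `&` [set w | 1 - F w < (1 - std_normal_cdf x - e) - e]).
  apply: measurableI => //; apply: measurable_lt_set; last exact: measurable_cst.
  by apply: measurable_funB => //; exact: measurable_cst.
apply/eqP; rewrite eq_le measure_ge0 andbT.
rewrite -[leRHS]add0e -[X in (_ <= X + _)%E]lo -[X in (_ <= _ + X)%E]up.
apply: le_trans (measureU2 _ m1 m2); apply: le_measure; rewrite ?inE.
- apply: measurableI => //; apply: measurable_lt_set; first exact: measurable_cst.
  by apply: measurable_fun_norm; apply: measurable_funB => //; exact: measurable_cst.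
- exact: measurableU.
- move=> w [gw]; rewrite /= real_lter_normr ?num_real// => /orP[] h; [right|left]; split=> //=; lra.
Qed.

End conclusion.

(** A union bound, with the constants as the assumptions provide them. *)
Lemma good_event_compl (M2 M3 M4 c' : R) : M2 <= M -> M3 <= M -> M4 <= M -> c <= c' ->
  (P (~` good_event) <= \sum_a \sum_b P [set w | (e0 < `|Hn w a b - H a b|)%R] +
   (P [set w | M2%:E < `|(n%:R^-1 * \sum_(i < n) enorm (W i w) ^+ 4)%:E|] +
    (P [set w | M3%:E < `|\big[maxe/0%E]_(i < n) (((n%:R * pi i w)%:E)^-1)|] +
     (P [set w | M4%:E < `|(n%:R^-1 * \sum_(i < n)
          `|resid (Ww w) (yw w) (bh w) i| `^ (2 + delta)
          * enorm (W i w) `^ (2 + delta))%:E|] +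
      P [set w | ~ forall u, (c' * enorm u ^+ 2 <=
          qform (r%:R *: Vc Suu (Ww w) (yw w) n r (pw w) (bh w)) u)%R]))))%E.
Proof.
move=> M2M M3M M4M cc'.
set B1 := fun a b => [set w | (e0 < `|Hn w a b - H a b|)%R].
set B2 := [set w | _]; set B3 := [set w | _]; set B4 := [set w | _]; set B5 := [set w | _].
have mB1 a b : measurable (B1 a b).
  apply: measurable_lt_set; first exact: measurable_cst.
  apply: measurable_fun_norm; apply: measurable_funB; last exact: measurable_cst.
  by apply: measurable_HW.
have mB2 : measurable B2.
  apply: measurable_lt_set; first exact: measurable_cst.
  by apply: measurable_fun_norm; apply: measurable_W4.
have mB4 : measurable B4.
  apply: measurable_lt_set; first exact: measurable_cst.
  by apply: measurable_fun_norm; apply: measurable_eW.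
have mB5 : measurable B5.
  rewrite (_ : B5 = ~` [set w | coercive c' (r%:R *: Vc Suu (Ww w) (yw w) n r (pw w) (bh w))])//; apply: measurableC.
  apply: measurable_coercive; apply: measurable_mxZ; first exact: measurable_cst.
  by apply: measurable_Vc.
have [_ pi0 _] := piP.
have maxP w (t : \bar R) : (0 <= t)%E -> (forall i : 'I_n, (((n%:R * pi i w)%:E)^-1 <= t)%E) ->
    (\big[maxe/0%E]_(i < n) (((n%:R * pi i w)%:E)^-1) <= t)%E.
  by move=> t0 h; elim/big_ind : _ => // a b; rewrite ge_max => -> ->.
have maxge w (i : 'I_n) : (((n%:R * pi i w)%:E)^-1 <=
    \big[maxe/0%E]_(i < n) (((n%:R * pi i w)%:E)^-1))%E.
  by rewrite (bigD1 i)//= le_max lexx.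
have max0 w : (0 <= \big[maxe/0%E]_(i < n) (((n%:R * pi i w)%:E)^-1))%E.
  elim/big_ind : _ => // [a b a0 b0|i _]; first by rewrite le_max a0.
  by rewrite inve_ge0 lee_fin mulr_ge0// pi0.
have key w : ~ B3 w -> weights_ge M3 w.
  rewrite /B3 /= gee0_abs// => /negP; rewrite -leNgt => hM.
  have key (i : 'I_n) : 0 < pi i w /\ (n%:R * pi i w)^-1 <= M3.
    have := le_trans (maxge w i) hM; rewrite inver; case: ifPn => //.
    rewrite lee_fin => np0; split=> //; rewrite lt0r pi0// andbT.
    by apply: contra np0 => /eqP ->; rewrite mulr0.
  by apply/andP; split; apply/forallP => i; case: (key i).
have mB3 : measurable B3.
  have [M30|M30] := ltP M3 0.
    rewrite (_ : B3 = setT) ?measurableT//; apply/seteqP; split=> w // _.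
    by rewrite /B3 /= gee0_abs// (lt_le_trans _ (max0 w))// lte_fin.
  rewrite (_ : B3 = ~` weights_ge M3); last first.
    apply/seteqP; split=> [w|w h]; last by apply: contrapT => /key.
    rewrite /B3 /= gee0_abs// => h /andP[/forallP p0 /forallP pM].
    move: h; apply/negP; rewrite -leNgt; apply: maxP => [|i]; first by rewrite lee_fin.
    by rewrite inver gt_eqF ?lee_fin ?pM// mulr_gt0 ?p0// ltr0n.
  apply: measurableC.
  rewrite (_ : weights_ge M3 = [set w | [forall i : 'I_n, 0 < pi i w]] `&`
    [set w | [forall i : 'I_n, (n%:R * pi i w)^-1 <= M3]]); last first.
    by apply/seteqP; split=> [w /andP[]|w [h1' h2']]//; apply/andP.
  apply: measurableI; apply: measurable_forallb => i.
    by apply: measurable_lt_set; [exact: measurable_cst|exact: mpi].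
  apply: measurable_le_set; last exact: measurable_cst.
  apply: measurable_fun_inv; apply: measurable_funM; first exact: measurable_cst.
  exact: mpi.
have mB1a a : measurable (\bigcup_b B1 a b) by exact: fin_bigcup_measurable.
have mB1' : measurable (\bigcup_a \bigcup_b B1 a b) by exact: fin_bigcup_measurable.
have le1 : (P (\bigcup_a \bigcup_b B1 a b) <= \sum_a \sum_b P (B1 a b))%E.
  apply: le_trans (probability_bigcup_le _ _ _ P _ _ mB1a) _.
  by apply: lee_sum => a _; exact: probability_bigcup_le.
apply: (@le_trans _ _ (P ((\bigcup_a \bigcup_b B1 a b) `|` (B2 `|` (B3 `|` (B4 `|` B5)))))).
  apply: le_measure; rewrite ?inE.
  - exact: measurableC.
  - by do 4!apply: measurableU => //.
  - move=> w ng; apply: contrapT => /not_orP[h1 /not_orP[h2 /not_orP[h3 /not_orP[h4 h5]]]].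
    apply: ng.
    have hc : hess_close w.
      apply/forallP => a; apply/forallP => b; rewrite leNgt; apply/negP => h.
      by apply: h1; exists a => //; exists b.
    have [_ _ _ bns] := hess_closeP _ hc.
    split=> //; split; [|split; [|split]].
    + rewrite /moment_le /= (le_trans _ M2M)// leNgt; apply/negP => h; apply: h2.
      by rewrite /B2 /= lte_fin (lt_le_trans h)// ler_norm.
    + have /andP[p0 /forallP pM] := key _ h3; apply/andP; split=> //.
      by apply/forallP => i; exact: le_trans (pM i) M3M.
    + rewrite /cross_le /= -bns (le_trans _ M4M)// leNgt; apply/negP => h; apply: h4.
      by rewrite /B4 /= lte_fin (lt_le_trans h)// ler_norm.
    + rewrite /Vc_coercive /= -bns => u; have /contrapT h := h5.
      by apply: le_trans (h u); rewrite ler_wpM2r// sqr_ge0.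
apply: le_trans (measureU2 _ _ _) _ => //; first by do 3!apply: measurableU => //.
apply: leeD => //.
apply: le_trans (measureU2 _ _ _) _ => //; first by do 2!apply: measurableU => //.
apply: leeD => //.
apply: le_trans (measureU2 _ _ _) _ => //; first exact: measurableU.
apply: leeD => //.
exact: measureU2.
Qed.

End one_sample.

(** * Asymptotic normality given the data *)

Lemma prob_cvg0P d (T : measurableType d) (R : realType) (P : probability T R)
    (A : nat -> set T) : (forall n, measurable (A n)) ->
  P (A n) @[n --> \oo] --> 0%E <->
  forall eta : R, 0 < eta -> \forall n \near \oo, (P (A n) <= eta%:E)%E.
Proof.
move=> mA.
have finP n : P (A n) \is a fin_num by rewrite fin_num_measure.
have E n eta : (`|fine (P (A n))| <= eta) = (P (A n) <= eta%:E)%E.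
  by rewrite ger0_norm ?fine_ge0// -lee_fin fineK.
split=> [/fine_cvgP[_ /cvgr0Pnorm_le h] eta eta0|h].
  by have := h eta eta0; apply: filterS => n; rewrite /= E.
apply/fine_cvgP; split; first exact: nearW.
apply/cvgr0Pnorm_le => eta eta0; have := h eta eta0.
by apply: filterS => n; rewrite /= E.
Qed.

Theorem theorem2 (d : measure_display) (T : measurableType d) (R : realType)
  (P : probability T R) (p : nat)
  (beta : 'cV[R]_p) (sigma : R) (Suu : 'M[R]_p)
  (X U : nat -> T -> 'cV[R]_p) (eps : nat -> T -> R)
  (W : nat -> T -> 'cV[R]_p) (y : nat -> T -> R)
  (model : measurement_error_model P beta sigma Suu X U eps W y)
  (bhat : nat -> T -> 'cV[R]_p)
  (bhatP : forall n, (0 < n)%N ->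
     argmin_estimator (fun w => loss Suu (W ^~ w) (y ^~ w) n) (bhat n))
  (r : nat -> nat) (pi : nat -> nat -> T -> R) (J : nat -> nat -> T -> nat)
  (piP : forall n, (0 < n)%N -> sampling_probs (data_sigma W y n) n (pi n))
  (JP : forall n, (0 < n)%N ->
     drawn_with_replacement P (data_sigma W y n) n (r n) (pi n) (J n))
  (btilde : nat -> T -> 'cV[R]_p)
  (btildeP : forall n, (0 < n)%N ->
     argmin_estimator
       (fun w => subloss Suu (W ^~ w) (y ^~ w) n (r n) (pi n ^~ w) (J n ^~ w))
       (btilde n))
  (A1 : exists2 H : 'M[R]_p, posdef H &
     forall a b, cvg_in_prob P (fun n w => HW Suu (W ^~ w) n a b) (H a b))
  (A2W : bounded_in_prob P (fun n w =>
     (n%:R^-1 * \sum_(i < n) enorm (W i w) ^+ 4)%:E))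
  (A2e : bounded_in_prob P (fun n w =>
     (n%:R^-1 * \sum_(i < n) resid (W ^~ w) (y ^~ w) (bhat n w) i ^+ 4)%:E))
  (A3 : bounded_in_prob P (fun n w =>
     \big[maxe/0%E]_(i < n) (((n%:R * pi n i w)%:E)^-1)%E))
  (A4 : exists2 delta : R, 0 < delta &
     bounded_in_prob P (fun n w =>
       (n%:R^-1 * \sum_(i < n)
          `|resid (W ^~ w) (y ^~ w) (bhat n w) i| `^ (2 + delta)
          * enorm (W i w) `^ (2 + delta))%:E))
  (nondeg : nondegenerate_in_prob P (fun n w =>
     (r n)%:R *: Vc Suu (W ^~ w) (y ^~ w) n (r n) (pi n ^~ w) (bhat n w)))
  (r_infty : r n @[n --> \oo] --> \oo)
  (r_small : (r n)%:R / n%:R @[n --> \oo] --> (0 : R))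
  (Vinvsqrt : nat -> T -> 'M[R]_p)
  (Vinvsqrt_meas : forall n, measurable_mx (Vinvsqrt n))
  (VinvsqrtP : forall n w,
     let V := Vmx Suu (W ^~ w) (y ^~ w) n (r n) (pi n ^~ w) (bhat n w) in
     posdef V -> is_inv_sqrt V (Vinvsqrt n w)) :
  forall (x : 'cV[R]_p) (F : nat -> T -> R),
    (forall n, (0 < n)%N ->
       is_cond_prob P (data_sigma W y n)
         [set w | forall a,
            (Vinvsqrt n w *m (btilde n w - bhat n w)) a 0 <= x a 0]
         (F n)) ->
    cvg_in_prob P F (std_normal_cdf x).
Proof.
have Suus : Suu^T = Suu.
  apply/matrixP => a b; rewrite mxE; apply: EFin_inj.
  by have [_ [_ [_ [[_ cov] _]]]] := model 0%N; rewrite -!cov covarianceC.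
have mW i : measurable_mx (W i).
  have [[mX mU _] [[_ WE] _]] := model i.
  move=> a b; rewrite (_ : (fun w => _) = (fun w => (X i w + U i w) a b)).
    exact: measurable_mxD.
  by apply/funext => w; rewrite WE.
have my i : measurable_fun [set: T] (y i).
  have [[mX mU me] [[yE _] _]] := model i.
  rewrite (_ : y i = (fun w => dot (X i w) beta + eps i w)); last exact/funext.
  apply: measurable_funD => //.
  by apply: (@measurable_dot _ T R p (X i) (fun=> beta)).
move=> x F FP e e0.
have [H posH HWcvg] := A1; have [delta d0 A4d] := A4.
have [cH cH0 coH] := posdef_coercive _ posH.
have p10 : 0 < p%:R + 1 :> R by rewrite ltr_wpDl.
(* A perturbation of the entries by e1 leaves at least half of the coercivity
   of the limit Hessian. *)
pose e1 := cH / (2 * (p%:R + 1)).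
have e10 : 0 < e1 by rewrite divr_gt0// mulr_gt0.
have gens_m n : data_sigma W y n `<=` measurable.
  apply: gen_measurable => _ [f [B [[i _ Ff] mB ->]]].
  rewrite -[X in measurable X]setTI.
  by case: Ff => [[a ->]|->]; [exact: mW|exact: my].
have mF n : (0 < n)%N -> measurable_fun [set: T] (F n).
  move=> n0 _ B mB; rewrite setTI; apply: (gens_m n).
  by case: (FP n n0) => mF _ _; exact: mF.
have mdev n : (0 < n)%N -> measurable [set w | e < `|F n w - std_normal_cdf x|].
  move=> n0; apply: measurable_lt_set; first exact: measurable_cst.
  apply: measurable_fun_norm; apply: measurable_funB; last exact: measurable_cst.
  exact: mF.
have mHdev n a b (e' : R) : measurable [set w | e' < `|HW Suu (W ^~ w) n a b - H a b|].
  apply: measurable_lt_set; first exact: measurable_cst.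
  apply: measurable_fun_norm; apply: measurable_funB; last exact: measurable_cst.
  by apply: measurable_HW.
suff near_le (eta : R) : 0 < eta ->
    \forall n \near \oo, (P [set w | (e < `|F n w - std_normal_cdf x|)%R] <= eta%:E)%E.
  pose A n := if (0 < n)%N then [set w | e < `|F n w - std_normal_cdf x|] else set0.
  have mA n : measurable (A n) by rewrite /A; case: ltnP => // n0; exact: mdev.
  have AE : \forall n \near \oo, A n = [set w | e < `|F n w - std_normal_cdf x|].
    by exists 1%N => // n /= n1; rewrite /A n1.
  have : P (A n) @[n --> \oo] --> 0%E.
    apply/prob_cvg0P => // eta eta0; have := near_le _ eta0.
    by apply: filterS2 AE => n ->.
  apply: cvg_trans; apply: near_eq_cvg.
  by apply: filterS AE => n ->.
move=> eta0.
(* One fifth of eta for each of the five terms of good_event_compl. *)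
pose eta5 := eta / 5.
have eta50 : 0 < eta5 by rewrite divr_gt0.
have [M2 near2] := A2W _ eta50.
have [M3 near3] := A3 _ eta50.
have [M4 near4] := A4d _ eta50.
have [c' c'0 near5] := nondeg _ eta50.
pose eab := eta5 / (p%:R ^+ 2 + 1).
have p210 : 0 < p%:R ^+ 2 + 1 :> R by rewrite ltr_wpDl// sqr_ge0.
have eab0 : 0 < eab by rewrite divr_gt0.
have near1 : \forall n \near \oo, forall a b,
    (P [set w | (e1 < `|HW Suu (W ^~ w) n a b - H a b|)%R] <= eab%:E)%E.
  apply: filter_forall => a; apply: filter_forall => b.
  by apply: (iffLR (prob_cvg0P _ _ _ P _ _)) => //; exact: (HWcvg a b e1 e10).
pose c := Num.min (cH / 2) c'.
have c0 : 0 < c by rewrite lt_min c'0 andbT divr_gt0.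
have cc' : c <= c' by rewrite ge_min lexx orbT.
pose HM := \sum_a \sum_b `|H a b| + e1.
pose M := 1 + `|M2| + `|M3| + `|M4| + HM.
have HM0 : 0 <= HM.
  by rewrite addr_ge0 ?(ltW e10)//; apply: sumr_ge0 => a _; exact: sumr_ge0.
have [M1 M2M M3M M4M HMM] : [/\ 1 <= M, M2 <= M, M3 <= M, M4 <= M & HM <= M].
  have := ler_norm M2; have := ler_norm M3; have := ler_norm M4.
  have := normr_ge0 M2; have := normr_ge0 M3; have := normr_ge0 M4.
  by split; rewrite /M; lra.
have Hclose (A : 'M[R]_p) : (forall a b, `|A a b - H a b| <= e1) ->
    coercive c A /\ entries_le A M.
  move=> AH; split.
    have hA := coercive_perturb _ _ _ _ coH AH.
    move=> u; apply: le_trans (hA u); rewrite ler_wpM2r ?sqr_ge0//.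
    apply: (@le_trans _ _ (cH / 2)); first by rewrite ge_min lexx.
    have : p%:R * e1 <= cH / 2.
      have <- : (p%:R + 1) * e1 = cH / 2 by rewrite /e1; field; rewrite gt_eqF.
      by rewrite ler_pM2r// lerDl.
    lra.
  move=> a b; apply: le_trans HMM; rewrite -[A a b](subrK (H a b)) /HM addrC.
  apply: le_trans (ler_normD _ _) _; apply: lerD => //.
  rewrite (bigD1 a)//= (bigD1 b)//= -addrA lerDl addr_ge0//; first exact: sumr_ge0.
  by apply: sumr_ge0 => ? _; exact: sumr_ge0.
have e20 : 0 < e / 2 by rewrite divr_gt0.
have [et [rho [K [R0 [et0 rho0 K0 draws]]]]] :=
  draws_of_good c M delta x (e / 2) c0 M1 d0 e20.
have nearr : \forall n \near \oo, (0 < r n)%N /\ R0 <= (r n)%:R.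
  have /cvgnyPge/(_ (maxn 1 (Num.truncn R0).+1)) := r_infty.
  apply: filterS => n; rewrite geq_max => /andP[r1 r2]; split=> //.
  by rewrite (le_trans (ltW (truncnS_gt R0)))// ler_nat.
have near0 : \forall n \near \oo, (0 < n)%N by exists 1%N.
near=> n.
have n0 : (0 < n)%N by near: n.
have [r0 rR] : (0 < r n)%N /\ R0 <= (r n)%:R by near: n.
have [spi_m spi0 spi1] := piP n n0.
pose good_ev := good_event d T R p n (r n) Suu W y (pi n) c M delta e1 H.
have goodP w : good_ev w ->
    good c M delta n (r n) Suu (W ^~ w) (y ^~ w) (pi n ^~ w) (bhat n w).
  exact: (good_eventP _ _ _ _ _ _ _ _ _ _ _ Suus (bhatP n n0) _ _ _ _ _ c0 Hclose).
have rootP w : good_ev w ->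
    is_inv_sqrt (Vmx Suu (W ^~ w) (y ^~ w) n (r n) (pi n ^~ w) (bhat n w)) (Vinvsqrt n w).
  by move=> gw; apply: VinvsqrtP; apply: (good_V_posdef c M delta) => //; exact: goodP.
have D w (gw : good_ev w) := draws n (r n) Suu (W ^~ w) (y ^~ w) (pi n ^~ w) (bhat n w)
  (Vinvsqrt n w) Suus r0 n0 (fun i => spi0 i w) (spi1 w) (goodP w gw) (rootP w gw) rR.
have mgood : measurable good_ev.
  exact: (gens_m n _ (good_event_G _ _ _ _ _ _ _ _ _ _ (piP n n0) _ _ _ _ _)).
have nul : P (good_ev `&` [set w | e / 2 + e / 2 < `|F n w - std_normal_cdf x|]) = 0%E.
  apply: (cond_cdf_near d T R P p n (r n) Suu W y (pi n) (J n) (bhat n) (btilde n)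
    (Vinvsqrt n) r0 Suus mW my (bhatP n n0) (piP n n0) (JP n n0) (btildeP n n0)
    (Vinvsqrt_meas n) (VinvsqrtP n) c M delta e1 H c0 Hclose x (e / 2) et rho K e20).
  - by move=> w gw j I b; have [h _ _] := D w gw; exact: h.
  - by move=> w gw; have [_ h _] := D w gw.
  - by move=> w gw; have [_ _ h] := D w gw.
  - exact: FP.
rewrite -splitr in nul.
have mdn := mdev n n0.
have compl := good_event_compl d T R P p n (r n) Suu W y (pi n) (bhat n) n0 Suus mW my
  (bhatP n n0) (piP n n0) c M delta e1 H c0 Hclose M2 M3 M4 c' M2M M3M M4M cc'.
apply: (@le_trans _ _ (P (~` good_ev))).
  rewrite -[leRHS]add0e -nul; apply: le_trans (measureU2 _ _ _) => //; last 2 first.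
  - exact: measurableI.
  - exact: measurableC.
  apply: le_measure; rewrite ?inE//.
    by apply: measurableU; [exact: measurableI|exact: measurableC].
  by move=> w hw; have [gw|gw] := EM (good_ev w); [left|right].
apply: (le_trans compl).
have -> : eta%:E = (eta5%:E + (eta5%:E + (eta5%:E + (eta5%:E + eta5%:E))))%E.
  by rewrite -!EFinD /eta5; congr (_%:E); field.
apply: leeD.
  apply: (@le_trans _ _ (\sum_(a < p) \sum_(b < p) eab%:E)%E).
    apply: lee_sum => a _; apply: lee_sum => b _.
    have : forall a b, (P [set w | (e1 < `|HW Suu (W ^~ w) n a b - H a b|)%R] <= eab%:E)%E.
      by near: n.
    exact.
  under eq_bigr do rewrite sumEFin.
  rewrite sumEFin lee_fin !sumr_const card_ord -mulrnA -[X in X <= _]mulr_natl natrM.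
  rewrite /eab mulrCA ler_piMr ?(ltW eta50)// ler_pdivrMr// mul1r expr2 lerDl.
  exact: ler01.
apply: leeD; first by near: n.
apply: leeD; first by near: n.
by apply: leeD; near: n.
Unshelve. all: by end_near.
Qed.
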